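(* There is a ribbon torus knot $R$ such that $\mathrm{Tube}^{-1}(R)$ contains inequivalent welded knots; that is, there exist welded knots $K, L$ which are not welded equivalent and such that $\mathrm{Tube}(K)\cong R\cong\mathrm{Tube}(L)$.
   Context: All knots are oriented and one-component, surface knots are oriented, and all isotopies preserve orientation; $\cong$ for surfaces denotes ambient isotopy of oriented surfaces in $S^4$. A ribbon torus knot is an oriented torus embedded in $S^4$ that bounds an immersed solid torus whose only singularities are ribbon singularities. Welded knots. A welded knot diagram is a generic immersion of an oriented circle in $\mathbb{R}^2$ in which each double point is marked either as a classical crossing (with over/under information) or as a welded (virtual) crossing. A welded knot is an equivalence class of such diagrams (welded equivalence) under planar isotopy and the welded Reidemeister moves: the three classical Reidemeister moves; the three analogous moves in which all crossings are welded; the mixed move sliding a strand that has only welded crossings past a classical crossing; and the ''forbidden'' move sliding a strand that passes over two other strands (at two classical crossings) across a welded crossing of those two strands. The map $\mathrm{Tube}$ (Satoh). Given a welded knot diagram of $K$ in $\mathbb{R}^2\subset\mathbb{R}^3$, write $\mathbb{R}^4=\mathbb{R}^3\times\mathbb{R}$ with the last coordinate the height, and build a surface in $\mathbb{R}^4\subset S^4$ from its projection to $\mathbb{R}^3$: replace every strand by a thin tube around it, at constant height away from crossings. At a welded crossing the two tubes are made disjoint in $\mathbb{R}^3$ by pushing one past the other (which one is immaterial). At a classical crossing the tube $T$ of the under-strand is made thinner and passes straight through the tube $F$ of the over-strand, meeting $F$ in two circles, each bounding a disk in $F$, one on the left side and one on the right side of the oriented over-strand; heights are chosen so that $T$ is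 below $F$ at the left circle and above $F$ at the right circle. The resulting embedded torus, oriented so that its normal vector in $\mathbb{R}^3$ points outward from the tube, is $\mathrm{Tube}(K)$. It is a ribbon torus knot whose isotopy class depends only on the welded knot $K$. $\mathrm{Tube}^{-1}(R)$ is the set of welded knots $K$ with $\mathrm{Tube}(K)\cong R$. *)

(* Defs.v *)
From HB Require Import structures.
From Stdlib Require Import Relation_Operators.
From mathcomp Require Import all_boot all_order all_algebra.
From mathcomp Require Import all_classical all_reals all_analysis.

Set Implicit Arguments.
Unset Strict Implicit.
Unset Printing Implicit Defensive.

Import Order.TTheory GRing.Theory Num.Theory.
Import numFieldNormedType.Exports.

Local Open Scope classical_set_scope.
Local Open Scope ring_scope.

(* Everything is in the smooth category.  In finite dimension, a map is C^k iff
   its iterated directional derivatives up to order k exist and are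
   continuous. *)
Fixpoint Ck (R : realType) (V W : normedModType R) (k : nat) (f : V -> W)
    : Prop :=
  if k is k'.+1 then
    forall v, (forall x, derivable f x v) /\ Ck k' ('D_v f)
  else continuous f.

Definition smooth (R : realType) (V W : normedModType R) (f : V -> W) : Prop :=
  forall k, Ck k f.

Definition immersive_at (R : realType) (V W : normedModType R) (f : V -> W)
    (x : V) : Prop :=
  forall v, 'D_v f x = 0 -> v = 0.

(* The circle is R/Z; maps out of it, and out of S^1 x S^1 and S^1 x D^2, are
   periodic maps out of the universal cover. *)
Definition cong1 (R : realType) (s t : R) : bool := s - t \is a Num.int.

Definition periodic1 (R : realType) (T : Type) (f : R -> T) : Prop :=
  forall s t, cong1 s t -> f s = f t.

Definition normsq (R : realType) (p : R * R) : R := p.1 ^+ 2 + p.2 ^+ 2.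

Definition det2 (R : realType) (p q : R * R) : R := p.1 * q.2 - p.2 * q.1.

Definition disc (R : realType) : set (R * R) := [set p | normsq p <= 1].
Definition open_disc (R : realType) : set (R * R) := [set p | normsq p < 1].
Definition circle (R : realType) : set (R * R) := [set p | normsq p = 1].

(* A smooth ambient isotopy of [X] (a closed submanifold of [V]), represented by
   a smooth extension to [R * V]; [G] extends the levelwise inverses. *)
Definition ambient_isotopy (R : realType) (V : normedModType R) (X : set V)
    (H : R * V -> V) : Prop :=
  [/\ smooth H, (forall x, X x -> H (0, x) = x) &
      exists2 G : R * V -> V, smooth G &
        forall t x, 0 <= t <= 1 -> X x ->
          [/\ X (H (t, x)), X (G (t, x)),
              G (t, H (t, x)) = x & H (t, G (t, x)) = x]].

(** Welded knots *)

Definition crossing (R : realType) (c : R -> R * R) (s t : R) : Prop :=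
  c s = c t /\ ~~ cong1 s t.

(* [over s t] means that the crossing with preimages [s] and [t] is classical
   and that the strand at [s] is the over-strand; a double point that is marked
   in neither order is a welded crossing. *)
Record welded_diagram (R : realType) := WeldedDiagram {
  curve :> R -> R * R;
  over : R -> R -> Prop;
  curve_smooth : smooth curve;
  curve_periodic : periodic1 curve;
  curve_immersive : forall s, derive1 curve s != 0;
  curve_transverse : forall s t, crossing curve s t ->
    det2 (derive1 curve s) (derive1 curve t) != 0;
  curve_no_triple : forall s t u,
    crossing curve s t -> crossing curve s u -> cong1 t u;
  over_crossing : forall s t, over s t -> crossing curve s t;
  over_asym : forall s t, over s t -> ~ over t s;
  over_periodic : forall s s' t t',
    cong1 s s' -> cong1 t t' -> over s t -> over s' t'
}.

Definition welded (R : realType) (D : welded_diagram R) (s t : R) : Prop :=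
  [/\ crossing D s t, ~ over D s t & ~ over D t s].

(* For [over D s t], this is the sign of the crossing. *)
Definition xsign (R : realType) (D : welded_diagram R) (s t : R) : R :=
  Num.sg (det2 (derive1 D s) (derive1 D t)).

Definition planar_isotopy (R : realType) (D E : welded_diagram R) : Prop :=
  exists (H : R * (R * R) -> R * R) (g : R -> R),
    [/\ ambient_isotopy setT H,
        [/\ smooth g, (forall s, 0 < derive1 g s) &
            forall s, g (s + 1) = g s + 1],
        (forall s, H (1, D s) = E (g s)) &
        forall s t, over D s t <-> over E (g s) (g t)].

Definition outside (R : realType) (k : nat) (a b : 'I_k -> R) (s : R) : Prop :=
  forall i t, a i <= t <= b i -> ~~ cong1 s t.

(* [D] and [E] coincide except for [k] arcs, parametrized by the intervals
   [a i, b i], which are the intersections of both with a smooth closed disc,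
   the image of [phi]. *)
Definition local_change (R : realType) (k : nat) (a b : 'I_k -> R)
    (D E : welded_diagram R) : Prop :=
  [/\ (forall i, a i < b i),
      (forall i j s t, a i <= s <= b i -> a j <= t <= b j ->
         cong1 s t -> i = j /\ s = t),
      (forall s, outside a b s -> D s = E s),
      (forall s t, outside a b s -> outside a b t -> over D s t <-> over E s t)
    & exists phi : R * R -> R * R,
      [/\ smooth phi, (forall p, disc p -> immersive_at phi p),
          {in @disc R &, injective phi},
          (forall s, outside a b s -> ~ (phi @` @disc R) (D s)) &
          forall i (F : welded_diagram R), F = D \/ F = E ->
            [/\ (phi @` @circle R) (F (a i)), (phi @` @circle R) (F (b i)) &
                forall s, a i < s < b i -> (phi @` @open_disc R) (F s)]]].

Definition move1 (R : realType) (D E : welded_diagram R) : Prop :=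
  exists (a b : 'I_1 -> R), local_change a b D E /\
    (forall i s t, a i <= s <= b i -> a i <= t <= b i -> ~ crossing D s t) /\
    exists s0 t0 : R, [/\ a ord0 <= s0, s0 < t0, t0 <= b ord0 &
      forall i s t, a i <= s <= b i -> a i <= t <= b i -> s < t ->
        (crossing E s t <-> s = s0 /\ t = t0)].

(* Two disjoint arcs in a disc are replaced by two embedded arcs crossing twice.
   The two crossings bound a bigon, so they have opposite signs with respect to
   the ordered pair of arcs. *)
Definition move2 (R : realType) (D E : welded_diagram R) : Prop :=
  exists (a b : 'I_2 -> R), local_change a b D E /\
    (forall i j s t, a i <= s <= b i -> a j <= t <= b j -> ~ crossing D s t) /\
    exists (i j : 'I_2) (s1 s2 t1 t2 : R), i != j /\
      [/\ (a i <= s1 <= b i /\ a i <= s2 <= b i),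
          (a j <= t1 <= b j /\ a j <= t2 <= b j),
          (forall k s t, a k <= s <= b k -> a k <= t <= b k ->
             ~ crossing E s t),
          (forall s t, a i <= s <= b i -> a j <= t <= b j ->
             (crossing E s t <-> s = s1 /\ t = t1 \/ s = s2 /\ t = t2)) &
          s1 != s2 /\ xsign E s1 t1 = - xsign E s2 t2 /\
          (over E s1 t1 /\ over E s2 t2 \/ welded E s1 t1 /\ welded E s2 t2)].

(* Three embedded arcs in a disc, arcs [i] and [j] crossing exactly once, at
   parameter [x i j] of arc [i] and [x j i] of arc [j]. *)
Definition triangle (R : realType) (a b : 'I_3 -> R) (D : welded_diagram R)
    (x : 'I_3 -> 'I_3 -> R) : Prop :=
  (forall i j, i != j -> a i <= x i j <= b i) /\
  (forall i j s t, a i <= s <= b i -> a j <= t <= b j ->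
     (crossing D s t <-> [/\ i != j, s = x i j & t = x j i])).

(* The allowed markings, in order: classical Reidemeister III, its welded
   analogue, the mixed move, the move with strand [i] passing over a welded
   crossing. *)
Definition triangle_marking (R : realType) (D : welded_diagram R)
    (x : 'I_3 -> 'I_3 -> R) : Prop :=
  let o i j := over D (x i j) (x j i) in
  let w i j := welded D (x i j) (x j i) in
  exists i j k : 'I_3, uniq [:: i; j; k] /\
    ([/\ o i j, o i k & o j k] \/ [/\ w i j, w i k & w j k] \/
     [/\ w i j, w i k & o j k] \/ [/\ o i j, o i k & w j k]).

(* Up to isotopy rel boundary there are exactly two configurations of three
   embedded arcs with given endpoints, pairwise crossing once in a disc; passing
   from one to the other keeps the crossing signs and reverses, on every arc,
   the order of its two crossings. *)
Definition move3 (R : realType) (D E : welded_diagram R) : Prop :=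
  exists (a b : 'I_3 -> R) (x y : 'I_3 -> 'I_3 -> R),
    [/\ local_change a b D E, triangle a b D x, triangle a b E y,
        triangle_marking D x &
        (forall i j, i != j ->
           (over D (x i j) (x j i) <-> over E (y i j) (y j i)) /\
           xsign D (x i j) (x j i) = xsign E (y i j) (y j i)) /\
        (forall i j k, uniq [:: i; j; k] ->
           (x i j < x i k <-> y i k < y i j))].

Definition welded_step (R : realType) (D E : welded_diagram R) : Prop :=
  planar_isotopy D E \/ move1 D E \/ move2 D E \/ move3 D E.

Definition welded_equiv (R : realType)
    : welded_diagram R -> welded_diagram R -> Prop :=
  clos_refl_sym_trans (welded_diagram R) (@welded_step R).

Record welded_knot (R : realType) := WeldedKnot {
  diagrams :> set (welded_diagram R);
  diagrams_class : exists D, diagrams = [set E | welded_equiv D E]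
}.

(** Torus knots in the 4-sphere *)

Definition dot (R : realType) (n : nat) (u v : 'rV[R]_n) : R :=
  \sum_i u ord0 i * v ord0 i.

Definition sphere4 (R : realType) : set 'rV[R]_5 := [set x | dot x x = 1].

(* Inverse stereographic projection, the inclusion of R^4 into S^4. *)
Definition stereo (R : realType) (x : 'rV[R]_4) : 'rV[R]_5 :=
  (dot x x + 1)^-1 *:
    (row_mx (2 *: x) (const_mx (dot x x - 1) : 'rV[R]_1) : 'rV[R]_(4 + 1)).

(* An oriented torus embedded in S^4, given by a parametrization, whose
   orientation is the image of the standard orientation of R^2. *)
Record torus_knot (R : realType) := TorusKnot {
  torus_map :> R * R -> 'rV[R]_5;
  torus_smooth : smooth torus_map;
  torus_sphere : forall p, sphere4 (torus_map p);
  torus_embedded : forall p q,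
    torus_map p = torus_map q <-> cong1 p.1 q.1 /\ cong1 p.2 q.2;
  torus_immersive : forall p, immersive_at torus_map p
}.

(* [g] is the lift to R^2 of a diffeomorphism of the torus: [S] and [T] being
   embeddings, the equation forces [g] to induce an injective local
   diffeomorphism of the torus, hence a diffeomorphism. *)
Definition torus_isotopic (R : realType) (S T : torus_knot R) : Prop :=
  exists (H : R * 'rV[R]_5 -> 'rV[R]_5) (g : R * R -> R * R),
    [/\ ambient_isotopy (@sphere4 R) H, smooth g,
        (forall p, 0 < det2 ('D_(1, 0) g p) ('D_(0, 1) g p)) &
        forall p, H (1, S p) = T (g p)].

Definition solid_cong (R : realType) (p q : R * (R * R)) : Prop :=
  cong1 p.1 q.1 /\ p.2 = q.2.

(* [Phi] is an immersion of the solid torus S^1 x D^2 whose double points are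
   transverse and form finitely many disjoint discs; the preimage of the i-th
   one consists of the properly embedded disc [al i] and the interior disc
   [be i]. *)
Definition ribbon_immersion (R : realType) (Phi : R * (R * R) -> 'rV[R]_5)
    : Prop :=
  let V : set (R * (R * R)) := [set p | disc p.2] in
  [/\ smooth Phi, (forall p q, solid_cong p q -> Phi p = Phi q),
      (forall p, V p -> sphere4 (Phi p) /\ immersive_at Phi p),
      (forall p q, V p -> V q -> ~ solid_cong p q -> Phi p = Phi q ->
         forall w, dot w (Phi p) = 0 ->
           exists u v, w = 'D_u Phi p + 'D_v Phi q) &
      exists (n : nat) (al be : 'I_n -> R * R -> R * (R * R)),
      [/\ (forall i, smooth (al i) /\ smooth (be i)),
          (forall i x, disc x -> immersive_at (al i) x /\
                                 immersive_at (be i) x),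
          (forall i x, disc x ->
             [/\ V (al i x), circle (al i x).2 <-> circle x &
                 open_disc (be i x).2]),
          (forall i j x y, disc x -> disc y ->
             [/\ solid_cong (al i x) (al j y) -> i = j /\ x = y,
                 solid_cong (be i x) (be j y) -> i = j /\ x = y &
                 ~ solid_cong (al i x) (be j y)]) &
          forall p q, V p -> V q -> ~ solid_cong p q ->
            (Phi p = Phi q <->
             exists i x, disc x /\
               (solid_cong p (al i x) /\ solid_cong q (be i x) \/
                solid_cong p (be i x) /\ solid_cong q (al i x)))]].

Definition ribbon (R : realType) (S : torus_knot R) : Prop :=
  exists2 Phi, ribbon_immersion Phi &
    range S = Phi @` [set p : R * (R * R) | circle p.2].

(** The Tube map *)

Definition unit_normal (R : realType) (c : R -> R * R) (s : R) : R * R :=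
  let d := derive1 c s in (Num.sqrt (normsq d))^-1 *: (- d.2, d.1).

(* The disc of radius [r s] at parameter [s] of the solid tube in R^3, whose
   core is the diagram pushed to altitude [z s].  The first coordinate of [p] is
   positive on the left side of the strand. *)
Definition tube_disc (R : realType) (c : R -> R * R) (r z : R -> R) (s : R)
    (p : R * R) : (R * R) * R :=
  (c s + (r s * p.1) *: unit_normal c s, z s + r s * p.2).

(* The direction is chosen so that, outward normal first, the derivatives along
   the strand and along the meridian form a positive frame of R^3. *)
Definition meridian (R : realType) (v : R) : R * R :=
  (sin (2 * pi * v), cos (2 * pi * v)).

(* At a classical crossing the piece of tube F around [o] is crossed by the piece
   T around [u].  Each line of T (fixed meridian coordinate [v]) is inside the
   solid tube of F exactly between the parameters [tL] and [tR], where it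
   meets F on its left and on its right side.  F is at height 0. *)
Definition tube_crossing (R : realType) (c : R -> R * R) (r z h : R -> R)
    (e o u : R) : Prop :=
  (forall s t, `|s - o| <= e -> `|t - u| <= e -> r t < r s) /\
  forall v,
    let hit t s p :=
      `|s - o| <= e /\ tube_disc c r z s p = tube_disc c r z t (meridian v) in
    exists tL tR, [/\ `|tL - u| <= e, `|tR - u| <= e, h tL < 0 < h tR,
      (forall t, `|t - u| <= e ->
         ((exists s p, disc p /\ hit t s p) <-> (t - tL) * (t - tR) <= 0)) &
      forall t, `|t - u| <= e ->
        [/\ (exists s p, [/\ circle p, hit t s p & 0 < p.1]) <-> t = tL,
            (exists s p, [/\ circle p, hit t s p & p.1 < 0]) <-> t = tR &
            forall s p, circle p -> hit t s p -> p.1 != 0]].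

(* Windows of half-width [e] around the preimages of the crossings are disjoint;
   the solid tube in R^3 meets itself only at classical crossings, in these
   windows, and the height is 0 away from the under-strands of these. *)
Definition tube_data (R : realType) (D : welded_diagram R) (r z h : R -> R)
    : Prop :=
  [/\ (smooth r /\ smooth z /\ smooth h),
      (periodic1 r /\ periodic1 z /\ periodic1 h),
      (forall s, 0 < r s) &
      exists2 e : R, 0 < e &
      let pass s t :=
        exists o u, [/\ over D o u, `|s - o| <= e & `|t - u| <= e] in
      [/\ (forall s s' t t', crossing D s s' -> crossing D t t' -> s != t ->
             2 * e < `|s - t|),
          (forall s t p q, disc p -> disc q ->
             tube_disc D r z s p = tube_disc D r z t q ->
             [\/ cong1 s t, pass s t | pass t s]),
          (forall t, (forall o u, over D o u -> e < `|t - u|) -> h t = 0) &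
          forall o u, over D o u -> tube_crossing D r z h e o u]].

Definition is_tube (R : realType) (D : welded_diagram R) (T : torus_knot R)
    : Prop :=
  exists r z h : R -> R, tube_data D r z h /\
    forall s v,
      let p := tube_disc D r z s (meridian v) in
      T (s, v) = stereo (\row_i [:: p.1.1; p.1.2; p.2; h s]`_i).

Definition Tube_isotopic (R : realType) (K : welded_knot R) (S : torus_knot R)
    : Prop :=
  exists D T, [/\ diagrams K D, is_tube D T & torus_isotopic T S].

Definition Tube_fiber (R : realType) (S : torus_knot R)
    : set (welded_knot R) :=
  [set K | Tube_isotopic K S].

(* Main.v *)
From mathcomp Require Import all_boot all_order all_algebra all_fingroup.
From mathcomp Require Import all_classical all_reals all_analysis.
From mathcomp Require Import zify ring lra.
From Stdlib Require Import Lia.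
Require Import Defs.

(** Reflect a diagram in the first axis and run it backwards; call the result its
    mirror image.  The half-turn [(y, z) |-> (- y, - z)] of three-space carries the
    tube of the diagram to the tube of the mirror image, outward normal to outward
    normal, and it does not change the heights.  It exchanges the left and right
    sides of every over-strand with respect to the old direction, and so it keeps
    them with respect to the reversed one: the convention at classical crossings
    holds again ([mirror_tube_data]).  The half-turn is the end of a rotation of the
    sphere, and on the torus it becomes [(s, v) |-> (- s, 1/2 - v)], which preserves
    the orientation.  Hence the tubes of a diagram and of its mirror image are
    isotopic ([mirror_isotopic]), and the theorem follows from the existence of a
    welded knot that is not equivalent to its mirror image.

    The invariant that distinguishes them is [developable].  Colour the strands of a
    diagram by conjugates of an involution [rho] in a finite group, such that passing
    under a strand of colour [c] turns the colour [x] into [c x c].  This is a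
    homomorphism from the welded knot group that sends meridians to involutions, and
    the invariant records which elements [L] occur as images of the longitude.  It
    does not change under welded equivalence ([welded_equiv_developable]).  As [c] is
    its own inverse, colours depend only on the order of the crossings along the
    strand and on which strand is above: a reflection is invisible, and reversing
    the direction inverts the longitude ([developable_reverse]).  So it suffices that
    [L] occurs for a diagram and that its inverse does not.  In the Mathieu group of
    degree 11 elements of order 8 are not conjugate to their inverses; for a certain
    cyclic sequence of nine arcs such an element occurs, and enumerating all
    colourings shows that its inverse does not ([chiral_longitude]).

    With welded crossings every such sequence is realized by some plane curve.  Here
    it is a Lissajous curve of frequencies 4 and 5, made of triangle waves with
    smoothed corners, nine of whose 31 double points are marked as classical.  It is
    straight near its double points, which are at parameters in 80ths, and the two
    strands are perpendicular there ([crossing_chart]).  Consequently a tube of small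
    radius consists of straight cylinders near a classical crossing, where the
    prescribed position is verified by computation ([liss_tube_crossing]); elsewhere
    a thin tube is disjoint from itself by compactness, the strands at welded
    crossings being moved apart ([tube_disjoint]).  In four-space the solid tube is
    immersed as soon as its radius is less than the radius of curvature
    ([dtube4_inj]), its boundary is embedded, and its double points are nine discs,
    the normal discs at the under-crossings: the torus is ribbon ([phi_ribbon]). *)

Set Implicit Arguments.
Unset Strict Implicit.
Unset Printing Implicit Defensive.
Import Order.TTheory GRing.Theory Num.Theory.
Import numFieldNormedType.Exports.
Local Open Scope classical_set_scope.
Local Open Scope ring_scope.

(** * Smooth maps *)

Section Smooth.
Variable R : realType.

Section Generic.
Variables V W : normedModType R.

Lemma smooth_continuous (f : V -> W) : smooth f -> continuous f.
Proof. by move=> /(_ 0%N). Qed.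

Lemma smooth_derivable (f : V -> W) : smooth f -> forall x v, derivable f x v.
Proof. by move=> sf x v; have /= [+ _] := sf 1%N v; apply. Qed.

Lemma smooth_derive (f : V -> W) v : smooth f -> smooth ('D_v f).
Proof. by move=> sf k; have /= [] := sf k.+1 v. Qed.

(** Smoothness is coinductive: a class of continuous, differentiable functions
   that contains the directional derivatives of its members consists of smooth
   functions.  Most closure properties below exhibit such a
   class. *)
Lemma smooth_coind (P : (V -> W) -> Prop) :
  (forall f, P f -> continuous f /\
     forall v, (forall x, derivable f x v) /\ P ('D_v f)) ->
  forall f, P f -> smooth f.
Proof.
move=> H f Pf k; elim: k f Pf => [|k IH] f /H [cf df] //= v.
by have [? ?] := df v; split => //; exact: IH.
Qed.

Lemma smooth_cst (w : W) : smooth (fun _ : V => w).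
Proof.
apply: (@smooth_coind (fun f => exists w, f = cst w)); last by exists w.
move=> f [{}w ->]; split; first by move=> ?; exact: cvg_cst.
move=> v; split; first by move=> x; exact: derivable_cst.
by exists 0; apply/funext => x; rewrite derive_cst.
Qed.

Lemma smooth_linear (f : {linear V -> W}) : continuous f -> smooth f.
Proof.
move=> cf [//|k] v; split.
  by move=> x; apply: diff_derivable; exact: linear_differentiable.
rewrite (_ : 'D_v f = (fun _ => f v)); first exact: smooth_cst.
apply/funext => x; rewrite deriveE ?diff_lin//.
by exact: linear_differentiable.
Qed.

End Generic.

(** Reduces a directional derivative to a derivative on the line, where the
   chain rule for differentiable maps applies. *)
Lemma derive_line (V U : normedModType R) (g : V -> U) x v :
  'D_v g x = 'D_1 (fun t : R => g (t *: v + x)) 0.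
Proof.
rewrite /derive /=.
have -> : (fun h : R => h^-1 *: (g (h *: v + x) - g x)) =
  (fun h : R => h^-1 *: (g ((h *: 1 + 0) *: v + x) - g (0 *: v + x))).
  by apply/funext => t; rewrite addr0 scale0r add0r [_%:A]mulr1.
by [].
Qed.

Lemma is_derive_chain (V W : normedModType R) (f : V -> R) (h : R -> W) x v df dh :
  is_derive x v f df -> is_derive (f x) 1 h dh ->
  is_derive x v (h \o f) (df *: dh).
Proof.
move=> [f1 f2] [h1 h2].
have d1 : differentiable (fun t : R => f (t *: v + x)) 0.
  by apply/derivable1_diffP; exact: (derivable1P f x v).1 f1.
have d2 : differentiable h (f (0 *: v + x)).
  by rewrite scale0r add0r; apply/derivable1_diffP.
have dc := differentiable_comp d1 d2.
apply: DeriveDef; first by apply/(derivable1P (h \o f) x v).2/derivable1_diffP.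
rewrite derive_line -derive1E derive1E'; last exact: dc.
rewrite (diff_comp d1 d2) /=.
have -> : 'd (fun t : R => f (t *: v + x)) 0 1 = df.
  by rewrite -derive1E' // derive1E -derive_line.
rewrite scale0r add0r -[df]mulr1 linearZ /= -derive1E' ?derive1E ?h2//.
  by rewrite mulr1.
exact/derivable1_diffP.
Qed.

Section Scalar.
Variable V : normedModType R.

(** Closing the smooth functions under the operations and under derivation at
   once: the derivative of a composite is again a composite, which is what
   makes the coinduction go through. *)
Inductive elementary : (V -> R) -> Prop :=
| elem_smooth f : smooth f -> elementary f
| elem_add f g : elementary f -> elementary g -> elementary (fun x => f x + g x)
| elem_mul f g : elementary f -> elementary g -> elementary (fun x => f x * g x)
| elem_comp h f : smooth (h : R -> R) -> elementary f -> elementary (fun x => h (f x))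
| elem_inv f : (forall x, f x != 0) -> elementary f -> elementary (fun x => (f x)^-1)
| elem_sqrt f : (forall x, 0 < f x) -> elementary f ->
    elementary (fun x => Num.sqrt (f x)).

Lemma is_derive_sqrt (f : V -> R) x v df : 0 < f x -> is_derive x v f df ->
  is_derive x v (fun y => Num.sqrt (f y)) (df * (2 * Num.sqrt (f x))^-1).
Proof. by move=> f0 fd; have := is_derive_chain fd (is_derive1_sqrt f0). Qed.

Lemma elementary_derive f : elementary f ->
  continuous f /\ forall v, exists2 g, elementary g & forall x, is_derive x v f (g x).
Proof.
elim=> {f} [f sf|f g _ [cf df] _ [cg dg]|f g ef [cf df] eg [cg dg]|h f sh ef [cf df]
  |f f0 ef [cf df]|f f0 ef [cf df]].
- split; first exact: smooth_continuous.
  move=> v; exists ('D_v f); first exact/elem_smooth/smooth_derive.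
  by move=> x; apply: derivableP; exact: smooth_derivable.
- split; first by move=> x; apply: cvgD; [exact: cf|exact: cg].
  move=> v; have [f' ef' df'] := df v; have [g' eg' dg'] := dg v.
  by exists (fun x => f' x + g' x); [exact: elem_add|move=> x; exact: is_deriveD].
- split; first by move=> x; apply: cvgM; [exact: cf|exact: cg].
  move=> v; have [f' ef' df'] := df v; have [g' eg' dg'] := dg v.
  exists (fun x => f x * g' x + g x * f' x); last by move=> x; exact: is_deriveM.
  by apply: elem_add; exact: elem_mul.
- split; first by move=> x; apply: (@continuous_comp _ _ _ f h); [exact: cf|exact: (smooth_continuous sh)].
  move=> v; have [f' ef' df'] := df v.
  exists (fun x => f' x * 'D_1 h (f x)).
    by apply: elem_mul => //; exact: (elem_comp (smooth_derive (1 : R) sh) ef).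
  by move=> x; apply: (is_derive_chain (df' x)); apply: derivableP; exact: smooth_derivable.
- split; first by move=> x; apply: cvgV; [exact: f0|exact: cf].
  move=> v; have [f' ef' df'] := df v.
  exists (fun x => -1 * ((f x)^-1 * (f x)^-1 * f' x)).
    apply: elem_mul; first exact/elem_smooth/smooth_cst.
    by apply: elem_mul => //; apply: elem_mul; exact: elem_inv.
  move=> x.
  have [d1 d2] := df' x.
  apply: DeriveDef; first exact: derivableV.
  by rewrite deriveV// d2 /GRing.scale /= expr2 invfM; ring.
- split; first by move=> x; apply: (@continuous_comp _ _ _ f Num.sqrt); [exact: cf|exact: sqrt_continuous].
  move=> v; have [f' ef' df'] := df v.
  exists (fun x => f' x * (2 * Num.sqrt (f x))^-1).
    apply: elem_mul => //; apply: elem_inv.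
      by move=> x; rewrite mulf_neq0// gt_eqF// sqrtr_gt0.
    by apply: elem_mul; [exact/elem_smooth/smooth_cst|exact: elem_sqrt].
  by move=> x; exact: is_derive_sqrt.
Qed.

Lemma elementary_smooth f : elementary f -> smooth f.
Proof.
apply: smooth_coind => {}f /elementary_derive[cf df]; split => // v.
have [g eg dg] := df v; split; first by move=> x; have [] := dg x.
by rewrite (_ : 'D_v f = g)//; apply/funext => x; have [] := dg x.
Qed.

Lemma smoothD (f g : V -> R) : smooth f -> smooth g -> smooth (fun x => f x + g x).
Proof. by move=> sf sg; apply/elementary_smooth/elem_add; exact: elem_smooth. Qed.

Lemma smoothM (f g : V -> R) : smooth f -> smooth g -> smooth (fun x => f x * g x).
Proof. by move=> sf sg; apply/elementary_smooth/elem_mul; exact: elem_smooth. Qed.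

Lemma smooth_comp (h : R -> R) (f : V -> R) : smooth h -> smooth f ->
  smooth (fun x => h (f x)).
Proof. by move=> sh sf; apply/elementary_smooth/elem_comp => //; exact: elem_smooth. Qed.

Lemma smoothV (f : V -> R) : (forall x, f x != 0) -> smooth f ->
  smooth (fun x => (f x)^-1).
Proof. by move=> f0 sf; apply/elementary_smooth/elem_inv => //; exact: elem_smooth. Qed.

Lemma smooth_sqrt (f : V -> R) : (forall x, 0 < f x) -> smooth f ->
  smooth (fun x => Num.sqrt (f x)).
Proof. by move=> f0 sf; apply/elementary_smooth/elem_sqrt => //; exact: elem_smooth. Qed.

Lemma smoothN (f : V -> R) : smooth f -> smooth (fun x => - f x).
Proof.
move=> sf; rewrite (_ : (fun x => _) = (fun x => -1 * f x)).
  by apply: smoothM => //; exact: smooth_cst.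
by apply/funext => x; rewrite mulN1r.
Qed.

Lemma smoothB (f g : V -> R) : smooth f -> smooth g -> smooth (fun x => f x - g x).
Proof. by move=> sf sg; apply: smoothD => //; exact: smoothN. Qed.

Lemma smooth_sum (I : Type) (s : seq I) (f : I -> V -> R) :
  (forall i, smooth (f i)) -> smooth (fun x => \sum_(i <- s) f i x).
Proof.
move=> sf; elim: s => [|i s IH].
  rewrite (_ : (fun _ => _) = (fun _ => 0)); first exact: smooth_cst.
  by apply/funext => x; rewrite big_nil.
rewrite (_ : (fun _ => _) = (fun x => f i x + \sum_(j <- s) f j x)).
  exact: smoothD.
by apply/funext => x; rewrite big_cons.
Qed.

Lemma smooth_mx (n : nat) (f : V -> 'rV[R]_n) :
  (forall i, smooth (fun x => f x ord0 i)) -> smooth f.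
Proof.
apply: (@smooth_coind _ _ (fun f : V -> 'rV[R]_n =>
  forall i, smooth (fun x => f x ord0 i))) => {}f sf; split.
  move=> x; apply/cvg_mx_entourageP => A /= eA; apply: filter_forall => i.
  apply: filter_forall => j; rewrite (ord1 i).
  have /cvg_app_entourageP := smooth_continuous (sf j) (x := x).
  by move=> /(_ A eA); apply: filterS => t At; exact/mem_set.
move=> v; have df x : derivable f x v.
  by apply/derivable_mxP => i j; rewrite (ord1 i); exact: smooth_derivable.
split => // i.
rewrite (_ : (fun x => _) = 'D_v (fun x => f x ord0 i)); first exact: smooth_derive.
by apply/funext => x; rewrite derive_mx// mxE.
Qed.

End Scalar.

Section Pair.
Variables (V W1 W2 : normedModType R).

Lemma is_derive_pair (f : V -> W1) (g : V -> W2) x v df dg :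
  is_derive x v f df -> is_derive x v g dg ->
  is_derive x v (fun y => (f y, g y)) (df, dg).
Proof.
move=> [f1 f2] [g1 g2].
have H : (fun h : R => h^-1 *: (((fun y => (f y, g y)) \o shift x) (h *: v) - (f x, g x)))
   @ 0^' --> (df, dg).
  have := cvg_pair (F := 0^') f1 g1.
  rewrite -/(derive f x v) -/(derive g x v) f2 g2.
  by move=> H; exact: (H _ _ _).
by apply: DeriveDef; [apply/cvg_ex; exists (df, dg)|exact: cvg_lim].
Qed.

Lemma smooth_pair (f : V -> W1) (g : V -> W2) :
  smooth f -> smooth g -> smooth (fun x => (f x, g x)).
Proof.
move=> sf sg.
apply: (@smooth_coind _ _ (fun h => exists f g, [/\ smooth f, smooth g & h = fun x => (f x, g x)])); last by exists f, g.
move=> _ [{}f [{}g [{}sf {}sg ->]]]; split.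
  by move=> x; apply: cvg_pair; [exact: (smooth_continuous sf)|exact: (smooth_continuous sg)].
move=> v.
have D x : is_derive x v (fun y => (f y, g y)) ('D_v f x, 'D_v g x).
  by apply: is_derive_pair; apply: derivableP; exact: smooth_derivable.
split; first by move=> x; have [] := D x.
exists ('D_v f), ('D_v g); split; [exact: smooth_derive..|].
by apply/funext => x; have [] := D x.
Qed.

Lemma smooth_fst : smooth (fst : W1 * W2 -> W1).
Proof.
apply: (@smooth_linear _ _ (GRing.Linear.clone _ _ _ _ fst _)).
by move=> x; exact: cvg_fst.
Qed.

Lemma smooth_snd : smooth (snd : W1 * W2 -> W2).
Proof.
apply: (@smooth_linear _ _ (GRing.Linear.clone _ _ _ _ snd _)).
by move=> x; exact: cvg_snd.
Qed.

End Pair.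

Lemma smooth_coord n (i : 'I_n) : smooth (fun x : 'rV[R]_n => x ord0 i).
Proof.
have @f : {linear 'rV[R]_n -> R}.
  by exists (fun N : 'rV[R]_n => N ord0 i); do 2![eexists]; do ?[constructor];
     rewrite ?mxE// => ? *; rewrite ?mxE//; move=> ?; rewrite !mxE.
rewrite (_ : (fun _ => _) = f) //; apply: smooth_linear; exact: coord_continuous.
Qed.

End Smooth.

(** * The circle R/Z *)

Section Circle.
Variable R : realType.
Implicit Types s t u x y : R.

Lemma cong1P s t : reflect (exists n : int, s = t + n%:~R) (cong1 s t).
Proof.
apply: (iffP idP) => [/intrP[n st]|[n ->]]; last by rewrite /cong1 addrC addKr.
by exists n; rewrite -st addrC subrK.
Qed.

Lemma cong1_refl s : cong1 s s.
Proof. by apply/cong1P; exists 0; rewrite addr0. Qed.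

Lemma cong1_sym s t : cong1 s t = cong1 t s.
Proof. by rewrite /cong1 -opprB rpredN. Qed.

Lemma cong1_trans t s u : cong1 s t -> cong1 t u -> cong1 s u.
Proof. by move=> st tu; rewrite /cong1 -(subrKA t) rpredD. Qed.

Lemma cong1DZ s (n : int) : cong1 (s + n%:~R) s.
Proof. by apply/cong1P; exists n. Qed.

Lemma cong1N s t : cong1 (- s) (- t) = cong1 s t.
Proof. by rewrite (cong1_sym s) /cong1 opprK addrC. Qed.

Lemma cong1_small s t : cong1 s t -> `|s - t| < 1 -> s = t.
Proof.
move=> /cong1P[n ->]; rewrite addrC addKr -intr_norm ltrz1 => n1.
by rewrite (_ : n = 0) ?addr0//; lia.
Qed.

Lemma periodic1_step (T : Type) (f : R -> T) :
  (forall s, f (s + 1) = f s) -> periodic1 f.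
Proof.
move=> f1 s t /cong1P[n ->]; have fn (m : nat) u : f (u + m%:R) = f u.
  by elim: m u => [|m IH] u; rewrite ?addr0// -natr1 addrA f1.
case: n => n; first exact: fn.
by rewrite NegzE mulrNz -[LHS](fn n.+1) pmulrn subrK.
Qed.

Definition sn x := sin (2 * pi * x).
Definition cs x := cos (2 * pi * x).

Lemma snD1 x : sn (x + 1) = sn x.
Proof. by rewrite /sn mulrDr mulr1 mulr_natl sinD2pi. Qed.

Lemma csD1 x : cs (x + 1) = cs x.
Proof. by rewrite /cs mulrDr mulr1 mulr_natl cosD2pi. Qed.

Lemma sn_periodic : periodic1 sn. Proof. exact/periodic1_step/snD1. Qed.
Lemma cs_periodic : periodic1 cs. Proof. exact/periodic1_step/csD1. Qed.

Lemma cs2sn2 x : cs x ^+ 2 + sn x ^+ 2 = 1. Proof. exact: cos2Dsin2. Qed.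

Lemma snN x : sn (- x) = - sn x. Proof. by rewrite /sn mulrN sinN. Qed.
Lemma csN x : cs (- x) = cs x. Proof. by rewrite /cs mulrN cosN. Qed.
Lemma cs0 : cs 0 = 1. Proof. by rewrite /cs mulr0 cos0. Qed.

Lemma csB x y : cs (x - y) = cs x * cs y + sn x * sn y.
Proof. by rewrite /cs /sn mulrBr cosB. Qed.

(** The reflection [x |-> - x] of R/Z has the half-circle as fundamental domain.
   The cosine and the triangle wave below are even and injective there, which
   determines their fibres. *)
Lemma fold_half x : exists2 y, 0 <= y <= 1 / 2 & cong1 x y \/ cong1 x (- y).
Proof.
pose f := x - (Num.floor x)%:~R.
have f0 : 0 <= f by rewrite subr_ge0 floor_le.
have f1 : f < 1 by have := floorD1_gt x; rewrite intrD /f => ?; lra.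
have xf : cong1 x f by apply/cong1P; exists (Num.floor x); rewrite subrK.
have [h|h] := lerP f (1 / 2); first by exists f; [rewrite f0|left].
exists (1 - f); first by apply/andP; split; lra.
right; apply: cong1_trans xf _; apply/cong1P; exists 1; rewrite opprB -addrA.
by rewrite addNr addr0.
Qed.

Lemma even_periodic_eq (A : R -> R) : periodic1 A -> (forall x, A (- x) = A x) ->
  {in `[0, 1 / 2] &, injective A} ->
  forall x y, A x = A y -> cong1 x y \/ cong1 x (- y).
Proof.
move=> A1 AN Ai x y.
have [x' x'h xx] := fold_half x; have [y' y'h yy] := fold_half y.
have -> : A x = A x' by case: xx => /A1 ->.
have -> : A y = A y' by case: yy => /A1 ->.
move=> /Ai; rewrite !in_itv /= => /(_ x'h y'h) xy; subst y'.
case: xx => xx; case: yy => yy.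
- by left; apply: cong1_trans xx _; rewrite cong1_sym.
- by right; apply: cong1_trans xx _; rewrite -cong1N opprK cong1_sym.
- right; apply: cong1_trans xx _; rewrite cong1N cong1_sym; exact: yy.
- by left; apply: cong1_trans xx _; rewrite cong1_sym.
Qed.

Lemma cs_inj : {in `[0, 1 / 2] &, injective cs}.
Proof.
have p0 := pi_gt0 R.
have h x : x \in `[0, 1 / 2] -> 2 * pi * x \in `[0, pi].
  rewrite !in_itv /= => /andP[x0 x1]; apply/andP; split; first by rewrite !mulr_ge0// ltW.
  rewrite (_ : 2 * pi * x = pi * (2 * x)); last by ring.
  by rewrite ger_pMr//; lra.
move=> x y /h hx /h hy /cos_inj => /(_ hx hy) /(mulfI _); apply.
by rewrite mulf_neq0// gt_eqF.
Qed.

Lemma cs_eq x y : cs x = cs y -> cong1 x y \/ cong1 x (- y).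
Proof. exact: (even_periodic_eq cs_periodic csN cs_inj). Qed.

Lemma cong1_circle s t : cong1 s t <-> sn s = sn t /\ cs s = cs t.
Proof.
split=> [st|[ss cc]]; first by rewrite (sn_periodic st) (cs_periodic st).
have : cs (s - t) = cs 0 by rewrite csB ss cc cs0 -!expr2 cs2sn2.
by move=> /cs_eq; rewrite oppr0 => -[]; rewrite /cong1 subr0.
Qed.

Lemma smooth_sin : smooth (sin : R -> R).
Proof.
apply: (@smooth_coind _ _ _ (fun f => exists p q : R, f = fun x => p * sin x + q * cos x)); last first.
  by exists 1, 0; apply/funext => x; rewrite mul0r addr0 mul1r.
move=> f [p [q ->]].
have D x : is_derive x 1 (fun x : R => p * sin x + q * cos x) (p * cos x - q * sin x).
  by apply: is_derive_eq; rewrite -![_ *: _]/(_ * _); ring.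
split.
  move=> x; apply: differentiable_continuous; apply/derivable1_diffP.
  by have [] := D x.
move=> v.
have Dv x : is_derive x v (fun x : R => p * sin x + q * cos x) (v * (p * cos x - q * sin x)).
  have := is_derive_chain (is_derive_id x v) (D x); exact.
split; first by move=> x; have [] := Dv x.
exists (- v * q), (v * p); apply/funext => x; have [_ ->] := Dv x; ring.
Qed.

Lemma smooth_scale (p : R) : smooth (fun x : R => p * x).
Proof.
apply: smoothM; first exact: smooth_cst.
apply: (@smooth_linear _ _ _ idfun) => x; exact: cvg_id.
Qed.

Lemma smooth_id : smooth (fun x : R => x).
Proof. apply: (@smooth_linear _ _ _ idfun) => x; exact: cvg_id. Qed.

Lemma smooth_sn : smooth sn.
Proof. exact: (smooth_comp smooth_sin (smooth_scale (2 * pi))). Qed.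

Lemma smooth_cs : smooth cs.
Proof.
have -> : cs = fun x => sn (x + 1 / 4).
  apply/funext => x; have e : 2 * pi * (x + 1 / 4) = 2 * pi * x + pi / 2 by field.
  by rewrite /cs /sn e sinDpihalf.
apply: (smooth_comp smooth_sn); apply: smoothD; [exact: smooth_id|exact: smooth_cst].
Qed.

Lemma sn_gt0 x : 0 < x < 1 / 2 -> 0 < sn x.
Proof.
move=> /andP[x0 x1]; have p0 := pi_gt0 R; apply: sin_gt0_pi; rewrite !mulr_gt0//=.
by rewrite (_ : 2 * pi * x = pi * (2 * x)) ?gtr_pMr//; [lra|ring].
Qed.

(** The circle being compact Hausdorff, the image of a segment is closed; through
   [cong1_circle] this is pulled back to the line. *)
Lemma closed_arc (a b : R) : closed [set s | exists2 t, a <= t <= b & cong1 s t].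
Proof.
pose e (x : R) : R * R := (sn x, cs x).
have ce : continuous e by apply: smooth_continuous; apply: smooth_pair; [exact: smooth_sn|exact: smooth_cs].
have -> : [set s | exists2 t, a <= t <= b & cong1 s t] = e @^-1` (e @` [set` `[a, b]]).
  apply/seteqP; split => s /= [t tab st].
    exists t; first by rewrite in_itv.
    by have [h1 h2] := (cong1_circle s t).1 st; rewrite /e h1 h2.
  exists t; first by rewrite in_itv in tab.
  by apply/cong1_circle; case: st.
apply: preimage_closed; first by move=> x _; exact: ce.
apply: compact_closed; first exact: norm_hausdorff.
apply: continuous_compact; first exact: continuous_subspaceT.
exact: segment_compact.
Qed.

End Circle.

(** * A colouring invariant of welded knots *)

Section OneSided.
Variable R : realType.

Lemma near_rightP (u : R) (P : R -> Prop) :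
  (\forall s \near u^'+, P s) <->
  exists2 d, 0 < d & forall s, u < s < u + d -> P s.
Proof.
split=> [[d /= d0 H]|[d d0 H]].
  exists d => // s /andP[us sd]; apply: (H s) => //=.
  by rewrite ltr_distlC; apply/andP; split; lra.
exists d => // s /=; rewrite ltr_distlC => /andP[_ sd] us; apply: H.
by rewrite us.
Qed.

Lemma near_leftP (u : R) (P : R -> Prop) :
  (\forall s \near u^'-, P s) <->
  exists2 d, 0 < d & forall s, u - d < s < u -> P s.
Proof.
split=> [[d /= d0 H]|[d d0 H]].
  exists d => // s /andP[us sd]; apply: (H s) => //=.
  by rewrite ltr_distlC; apply/andP; split; lra.
exists d => // s /=; rewrite ltr_distlC => /andP[us _] su; apply: H.
by rewrite us.
Qed.

Lemma near_right_shift (u c : R) (P : R -> Prop) :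
  (\forall s \near u^'+, P s) -> \forall s \near (u + c)^'+, P (s - c).
Proof.
move=> /near_rightP[d d0 H]; apply/near_rightP; exists d => // s /andP[h1 h2].
by apply: H; apply/andP; split; lra.
Qed.

Lemma near_left_shift (u c : R) (P : R -> Prop) :
  (\forall s \near u^'-, P s) -> \forall s \near (u + c)^'-, P (s - c).
Proof.
move=> /near_leftP[d d0 H]; apply/near_leftP; exists d => // s /andP[h1 h2].
by apply: H; apply/andP; split; lra.
Qed.

Lemma near_rightW (u : R) (P : R -> Prop) :
  (\forall s \near u, P s) -> \forall s \near u^'+, P s.
Proof. by move=> H; apply: cvg_within. Qed.

Lemma near_leftW (u : R) (P : R -> Prop) :
  (\forall s \near u, P s) -> \forall s \near u^'-, P s.
Proof. by move=> H; apply: cvg_within. Qed.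

End OneSided.

Section LocallyConstant.
Variables (R : realType) (T : Type).

(** A function on a segment that is constant to the right and to the left of
   every point is constant: otherwise comparing its values with the initial one
   gives a continuous function onto a two-point set. *)
Lemma locally_constant (f : R -> T) (x y : R) : x <= y ->
  (forall u, x <= u < y -> \forall s \near u^'+, f s = f u) ->
  (forall u, x < u <= y -> \forall s \near u^'-, f s = f u) -> f y = f x.
Proof.
rewrite le_eqVlt => /predU1P[->//|xy] fr fl.
pose g (s : R) : R := (asbool (f s = f x))%:R.
have gE u s : f s = f u -> g s = g u by rewrite /g => ->.
have cg : {within `[x, y], continuous g}.
  apply/continuous_within_itvP => //; split.
  - move=> u; rewrite in_itv /= => /andP[xu uy].
    apply/left_right_continuousP; split; apply: cvg_near_cst.
      by have := fl u; rewrite xu ltW// => /(_ isT); apply: filterS => s /gE.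
    by have := fr u; rewrite uy ltW// => /(_ isT); apply: filterS => s /gE.
  - apply: cvg_near_cst.
    by have := fr x; rewrite lexx xy => /(_ isT); apply: filterS => s /gE.
  - apply: cvg_near_cst.
    by have := fl y; rewrite lexx xy => /(_ isT); apply: filterS => s /gE.
apply: contrapT => fyx.
have gx : g x = 1 by rewrite /g; case: asboolP.
have gy : g y = 0 by rewrite /g; case: asboolP.
have [|c _] := @IVT _ g x y (1 / 2) (ltW xy) cg.
  by rewrite gx gy min_r ?max_l ?ler01//; apply/andP; split; lra.
by rewrite /g; case: asboolP => _ /=; lra.
Qed.

End LocallyConstant.

Section Developing.
Variables (R : realType) (gT : finGroupType).
Implicit Types (D E : welded_diagram R) (mu : R -> gT) (s t u o : R).
Local Notation "x ** y" := (mulg x y) (at level 40, left associativity).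
Local Notation "x ^^ y" := (conjg x y) (at level 30, right associativity).

Section Fixed.
Variables (rho L : gT).
Hypotheses (rho2 : rho ** rho = 1%g) (rhoL : commute rho L).

(** Colour the strand at [s] by the involution [rho ^ mu s].  Passing under a
   strand of colour [c] multiplies [mu] by [rho] on the left and by [c] on the
   right, so that the colour [x] turns into [c x c]: the colours define a
   homomorphism from the welded knot group that sends meridians to conjugates of
   [rho].  The factor [rho] compensates [c] at a self-crossing of one arc, and so
   [L] is the image of the longitude with the framing that kinks do not change.
   Since colours are involutions, neither the direction of the over-strand nor
   the side from which one passes under it matters. *)
Definition developing D mu : Prop :=
  [/\ (forall u, \forall s \near u^'-, mu s = mu u),
      (forall o u, over D o u ->
         \forall s \near u^'+, mu s = rho ** mu u ** rho ^^ mu o),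
      (forall u, (forall o, ~ over D o u) -> \forall s \near u^'+, mu s = mu u)
    & forall s, mu (s + 1) = L ** mu s].

Definition developable D : Prop := exists mu, developing D mu.

Lemma conj_rho2 g : rho ^^ g ** rho ^^ g = 1%g.
Proof. by rewrite -conjMg rho2 conj1g. Qed.

Lemma jumpK m c : c ** c = 1%g -> rho ** (rho ** m ** c) ** c = m.
Proof. by move=> c2; rewrite !mulgA rho2 mul1g -mulgA c2 mulg1. Qed.

(** The translates of a developing map differ by elements that commute with
   [rho], so that colours are well defined on the circle. *)
Lemma shift_developing mu : (forall s, mu (s + 1) = L ** mu s) ->
  forall n : int, exists g, [/\ commute rho g, commute L g &
    forall s, mu (s + n%:~R) = g ** mu s].
Proof.
move=> muL.
have mun (n : nat) s : mu (s + n%:R) = (L ^+ n)%g ** mu s.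
  elim: n s => [|n IH] s; first by rewrite addr0 expg0 mul1g.
  by rewrite -natr1 addrA muL IH mulgA -expgS.
case=> n.
  exists (L ^+ n)%g; split; [exact: commuteX|exact: commuteX|exact: mun].
exists (L ^- n.+1)%g; split; [exact/commuteV/commuteX|exact/commuteV/commuteX|].
move=> s; rewrite NegzE mulrNz.
by rewrite -[in RHS](subrK n.+1%:R s) mun mulgA mulVg mul1g pmulrn.
Qed.

Lemma cong1_shift mu s t : (forall s, mu (s + 1) = L ** mu s) -> cong1 s t ->
  rho ^^ mu s = rho ^^ mu t.
Proof.
move=> muL /cong1P[n ->]; have [g [cg _ ->]] := shift_developing muL n.
by rewrite conjgM; congr (_ ^^ _); apply/conjg_fixP/commgP.
Qed.

Lemma crossing_sym (c : R -> R * R) s t : crossing c s t -> crossing c t s.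
Proof. by move=> [e n]; split => //; rewrite cong1_sym. Qed.

(** Double points being simple, the over-strand has no jump at a crossing; its
   colour can be read on either side. *)
Lemma over_top D o u o' : over D o u -> ~ over D o' o.
Proof.
move=> ou o'o; have [e n] := over_crossing ou; have [e' n'] := over_crossing o'o.
have uo' : cong1 u o'.
  by apply: (@curve_no_triple _ D o u o'); split => //; rewrite cong1_sym.
apply: (over_asym ou); apply: over_periodic o'o => //; first by rewrite cong1_sym.
exact: cong1_refl.
Qed.

Section LocalChange.
Variables (k : nat) (a b : 'I_k -> R) (D E : welded_diagram R).
Hypothesis DE : local_change a b D E.

Lemma local_change_sym : local_change a b E D.
Proof.
case: DE => h1 h2 h3 h4 [phi [p1 p2 p3 p4 p5]]; split => //.
- by move=> s so; rewrite h3.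
- by move=> s t so to; rewrite h4.
- exists phi; split => //; first by move=> s so; rewrite -h3//; exact: p4.
  by move=> i F [->|->]; apply: p5; [right|left].
Qed.

Lemma outsidePn s : ~ outside a b s -> exists i t, a i <= t <= b i /\ cong1 s t.
Proof.
move=> so; apply: contrapT => H; apply: so => i t it; apply/negP => st.
by apply: H; exists i, t.
Qed.

(** Outside the arcs the curve avoids the disc in which the arcs lie, so that a
   local change does not affect the crossings there. *)
Lemma crossing_outside F s t : F = D \/ F = E -> crossing F s t ->
  outside a b t -> outside a b s.
Proof.
case: DE => h1 h2 h3 h4 [phi [p1 p2 p3 p4 p5]] FDE [e _] to.
have FD u : outside a b u -> F u = D u by move=> uo; case: FDE => -> //; rewrite h3.
apply: contrapT => /outsidePn[i [u [/andP[u1 u2] su]]].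
have [e1 e2 e3] := p5 i F FDE.
apply: (p4 _ to); rewrite -FD// -e (curve_periodic F su).
have sub (P : set (R * R)) : P `<=` @disc R -> (phi @` P) `<=` (phi @` @disc R).
  exact: image_subset.
have cd : @circle R `<=` @disc R by move=> p; rewrite /circle /disc /= => ->.
have od : @open_disc R `<=` @disc R by move=> p; exact: ltW.
move: u1 u2; rewrite !le_eqVlt => /orP[/eqP <- _|u1 /orP[/eqP ->|u2]].
- exact: (sub _ cd).
- exact: (sub _ cd).
- by apply: (sub _ od); apply: e3; rewrite u1.
Qed.

Lemma arc_short i : b i < a i + 1.
Proof.
case: DE => h1 h2 _ _ _; rewrite ltNge; apply/negP => ab.
have c : cong1 (a i) (a i + 1) by rewrite cong1_sym; exact: (cong1DZ _ 1).
have ai : a i <= a i <= b i by rewrite lexx ltW.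
have bi : a i <= a i + 1 <= b i by rewrite ab andbT; lra.
by have [_ /eqP] := h2 _ _ _ _ ai bi c; rewrite -subr_eq0; apply/negP; lra.
Qed.

Lemma near_outside_arc i u : (forall t, a i <= t <= b i -> ~~ cong1 u t) ->
  \forall s \near u, forall t, a i <= t <= b i -> ~~ cong1 s t.
Proof.
move=> H; have := closed_openC (@closed_arc R (a i) (b i)).
rewrite openE => /(_ u); rewrite /interior /= => h.
have /h : ~ (exists2 t : R, a i <= t <= b i & cong1 u t).
  by move=> [t /H/negP].
apply: filterS => s; rewrite /setC /= => hs t ti; apply/negP => st.
by apply: hs; exists t.
Qed.

Lemma near_outside u : outside a b u -> \forall s \near u, outside a b s.
Proof.
move=> uo; have := filter_forall _ (fun i => near_outside_arc (uo i)).
by move=> H; exact: (H _).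
Qed.

Lemma near_left_outside i : \forall s \near (a i)^'-, outside a b s.
Proof.
case: DE => h1 h2 _ _ _.
suff H j : \forall s \near (a i)^'-, forall t, a j <= t <= b j -> ~~ cong1 s t.
  by have := filter_forall _ H => H'; exact: (H' _).
have ai : a i <= a i <= b i by rewrite lexx ltW.
have [->{j}|ji] := eqVneq j i; last first.
  apply: cvg_within; apply: near_outside_arc => t tj; apply/negP => st.
  by have [/eqP] := h2 _ _ _ _ ai tj st; rewrite eq_sym (negbTE ji).
apply/near_leftP; have bs := arc_short i.
exists (a i + 1 - b i); first by lra.
move=> s /andP[s1 s2] t /andP[t1 t2]; apply/negP => st.
by have := cong1_small st; rewrite ltr_distlC => H; have := H _; lra.
Qed.

Lemma near_right_outside i : \forall s \near (b i)^'+, outside a b s.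
Proof.
case: DE => h1 h2 _ _ _.
suff H j : \forall s \near (b i)^'+, forall t, a j <= t <= b j -> ~~ cong1 s t.
  by have := filter_forall _ H => H'; exact: (H' _).
have bi : a i <= b i <= b i by rewrite lexx ltW.
have [->{j}|ji] := eqVneq j i; last first.
  apply: cvg_within; apply: near_outside_arc => t tj; apply/negP => st.
  by have [/eqP] := h2 _ _ _ _ bi tj st; rewrite eq_sym (negbTE ji).
apply/near_rightP; have bs := arc_short i.
exists (a i + 1 - b i); first by lra.
move=> s /andP[s1 s2] t /andP[t1 t2]; apply/negP => st.
by have := cong1_small st; rewrite ltr_distlC => H; have := H _; lra.
Qed.

Section Patch.
Variables (mu : R -> gT) (nu : 'I_k -> R -> gT).
Hypothesis dev : developing D mu.

(** On an arc the patched function is the given one; on the translates of the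
   arc it is corrected by the monodromy, which is what multiplying by
   [mu s ** (mu t)^-1] does. *)
Definition patch s : gT :=
  if pselect (exists it : 'I_k * R, a it.1 <= it.2 <= b it.1 /\ cong1 s it.2)
    is left e then
    let it := projT1 (cid e) in mu s ** (mu it.2)^-1%g ** nu it.1 it.2
  else mu s.

Lemma patch_in s i t : a i <= t <= b i -> cong1 s t ->
  patch s = mu s ** (mu t)^-1%g ** nu i t.
Proof.
case: DE => h1 h2 _ _ _ it st; rewrite /patch; case: pselect => [e|[]]; last first.
  by exists (i, t).
case: (cid e) => -[j t'] /= [jt' st'].
have tt' : cong1 t t' by apply: cong1_trans st'; rewrite cong1_sym.
by have [-> ->] := h2 _ _ _ _ it jt' tt'.
Qed.

Lemma patch_arc i t : a i <= t <= b i -> patch t = nu i t.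
Proof. by move=> it; rewrite (patch_in it (cong1_refl t)) mulgV mul1g. Qed.

Lemma patch_out s : outside a b s -> patch s = mu s.
Proof.
move=> so; rewrite /patch; case: pselect => // e; exfalso; case: e => -[i t] [/= it st].
by have := so _ _ it; rewrite st.
Qed.

Lemma patch_shift s : patch (s + 1) = L ** patch s.
Proof.
have [_ _ _ muL] := dev.
have [so|/outsidePn[i [t [it st]]]] := pselect (outside a b s); last first.
  rewrite (patch_in it st) (@patch_in _ i t it); first by rewrite muL !mulgA.
  by apply: cong1_trans st; exact: (cong1DZ _ 1).
rewrite !patch_out// => i t it; apply: contra (so _ _ it) => st.
by apply: cong1_trans st; rewrite cong1_sym; exact: (cong1DZ _ 1).
Qed.

Hypothesis nua : forall i, nu i (a i) = mu (a i).
Hypothesis nu_left : forall i u, a i < u <= b i ->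
  \forall s \near u^'-, nu i s = nu i u.
(* Just after [b i] the values are those of [mu] again. *)
Let after i u := if u < b i then nu i else mu.
Hypothesis nu_over : forall i j o u, a i <= u <= b i -> a j <= o <= b j ->
  over E o u -> \forall s \near u^'+, after i u s = rho ** nu i u ** rho ^^ nu j o.
Hypothesis nu_free : forall i u, a i <= u <= b i -> (forall o, ~ over E o u) ->
  \forall s \near u^'+, after i u s = nu i u.

Lemma patch_after i u : a i <= u <= b i ->
  \forall s \near u^'+, patch s = after i u s.
Proof.
move=> /andP[u1]; rewrite /after le_eqVlt => /orP[/eqP->|u2].
  rewrite ltxx; apply: filterS (near_right_outside i) => s; exact: patch_out.
rewrite u2; apply/near_rightP; exists (b i - u); first by lra.
by move=> s /andP[s1 s2]; apply: patch_arc; apply/andP; split; lra.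
Qed.

Lemma patch_left u : \forall s \near u^'-, patch s = patch u.
Proof.
have [mul _ _ _] := dev.
have [uo|/outsidePn[i [t [/andP[t1 t2] /cong1P[n ->]]]]] := pselect (outside a b u).
  have := near_leftW (near_outside uo).
  apply: filterS2 (mul u) => s su so; by rewrite !patch_out.
have [g [_ _ pg]] := shift_developing patch_shift n.
suff H : \forall s \near t^'-, patch s = patch t.
  have := near_left_shift (n%:~R) H; apply: filterS => s sH.
  by rewrite -{1}(subrK n%:~R s) !pg sH.
have [h1 _ _ _ _] := DE.
move: t1; rewrite le_eqVlt => /orP[/eqP at_|at_].
  rewrite -at_; apply: filterS2 (mul (a i)) (near_left_outside i) => s su so.
  by rewrite patch_out// (@patch_arc i) ?lexx ?ltW// nua.
have := nu_left (i := i) (u := t); rewrite at_ t2 => /(_ isT).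
have H : \forall s \near t^'-, a i <= s <= b i.
  apply/near_leftP; exists (t - a i); first by lra.
  by move=> s /andP[s1 s2]; apply/andP; split; lra.
apply: filterS2 H => s si sH.
by rewrite !(@patch_arc i)// (ltW at_).
Qed.

Lemma developing_patch : developing E patch.
Proof.
have [mul muo muf muL] := dev; have [h1 h2 h3 h4 _] := DE.
split; [exact: patch_left| | |exact: patch_shift].
- move=> o u ou.
  have [uo|/outsidePn[i [t [it ut]]]] := pselect (outside a b u).
    have oo := crossing_outside (or_intror erefl) (over_crossing ou) uo.
    have ou' : over D o u by apply/h4.
    have := near_rightW (near_outside uo).
    by apply: filterS2 (muo _ _ ou') => s su so; rewrite !patch_out.
  have [oo|/outsidePn[j [t' [jt' ot']]]] := pselect (outside a b o).
    have uo := crossing_outside (or_intror erefl) (crossing_sym (over_crossing ou)) oo.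
    by have := uo _ _ it; rewrite ut.
  have {}ou : over E t' t by apply: over_periodic ou.
  rewrite (cong1_shift patch_shift ot') (patch_arc jt').
  move: ut => /cong1P[n ->]; have [g [cg _ pg]] := shift_developing patch_shift n.
  apply: filterS2 (near_right_shift (n%:~R) (patch_after it))
    (near_right_shift (n%:~R) (nu_over it jt' ou)) => s sH1 sH2.
  rewrite -{1}(subrK n%:~R s) !pg sH1 sH2 (patch_arc it) !mulgA.
  by rewrite -cg.
- move=> u uf.
  have [uo|/outsidePn[i [t [it ut]]]] := pselect (outside a b u).
    have uf' o : ~ over D o u.
      move=> ou; apply: (uf o); apply/h4 => //.
      exact: crossing_outside (or_introl erefl) (over_crossing ou) uo.
    have := near_rightW (near_outside uo).
    by apply: filterS2 (muf _ uf') => s su so; rewrite !patch_out.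
  have tf o : ~ over E o t.
    move=> ot; apply: (uf o); apply: over_periodic ot; first exact: cong1_refl.
    by rewrite cong1_sym.
  move: ut => /cong1P[n ->]; have [g [cg _ pg]] := shift_developing patch_shift n.
  apply: filterS2 (near_right_shift (n%:~R) (patch_after it))
    (near_right_shift (n%:~R) (nu_free it tf)) => s sH1 sH2.
  by rewrite -{1}(subrK n%:~R s) !pg sH1 sH2 (patch_arc it).
Qed.

End Patch.
End LocalChange.

Section TwoEvents.
Variables (t1 t2 : R) (f1 f2 : gT -> gT) (m : gT).
Hypothesis t12 : t1 < t2.

Definition two s := if s <= t1 then m else if s <= t2 then f1 m else f2 (f1 m).

Lemma two_left u : \forall s \near u^'-, two s = two u.
Proof.
rewrite /two; have [u1|u1] := leP u t1.
  apply/near_leftP; exists 1 => // s /andP[_ su].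
  by rewrite (le_trans (ltW su) u1).
have [u2|u2] := leP u t2; apply/near_leftP.
  exists (u - t1); first by rewrite subr_gt0.
  move=> s /andP[s1 su]; rewrite subKr in s1.
  by rewrite leNgt s1 (le_trans (ltW su) u2).
exists (u - t2); first by rewrite subr_gt0.
by move=> s /andP[s1 su]; rewrite subKr in s1; rewrite !leNgt s1 (lt_trans t12 s1).
Qed.

Lemma two_right u : \forall s \near u^'+,
  two s = (if u == t1 then f1 else if u == t2 then f2 else id) (two u).
Proof.
rewrite /two; case: (ltgtP u t1) => [u1|u1|->].
- rewrite (lt_eqF (lt_trans u1 t12)); apply/near_rightP.
  exists (t1 - u); first by rewrite subr_gt0.
  by move=> s /andP[_ s1]; rewrite addrC subrK in s1; rewrite (ltW s1).
- case: (ltgtP u t2) => [u2|u2|->].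
  + apply/near_rightP; exists (t2 - u); first by rewrite subr_gt0.
    move=> s /andP[us s1]; rewrite addrC subrK in s1.
    by rewrite leNgt (lt_trans u1 us) (ltW s1).
  + apply/near_rightP; exists 1 => // s /andP[us _].
    by rewrite !leNgt (lt_trans u1 us) (lt_trans u2 us).
  + apply/near_rightP; exists 1 => // s /andP[us _].
    by rewrite !leNgt (lt_trans t12 us) us.
- apply/near_rightP; exists (t2 - t1); first by rewrite subr_gt0.
  move=> s /andP[us s1]; rewrite addrC subrK in s1.
  by rewrite leNgt us (ltW s1).
Qed.

Lemma two_start s : s <= t1 -> two s = m. Proof. by rewrite /two => ->. Qed.

Lemma two_end s : t2 <= s ->
  (if s == t2 then f2 else id) (two s) = f2 (f1 m).
Proof.
rewrite le_eqVlt /two => /orP[/eqP<-|s2].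
  by rewrite eqxx (leNgt t2 t1) t12 lexx.
by rewrite (gt_eqF s2) !leNgt s2 (lt_trans t12 s2).
Qed.

(** Two functions with the same jumps stay equal once they agree at one point:
   the jumps being injective, whether they agree is locally constant. *)
Lemma two_unique (g : R -> gT) (x y : R) : injective f1 -> injective f2 ->
  (forall u, x < u <= y -> \forall s \near u^'-, g s = g u) ->
  (forall u, x <= u < y -> \forall s \near u^'+,
     g s = (if u == t1 then f1 else if u == t2 then f2 else id) (g u)) ->
  x <= y -> g x = two x -> g y = two y.
Proof.
move=> f1i f2i gl gr xy gx.
suff : asbool (g y = two y) = asbool (g x = two x).
  by move=> e; apply: contrapT => /asboolPn; rewrite e => /negP; apply; exact/asboolP.
apply: (@locally_constant R bool (fun s => asbool (g s = two s))) => // u uxy.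
  apply: filterS2 (gr _ uxy) (two_right u) => s -> ->.
  apply: asbool_equiv_eq; split => [|-> //].
  by case: ifP => _; [exact: f1i|case: ifP => _ //; exact: f2i].
by apply: filterS2 (gl _ uxy) (two_left u) => s -> ->.
Qed.

End TwoEvents.

(** A Reidemeister move affects at most two under-crossings on each arc.  Away from
   the arcs nothing changes, so that it remains to compare the total effect of the
   two jumps before and after. *)
Lemma developable_events (k : nat) (a b : 'I_k -> R) (D E : welded_diagram R)
    (mu : R -> gT) (x1 x2 y1 y2 : 'I_k -> R) (f1 f2 g1 g2 : 'I_k -> gT -> gT) :
  let nu q := two (y1 q) (y2 q) (g1 q) (g2 q) (mu (a q)) in
  local_change a b D E -> developing D mu ->
  (forall q, [/\ a q <= x1 q, x1 q < x2 q & x2 q <= b q]) ->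
  (forall q, [/\ a q <= y1 q, y1 q < y2 q & y2 q <= b q]) ->
  (forall q, injective (f1 q) /\ injective (f2 q)) ->
  (forall q u, a q <= u <= b q -> \forall s \near u^'+,
     mu s = (if u == x1 q then f1 q else if u == x2 q then f2 q else id) (mu u)) ->
  (forall q, f2 q (f1 q (mu (a q))) = g2 q (g1 q (mu (a q)))) ->
  (forall q r u o, a q <= u <= b q -> a r <= o <= b r -> over E o u ->
     u = y1 q /\ g1 q (nu q u) = rho ** nu q u ** rho ^^ nu r o \/
     u = y2 q /\ g2 q (nu q u) = rho ** nu q u ** rho ^^ nu r o) ->
  (forall q u, a q <= u <= b q -> (forall o, ~ over E o u) ->
     (u = y1 q -> forall m, g1 q m = m) /\ (u = y2 q -> forall m, g2 q m = m)) ->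
  developable E.
Proof.
move=> nu DE dev xab yab fi fD tot over_E free_E.
have [mul _ _ _] := dev.
have nu_b q : \forall s \near (b q)^'+,
    mu s = (if b q == y1 q then g1 q else if b q == y2 q then g2 q else id) (nu q (b q)).
  have [ax x12 xb] := xab q; have [ay y12 yb] := yab q; have [i1 i2] := fi q.
  have bq : a q <= b q <= b q by rewrite lexx andbT; lra.
  rewrite (gt_eqF (lt_le_trans y12 yb)) /nu (two_end _ _ _ y12 yb).
  apply: filterS (fD _ _ bq) => s ->.
  rewrite (gt_eqF (lt_le_trans x12 xb)) -tot -(two_end (f1 q) (f2 q) (mu (a q)) x12 xb).
  congr ((if _ then _ else _) _).
  apply: (two_unique (x := a q) x12 i1 i2) => [u _|u /andP[u1 u2]||]; first exact: mul.
  - by apply: fD; rewrite u1 ltW.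
  - by lra.
  - by rewrite two_start.
have right q u : a q <= u <= b q -> \forall s \near u^'+,
    (if u < b q then nu q else mu) s =
    (if u == y1 q then g1 q else if u == y2 q then g2 q else id) (nu q u).
  move=> /andP[_]; rewrite le_eqVlt => /orP[/eqP->|u2]; first by rewrite ltxx.
  by rewrite u2; have [_ y12 _] := yab q; exact: two_right.
exists (patch a b mu nu); apply: (developing_patch DE dev) => //.
- by move=> q; rewrite /nu two_start//; have [] := yab q.
- by move=> q u _; apply: two_left; have [] := yab q.
- move=> q r o u uq or_ ou; have [_ y12 _] := yab q.
  apply: filterS (right q u uq) => s ->.
  case: (over_E _ _ _ _ uq or_ ou) => -[-> <-]; first by rewrite eqxx.
  by rewrite (gt_eqF y12) eqxx.
- move=> q u uq uf; apply: filterS (right q u uq) => s ->.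
  have [h1 h2] := free_E _ _ uq uf.
  by case: eqP => [/h1|_]//; case: eqP => [/h2|].
Qed.

(** An over-strand of an arc lies in the disc as well; up to a period it is one of
   the arcs. *)
Lemma over_arc (k : nat) (a b : 'I_k -> R) D E F o q u : local_change a b D E ->
  F = D \/ F = E -> a q <= u <= b q -> over F o u ->
  exists r o', [/\ a r <= o' <= b r, cong1 o o' & over F o' u].
Proof.
move=> DE FDE uq ou.
have : ~ outside a b o.
  move=> /(crossing_outside DE FDE (crossing_sym (over_crossing ou))) uo.
  by have := uo _ _ uq; rewrite cong1_refl.
move=> /outsidePn[r [ o' [inr_ oo']]]; exists r, o'; split => //.
by apply: over_periodic ou => //; exact: cong1_refl.
Qed.

Lemma kink m : rho ** m ** rho ^^ m = m.
Proof. by rewrite conjgE !mulgA mulgK rho2 mul1g. Qed.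

Lemma two_id t1 t2 m s : two t1 t2 id id m s = m.
Proof. by rewrite /two; case: ifP => // _; case: ifP. Qed.

(** A kink crosses under an arc of its own colour, so its jump is trivial. *)
Lemma move1_developable D E : move1 D E -> developable D -> developable E.
Proof.
move=> [a [b [DE [noD [s0 [t0 [as0 st0 t0b cE]]]]]]] [mu dev].
have [_ _ muf _] := dev.
apply: (@developable_events 1 a b D E mu (fun=> s0) (fun=> t0) (fun=> s0) (fun=> t0)
  (fun=> id) (fun=> id) (fun=> id) (fun=> id)) => //.
- by move=> q; rewrite (ord1 q).
- by move=> q; rewrite (ord1 q).
- by move=> q; split; exact: inj_id.
- move=> q u uq; rewrite !if_same; apply: muf => o ou.
  have [r [ o' [inr_ oo' o'u]]] := over_arc DE (or_introl erefl) uq ou.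
  rewrite (ord1 r) in inr_; rewrite (ord1 q) in uq.
  exact: (noD _ _ _ inr_ uq (over_crossing o'u)).
- move=> q r u o; rewrite (ord1 q) (ord1 r) => uq inr_ ou; rewrite !two_id kink.
  have cou := over_crossing ou; case: (ltgtP o u) => ou'.
  + by right; have [] := (cE ord0 o u inr_ uq ou').1 cou.
  + by left; have [] := (cE ord0 u o uq inr_ ou').1 (crossing_sym cou).
  + by case: cou => _; rewrite ou' cong1_refl.
Qed.

(** Conversely, the colour is the same on both sides of the kink: if the loop is
   entered from below this is read from the equation [m = rho m' (rho ^ m)], which
   forces [m' = m]. *)
Lemma move1_developable_inv D E : move1 D E -> developable E -> developable D.
Proof.
move=> [a [b [DE [noD [s0 [t0 [as0 st0 t0b cE]]]]]]] [mu dev].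
have [mul muo muf _] := dev.
have ED := local_change_sym DE.
have overE o u : a ord0 <= u <= b ord0 -> over E o u ->
    exists o', [/\ cong1 o o', over E o' u & o' = s0 /\ u = t0 \/ o' = t0 /\ u = s0].
  move=> uq ou; have [r [ o' [inr_ oo' o'u]]] := over_arc DE (or_intror erefl) uq ou.
  rewrite (ord1 r) in inr_; exists o'; split => //.
  have cou := over_crossing o'u; case: (ltgtP o' u) => ou'.
  + by left; have [] := (cE ord0 o' u inr_ uq ou').1 cou.
  + by right; have [] := (cE ord0 u o' uq inr_ ou').1 (crossing_sym cou).
  + by case: cou => _; rewrite ou' cong1_refl.
have left_ u : s0 < u <= t0 -> \forall s \near u^'-, mu s = mu u by move=> _; exact: mul.
have in_ u : s0 <= u <= t0 -> a ord0 <= u <= b ord0.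
  by move=> /andP[u1 u2]; apply/andP; split; lra.
(* the two preimages of the kink have the same colour *)
have trivial o u : a ord0 <= u <= b ord0 -> over E o u -> mu u = rho ** mu u ** rho ^^ mu o.
  move=> uq ou; have [ o' [oo' o'u ends]] := overE _ _ uq ou.
  have [_ _ _ muL] := dev; rewrite (cong1_shift muL oo').
  suff -> : mu o' = mu u by rewrite kink.
  case: ends => -[? ?]; subst o' u.
    apply/esym; apply: locally_constant (ltW st0) _ left_ => v /andP[v1 v2].
    have vq : a ord0 <= v <= b ord0 by apply: in_; rewrite v1 ltW.
    apply: muf => o2 o2v; have [ o3 [_ o3v]] := overE _ _ vq o2v.
    case=> -[? ?]; subst o3 v; first by rewrite ltxx in v2.
    exact: over_asym o'u o3v.
  have /near_rightP[d d0 H] := muo _ _ o'u.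
  pose v := s0 + Num.min (d / 2) (t0 - s0).
  have [v1 v2 v3] : [/\ s0 < v, v < s0 + d & v <= t0].
    rewrite /v; have [h|h] := leP (d / 2) (t0 - s0); split; lra.
  have mv : mu t0 = mu v.
    apply: locally_constant v3 _ _ => w /andP[w1 w2]; last exact: mul.
    have wq : a ord0 <= w <= b ord0 by apply: in_; apply/andP; split; lra.
    apply: muf => o2 o2w; have [ o3 [_ o3w]] := overE _ _ wq o2w.
    by case=> -[? ?]; subst o3 w; lra.
  have : mu v = rho ** mu s0 ** rho ^^ mu v by rewrite {1}H ?mv// v1 v2.
  rewrite mv conjgE !mulgA -{1}(mul1g (mu v)) => /mulIg e.
  have {}e : mu s0 ** (mu v)^-1%g = (1 : gT)%g.
    apply: (mulgI rho); apply: (mulIg rho).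
    by rewrite mulgA -e mulg1 rho2.
  by rewrite -[mu v]mul1g -e -mulgA mulVg mulg1.
apply: (@developable_events 1 a b E D mu (fun=> s0) (fun=> t0) (fun=> s0) (fun=> t0)
  (fun=> id) (fun=> id) (fun=> id) (fun=> id)) => //.
- by move=> q; rewrite (ord1 q).
- by move=> q; rewrite (ord1 q).
- by move=> q; split; exact: inj_id.
- move=> q u; rewrite (ord1 q) !if_same => uq.
  have [[ o ou]|no] := pselect (exists o, over E o u).
    by apply: filterS (muo _ _ ou) => s ->; rewrite -trivial.
  by apply: muf => o ou; apply: no; exists o.
- move=> q r u o; rewrite (ord1 q) (ord1 r) => uq inr_ ou.
  by have := noD _ _ _ inr_ uq (over_crossing ou).
Qed.

(** A welded crossing is a jump by the identity, which lets one argument treat the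
   classical and the welded version of a move. *)
Definition jump (p : bool) c m := if p then rho ** m ** c else m.

Lemma jump_inj p c : injective (jump p c).
Proof. by rewrite /jump; case: p => // x y /mulIg /mulgI. Qed.

Lemma jump_twice p c m : c ** c = 1%g -> jump p c (jump p c m) = m.
Proof. by rewrite /jump; case: p => // c2; rewrite jumpK. Qed.

Lemma ord2P (i j q : 'I_2) : i != j -> q = i \/ q = j.
Proof.
move: i j q => [[|[|//]] ?] [[|[|//]] ?] [[|[|//]] ?] //= _;
  by [left; apply: val_inj|right; apply: val_inj].
Qed.

(** The form in which the second move is used: [p] tells whether its crossings are
   classical, and they are ordered along the lower arc [j]. *)
Lemma move2P D E : move2 D E -> exists (a b : 'I_2 -> R) (i j : 'I_2)
    (p : bool) (s1 s2 t1 t2 : R),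
  [/\ local_change a b D E,
      (forall q r s t, a q <= s <= b q -> a r <= t <= b r -> ~ crossing D s t),
      i != j /\ t1 < t2,
      [/\ a i <= s1 <= b i, a i <= s2 <= b i, a j <= t1 <= b j & a j <= t2 <= b j] &
      forall q r u o, a q <= u <= b q -> a r <= o <= b r ->
        (over E o u <-> [/\ p, r = i, q = j & (o = s1 /\ u = t1) \/ (o = s2 /\ u = t2)])].
Proof.
move=> [a [b [DE [noD [i [j [s1 [s2 [t1 [t2 [ij [[s1i s2i] [t1j t2j] noE cE [s12 [_ mk]]]]]]]]]]]]]].
have t12 : t1 != t2.
  apply/eqP => t12; subst t2; move/eqP: s12; apply.
  have c1 : crossing E s1 t1 by apply/(cE _ _ s1i t1j); left.
  have c2 : crossing E s2 t1 by apply/(cE _ _ s2i t1j); right.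
  have := curve_no_triple (crossing_sym c1) (crossing_sym c2).
  by case: DE => _ h2 _ _ _ /(h2 _ _ _ _ s1i s2i)[].
have [p pE] : exists p : bool, (p <-> over E s1 t1) /\ (p <-> over E s2 t2).
  case: mk => [[h1 h2]|[[_ h1 _] [_ h2 _]]]; [exists true|exists false]; split; split => //.
have noji : ~ over E t1 s1 /\ ~ over E t2 s2.
  case: mk => [[h1 h2]|[[_ _ h1] [_ _ h2]]] //.
  by split; apply: over_asym.
have OV q r u o : a q <= u <= b q -> a r <= o <= b r ->
    (over E o u <-> [/\ p, r = i, q = j & (o = s1 /\ u = t1) \/ (o = s2 /\ u = t2)]).
  move=> uq ro; split=> [ou|[pp _ _ [[-> ->]|[-> ->]]]]; last 2 first.
  - exact: pE.1.1.
  - exact: pE.2.1.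
  have cou := over_crossing ou.
  have [rq|rq] := eqVneq r q; first by subst r; have := noE _ _ _ ro uq cou.
  have [ri|rj] := ord2P r ij; subst r.
    have [qi|qj] := ord2P q ij; subst q; first by rewrite eqxx in rq.
    have H := (cE _ _ ro uq).1 cou; split => //.
    by case: H => -[? ?]; subst; [exact: pE.1.2|exact: pE.2.2].
  have [qi|qj] := ord2P q ij; subst q; last by rewrite eqxx in rq.
  have [n1 n2] := noji.
  by have [[? ?]|[? ?]] := (cE _ _ uq ro).1 (crossing_sym cou); subst.
exists a, b, i, j, p.
case: (ltgtP t1 t2) t12 => // tt _; [exists s1, s2, t1, t2|exists s2, s1, t2, t1]; split => //.
move=> q r u o uq ro; rewrite (OV q r u o uq ro).
by split=> -[? ? ? H]; split => //; case: H; [right|left|right|left].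
Qed.

Section Move2.
Variables (D E : welded_diagram R) (a b : 'I_2 -> R) (i j : 'I_2) (p : bool).
Variables (s1 s2 t1 t2 : R).
Hypothesis DE : local_change a b D E.
Hypothesis noD : forall q r s t, a q <= s <= b q -> a r <= t <= b r -> ~ crossing D s t.
Hypotheses (ij : i != j) (t12 : t1 < t2).
Hypotheses (s1i : a i <= s1 <= b i) (s2i : a i <= s2 <= b i).
Hypotheses (t1j : a j <= t1 <= b j) (t2j : a j <= t2 <= b j).
Hypothesis overE : forall q r u o, a q <= u <= b q -> a r <= o <= b r ->
  (over E o u <-> [/\ p, r = i, q = j & (o = s1 /\ u = t1) \/ (o = s2 /\ u = t2)]).

Let first q := if q == j then t1 else a q.
Let second q := if q == j then t2 else b q.
Let event (mu : R -> gT) q := if q == j then jump p (rho ^^ mu (a i)) else id.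

Let times q : [/\ a q <= first q, first q < second q & second q <= b q].
Proof.
rewrite /first /second; case: eqP => [->|_]; first by split; case/andP: t1j; case/andP: t2j.
by split => //; case: DE.
Qed.

Let event_inj mu q : injective (event mu q) /\ injective (event mu q).
Proof. by rewrite /event; case: ifP => _; split; (exact: inj_id || exact: jump_inj). Qed.

(** The two jumps of the lower arc are by the same colour and cancel. *)
Lemma move2_forward mu : developing D mu -> developable E.
Proof.
move=> dev; have [_ _ muf _] := dev.
apply: (@developable_events 2 a b D E mu first second first second
  (fun=> id) (fun=> id) (event mu) (event mu)) => //.
- by move=> q; split; exact: inj_id.
- move=> q u uq; rewrite !if_same; apply: muf => o ou.
  have [r [ o' [ro _ o'u]]] := over_arc DE (or_introl erefl) uq ou.
  exact: (noD ro uq (over_crossing o'u)).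
- by move=> q; rewrite /event; case: ifP => // _; rewrite jump_twice// conj_rho2.
- move=> q r u o uq ro /(overE uq ro)[pp ri qj ends]; subst r q.
  rewrite /event /first /second eqxx (negbTE ij) two_id /jump pp.
  by case: ends => -[_ ->]; [left|right].
- move=> q u uq uf; rewrite /event /first /second; case: eqP => // qj; subst q.
  rewrite /jump; case: (boolP p) => // pp; split => ut; exfalso; subst u.
    by apply: (uf s1); apply/(overE uq s1i); split => //; left.
  by apply: (uf s2); apply/(overE uq s2i); split => //; right.
Qed.

Lemma move2_backward mu : developing E mu -> developable D.
Proof.
move=> dev; have [mul muo muf muL] := dev.
have constant s : a i <= s <= b i -> mu s = mu (a i).
  move=> /andP[sa sb]; apply: (locally_constant sa) => [u /andP[u1 u2]|u _]; last exact: mul.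
  have ui : a i <= u <= b i by rewrite u1; lra.
  apply: muf => o ou.
  have [r [ o' [ro _ o'u]]] := over_arc DE (or_intror erefl) ui ou.
  by have [_ _ /eqP] := (overE ui ro).1 o'u; rewrite (negbTE ij).
apply: (@developable_events 2 a b E D mu first second first second
  (event mu) (event mu) (fun=> id) (fun=> id)) => //.
- exact: local_change_sym.
- move=> q u uq; rewrite /event /first /second.
  have [[ o ou]|no] := pselect (exists o, over E o u).
    have [r [ o' [ro oo' o'u]]] := over_arc DE (or_intror erefl) uq ou.
    have [pp ri qj ends] := (overE uq ro).1 o'u; subst r q.
    apply: filterS (muo _ _ o'u) => s ->; rewrite eqxx (constant o')// /jump pp.
    by case: ends => -[_ ->]; rewrite ?eqxx// if_same.
  have -> : (if u == (if q == j then t1 else a q) then if q == j then jump p (rho ^^ mu (a i)) else id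
     else if u == (if q == j then t2 else b q) then if q == j then jump p (rho ^^ mu (a i)) else id else id) (mu u) = mu u.
    have [qj|_] := eqVneq q j; last by rewrite !if_same.
    subst q; rewrite /jump; case: (boolP p) => pp; last by rewrite !if_same.
    case: eqP => [u1|_]; first by exfalso; apply: no; exists s1; apply/(overE uq s1i); split => //; left.
    case: eqP => // u2; exfalso; apply: no; exists s2; apply/(overE uq s2i); split => //; by right.
  by apply: muf => o ou; apply: no; exists o.
- by move=> q; rewrite /event; case: ifP => // _; rewrite jump_twice// conj_rho2.
- by move=> q r u o uq ro ou; have := noD ro uq (over_crossing ou).
Qed.

End Move2.

Lemma move2_developable D E : move2 D E -> (developable D <-> developable E).
Proof.
move=> /move2P[a [b [i [j [p [s1 [s2 [t1 [t2 [DE noD [ij t12] [h1 h2 h3 h4] OV]]]]]]]]]].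
split=> -[mu dev].
  exact: (move2_forward DE noD ij t12 h1 h2 h3 h4 OV dev).
exact: (move2_backward DE noD ij t12 h1 h2 h3 h4 OV dev).
Qed.

Lemma ord3P (i j k q : 'I_3) : uniq [:: i; j; k] -> [\/ q = i, q = j | q = k].
Proof.
move: i j k q => [[|[|[|//]]] ?] [[|[|[|//]]] ?] [[|[|[|//]]] ?] [[|[|[|//]]] ?] //= _;
  by [constructor 1; apply: val_inj|constructor 2; apply: val_inj|constructor 3; apply: val_inj].
Qed.

Lemma conj_cancel (B : gT) : B ** B = 1%g ->
  (forall X, B ** (B ** X ** B) = X ** B) /\ (forall X, B ** X ** B ** B = B ** X).
Proof. by move=> BB; split=> X; [rewrite !mulgA BB mul1g|rewrite -!mulgA BB mulg1]. Qed.

(** The two under-crossings of the lowest strand may be exchanged if the colour of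
   the middle strand is conjugated by that of the top strand. *)
Lemma jump_swap (B C C' : gT) w (o : bool) m : B ** C = C' ** B -> C ** B = B ** C' ->
  (if o then jump w C else jump true B) ((if o then jump true B else jump w C) m) =
  (if ~~ o then jump w C' else jump true B) ((if ~~ o then jump true B else jump w C') m).
Proof.
rewrite /jump; case: w; case: o => //= s1 s2; rewrite !mulgA rho2 !mul1g -!mulgA.
  by rewrite s1.
by rewrite s2.
Qed.

Section Move3.
Variables (D E : welded_diagram R) (a b : 'I_3 -> R) (x y : 'I_3 -> 'I_3 -> R).
Variables (i j k : 'I_3) (p w : bool).
Hypothesis DE : local_change a b D E.
Hypotheses (TD : triangle a b D x) (TE : triangle a b E y).
Hypothesis ijk : uniq [:: i; j; k].

(* [i] lies on top, [k] at the bottom; [i] is classical with respect to both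
   other strands or to none *)
Let mark r q := [|| [&& r == i, q == j & p], [&& r == i, q == k & p] |
                    [&& r == j, q == k & w]].

Hypothesis overD : forall r q, r != q -> over D (x r q) (x q r) <-> mark r q.
Hypothesis overE : forall r q, r != q -> over E (y r q) (y q r) <-> mark r q.
Hypothesis order : forall i j k, uniq [:: i; j; k] -> (x i j < x i k <-> y i k < y i j).

Variable mu : R -> gT.
Hypothesis dev : developing D mu.

Let ij : i != j. Proof. by move: ijk; rewrite /= !inE negb_or => /and3P[/andP[]]. Qed.
Let ik : i != k. Proof. by move: ijk; rewrite /= !inE negb_or => /and3P[/andP[]]. Qed.
Let jk : j != k. Proof. by move: ijk; rewrite /= !inE negb_or => /and3P[_]. Qed.

Let A := rho ^^ mu (a i).
(* The colour of [j] where it passes over [k]. *)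
Let color (z : 'I_3 -> 'I_3 -> R) :=
  rho ^^ (if z j i < z j k then jump p A (mu (a j)) else mu (a j)).
(* On arc [q] the other two arcs are [o1 q] and [o2 q]; [lo] and [hi] are the
   parameters of the two crossings in increasing order, [e1] and [e2] the jumps
   there. *)
Let o1 q := if q == i then j else i.
Let o2 q := if q == k then j else k.
Let lo (z : 'I_3 -> 'I_3 -> R) q := Num.min (z q (o1 q)) (z q (o2 q)).
Let hi (z : 'I_3 -> 'I_3 -> R) q := Num.max (z q (o1 q)) (z q (o2 q)).
Let ev z q r := jump (mark r q) (if r == i then A else color z).
Let e1 z q := if z q (o1 q) < z q (o2 q) then ev z q (o1 q) else ev z q (o2 q).
Let e2 z q := if z q (o1 q) < z q (o2 q) then ev z q (o2 q) else ev z q (o1 q).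

Let others q : [/\ o1 q != q, o2 q != q & o1 q != o2 q].
Proof.
rewrite /o1 /o2; have [-> | -> | ->] := ord3P q ijk.
- by rewrite eqxx (negbTE ik) (eq_sym j) ij (eq_sym k) ik jk.
- by rewrite (eq_sym j) (negbTE ij) (negbTE jk) ij (eq_sym k) jk ik.
- by rewrite (eq_sym k) (negbTE ik) eqxx ik jk ij.
Qed.

Let otherP q r : r != q -> r = o1 q \/ r = o2 q.
Proof.
rewrite /o1 /o2; have [-> | -> | ->] := ord3P q ijk;
  have [-> | -> | ->] := ord3P r ijk; rewrite ?eqxx ?(negbTE ik) ?(negbTE ij) ?(negbTE jk)//
  ?(eq_sym j i) ?(eq_sym k i) ?(eq_sym k j) ?(negbTE ik) ?(negbTE ij) ?(negbTE jk);
  by [left|right].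
Qed.

Let distinct F z q r r' : F = D \/ F = E -> triangle a b F z ->
  r != q -> r' != q -> r != r' -> z q r != z q r'.
Proof.
move=> FDE [zin zX] rq r'q rr'; apply/eqP => e.
have c1 : crossing F (z q r) (z r q) by apply/(zX q r); rewrite ?zin// eq_sym.
have c2 : crossing F (z q r') (z r' q) by apply/(zX q r'); rewrite ?zin// eq_sym.
have := curve_no_triple c1; rewrite e => /(_ _ c2) c.
case: DE => _ h2 _ _ _.
by have [/eqP] := h2 _ _ _ _ (zin _ _ rq) (zin _ _ r'q) c; rewrite (negbTE rr').
Qed.

Let sel z q u : z q (o1 q) != z q (o2 q) ->
  (if u == lo z q then e1 z q else if u == hi z q then e2 z q else id) =
  (if u == z q (o1 q) then ev z q (o1 q)
   else if u == z q (o2 q) then ev z q (o2 q) else id).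
Proof.
rewrite /lo /hi /e1 /e2; case: (ltgtP (z q (o1 q)) (z q (o2 q))) => // h _.
by case: eqP => [->|//]; rewrite (lt_eqF h).
Qed.

Let lohi F z q : F = D \/ F = E -> triangle a b F z ->
  [/\ a q <= lo z q, lo z q < hi z q & hi z q <= b q].
Proof.
move=> FDE T; have [h1 h2 h3] := others q.
have := distinct FDE T h1 h2 h3; case: T => zin _.
have := zin q (o1 q); have := zin q (o2 q); rewrite !(eq_sym q) h1 h2.
move=> /(_ isT)/andP[? ?] /(_ isT)/andP[? ?]; rewrite /lo /hi.
by case: (ltgtP (z q (o1 q)) (z q (o2 q))).
Qed.

Let ev_inj z q r : injective (ev z q r). Proof. exact: jump_inj. Qed.
Let e_inj z q : injective (e1 z q) /\ injective (e2 z q).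
Proof. by rewrite /e1 /e2; case: ifP => _; split; exact: ev_inj. Qed.

Let nu z q := two (lo z q) (hi z q) (e1 z q) (e2 z q) (mu (a q)).

Let mark_i r : mark r i = false.
Proof. by rewrite /mark (negbTE ij) (negbTE ik) !andbF. Qed.
Let mark_k q : mark k q = false.
Proof. by rewrite /mark (eq_sym k) (negbTE ik) (eq_sym k) (negbTE jk). Qed.
Let mark_ij : mark i j = p.
Proof. by rewrite /mark !eqxx (negbTE jk) (negbTE ij) !andbF !orbF. Qed.
Let mark_ik : mark i k = p.
Proof. by rewrite /mark !eqxx (eq_sym k) (negbTE jk) (negbTE ij) !andbF !orbF. Qed.
Let mark_jk : mark j k = w.
Proof. by rewrite /mark !eqxx (eq_sym j i) (negbTE ij). Qed.

Let nu_i z s : nu z i s = mu (a i).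
Proof.
by rewrite /nu /e1 /e2 /ev !mark_i /jump; case: ifP => _; rewrite /two; case: ifP => // _; case: ifP.
Qed.

(* the colour of [j] where [k] meets it *)
Let nu_jk F z : F = D \/ F = E -> triangle a b F z ->
  rho ^^ nu z j (z j k) = color z.
Proof.
move=> FDE T; have := lohi j FDE T; have [h1 h2 h3] := others j.
have := distinct FDE T h1 h2 h3; rewrite /nu /two /lo /hi /e1 /e2 /color /o1 /o2.
rewrite (eq_sym j i) (negbTE ij) (negbTE jk).
case: (ltgtP (z j i) (z j k)) => // h _ _; congr (_ ^^ _).
  by rewrite lexx leNgt h /ev mark_ij eqxx.
by rewrite lexx.
Qed.

Let hit F z q r u o : F = D \/ F = E -> triangle a b F z ->
  a q <= u <= b q -> a r <= o <= b r -> over F o u ->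
  [/\ r != q, u = z q r & o = z r q].
Proof. by move=> FDE [_ zX] uq ro /over_crossing/(zX _ _ _ _ ro uq)[]. Qed.

Let read q : (forall r, r != q -> mark r q ->
    rho ^^ mu (x r q) = if r == i then A else color x) ->
  forall u, a q <= u <= b q -> \forall s \near u^'+,
    mu s = (if u == lo x q then e1 x q else if u == hi x q then e2 x q else id) (mu u).
Proof.
move=> colq u uq; have [mul muo muf _] := dev; have [h1 h2 h3] := others q.
rewrite (sel u (distinct (or_introl erefl) TD h1 h2 h3)).
have [[ o ou]|no] := pselect (exists o, over D o u).
  have [r [ o' [ro oo' o'u]]] := over_arc DE (or_introl erefl) uq ou.
  have [rq ur or_] := hit (or_introl erefl) TD uq ro o'u.
  have mrq : mark r q by apply/overD => //; rewrite -ur -or_.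
  have -> : (if u == x q (o1 q) then ev x q (o1 q)
     else if u == x q (o2 q) then ev x q (o2 q) else id) = ev x q r.
    rewrite ur; case: (otherP rq) => ->; first by rewrite eqxx.
    by rewrite eq_sym (negbTE (distinct (or_introl erefl) TD h1 h2 h3)) eqxx.
  apply: filterS (muo _ _ o'u) => s ->; by rewrite /ev mrq /jump -colq// or_.
have nomark r : r != q -> u = x q r -> ev x q r = id.
  move=> rq ur; rewrite /ev; case: (boolP (mark r q)) => [/(overD rq)|//].
  by rewrite -ur => ou; exfalso; apply: no; exists (x r q).
have -> : (if u == x q (o1 q) then ev x q (o1 q)
     else if u == x q (o2 q) then ev x q (o2 q) else id) = id.
  by case: eqP => [/(nomark _ h1)//|_]; case: eqP => [/(nomark _ h2)|].
by apply: muf => o ou; apply: no; exists o.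
Qed.

Let read_all q : (forall r, r != q -> mark r q ->
    rho ^^ mu (x r q) = if r == i then A else color x) ->
  forall s, a q <= s <= b q -> mu s = nu x q s.
Proof.
move=> colq s /andP[s1 s2]; have [mul _ _ _] := dev.
have [h1 h2 h3] := lohi q (or_introl erefl) TD; have [i1 i2] := e_inj x q.
apply: (two_unique (x := a q) h2 i1 i2) => // [u|]; last by rewrite two_start.
by move=> /andP[u1 u2]; apply: read => //; rewrite u1; lra.
Qed.

Let xin q r : r != q -> a q <= x q r <= b q.
Proof. by move=> rq; case: TD => h _; apply: h; rewrite eq_sym. Qed.

Let mu_i s : a i <= s <= b i -> mu s = mu (a i).
Proof. by move=> si; rewrite (@read_all i) ?nu_i// => r _; rewrite mark_i. Qed.

Let markE r q : mark r q -> r = i \/ (r = j /\ q = k).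
Proof. by case/or3P => /and3P[/eqP ? /eqP ? _]; [left|left|right]. Qed.

Let colors q r : r != q -> mark r q -> rho ^^ mu (x r q) = if r == i then A else color x.
Proof.
have ci q' : i != q' -> rho ^^ mu (x i q') = A by move=> iq; rewrite mu_i// xin// eq_sym.
move=> rq m; case: (markE m) => [ri|[rj qk]]; first by subst r; rewrite eqxx ci.
subst r q; rewrite (eq_sym j i) (negbTE ij) -(nu_jk (or_introl erefl) TD).
congr (_ ^^ _); apply: read_all; last by rewrite xin// eq_sym.
move=> r _ mj; case: (markE mj) => [->|[_ jk']]; first by rewrite eqxx ci.
by move: jk; rewrite jk' eqxx.
Qed.

Let flip i' j' k' : uniq [:: i'; j'; k'] -> (y i' j' < y i' k') = ~~ (x i' j' < x i' k').
Proof.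
move=> u; have [n1 n2 n3] : [/\ j' != i', k' != i' & j' != k'].
  by move: u; rewrite /= !inE negb_or => /and3P[/andP[? ?] ? _]; rewrite eq_sym; split => //; rewrite eq_sym.
have u' : uniq [:: i'; k'; j'].
  by rewrite /= !inE negb_or (eq_sym i' k') n2 (eq_sym i' j') n1 eq_sym n3.
have dx := distinct (or_introl erefl) TD n1 n2 n3.
rewrite -leNgt le_eqVlt eq_sym (negbTE dx) /=.
by apply/idP/idP => /(order u').
Qed.

(* both strands on top of [k] slide past their crossing: the identity
   [A * B = (A * B * A) * A] for involutions, in one order or the other *)
Let color_swap : p -> A ** color x = color y ** A /\ color x ** A = A ** color y.
Proof.
have uj : uniq [:: j; i; k] by rewrite /= !inE negb_or (eq_sym j) ij jk ik.
have AA : A ** A = 1%g := conj_rho2 _.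
have cA m : rho ^^ (rho ** m ** A) = A ** (rho ^^ m) ** A.
  move: AA; move: A => B BB; rewrite !conjgE !invMg.
  have -> : B^-1%g = B by apply/eqP; rewrite eq_invg_mul BB.
  have -> : rho^-1%g = rho by apply/eqP; rewrite eq_invg_mul rho2.
  by rewrite !mulgA -(mulgA _ rho rho) rho2 mulg1.
move=> pp; rewrite /color (flip uj) /jump pp; have [l1 l2] := conj_cancel AA.
by case: (x j i < x j k) => /=; rewrite cA l1 l2.
Qed.

Let total q m : m = mu (a q) -> e2 x q (e1 x q m) = e2 y q (e1 y q m).
Proof.
move=> _; rewrite /e1 /e2 /ev; have [->|->|->] := ord3P q ijk.
- by rewrite !mark_i /jump; do 2![case: ifP].
- rewrite /o1 /o2 (eq_sym j i) (negbTE ij) (negbTE jk) mark_k mark_ij eqxx.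
  by rewrite /jump; case: (x j i < x j k); case: (y j i < y j k).
- have uk : uniq [:: k; i; j] by rewrite /= !inE negb_or (eq_sym k) ik (eq_sym k) jk ij.
  have uj : uniq [:: j; i; k] by rewrite /= !inE negb_or (eq_sym j) ij jk ik.
  rewrite /o1 /o2 (eq_sym k i) (negbTE ik) eqxx mark_ik mark_jk eqxx (eq_sym j i) (negbTE ij).
  rewrite (flip uk); have [pp|np] := boolP p.
    by have [s1 s2] := color_swap pp; exact: jump_swap.
  have -> : color x = color y.
    by rewrite /color (flip uj) /jump (negbTE np) !if_same.
  by rewrite /jump; case: (x k i < x k j).
Qed.

(** The colour of the middle strand where it meets the lowest one is conjugated by
   the colour of the top strand, exactly when the order of the two under-crossings
   of the lowest strand is exchanged: the total jump along each strand is the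
   same before and after. *)
Lemma move3_patch : developable E.
Proof.
apply: (@developable_events 3 a b D E mu (lo x) (hi x) (lo y) (hi y)
  (e1 x) (e2 x) (e1 y) (e2 y)) => //.
- by move=> q; apply: lohi TD; left.
- by move=> q; apply: lohi TE; right.
- by move=> q u; apply: read; exact: colors.
- by move=> q; exact: total.
- move=> q r u o uq ro ou; rewrite -!/(nu y _).
  have [rq ur or_] := hit (or_intror erefl) TE uq ro ou.
  have m : mark r q by apply/overE => //; rewrite -ur -or_.
  have evE : ev y q r (nu y q u) = rho ** nu y q u ** rho ^^ nu y r o.
    rewrite /ev m /jump; congr (_ ** _).
    case: (markE m) => [ri|[rj qk]]; first by subst r; rewrite eqxx nu_i.
    by subst r q; rewrite or_ (nu_jk (or_intror erefl) TE) (eq_sym j i) (negbTE ij).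
  have [h1 h2 h3] := others q; have dy := distinct (or_intror erefl) TE h1 h2 h3.
  move: evE dy; rewrite /lo /hi /e1 /e2; move: (nu y q u) (rho ^^ nu y r o) => m1 m2.
  by case: (otherP rq) ur => -> ->; case: (ltgtP (y q (o1 q)) (y q (o2 q))) => // _ ->;
    by [left|right].
- move=> q u uq no; have [h1 h2 h3] := others q.
  have dy := distinct (or_intror erefl) TE h1 h2 h3.
  have nomark r : r != q -> u = y q r -> forall m, ev y q r m = m.
    move=> rq ur; rewrite /ev; case: (boolP (mark r q)) => [/(overE rq)|//].
    by rewrite -ur => ou; exfalso; apply: no ou.
  rewrite /lo /hi /e1 /e2; move: dy; case: (ltgtP (y q (o1 q)) (y q (o2 q))) => // _ _.
    by split; exact: nomark.
  by split; exact: nomark.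
Qed.

End Move3.

End Fixed.
End Developing.

Section Developing2.
Variables (R : realType) (gT : finGroupType).
Implicit Types (D E : welded_diagram R) (mu : R -> gT) (s t u o : R).
Local Notation "x ** y" := (mulg x y) (at level 40, left associativity).
Local Notation "x ^^ y" := (conjg x y) (at level 30, right associativity).

Section Fixed.
Variables (rho L : gT).
Hypotheses (rho2 : rho ** rho = 1%g) (rhoL : commute rho L).

Lemma move3_sym D E : move3 D E -> move3 E D.
Proof.
move=> [a [b [x [y [DE TD TE mk [signs order]]]]]]; exists a, b, y, x; split; [exact: local_change_sym|exact: TE|exact: TD| |].
- case: mk => i [j [k [ijk mk]]]; exists i, j, k; split => //.
  have [ij ik jk] : [/\ i != j, i != k & j != k].
    by move: ijk; rewrite /= !inE negb_or => /and3P[/andP[? ?] ? _].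
  have o q r : q != r -> over D (x q r) (x r q) -> over E (y q r) (y r q).
    by move=> qr; apply (signs q r qr).1.
  have o' q r : q != r -> over E (y q r) (y r q) -> over D (x q r) (x r q).
    by move=> qr; apply (signs q r qr).1.
  have wd q r : q != r -> welded D (x q r) (x r q) -> welded E (y q r) (y r q).
    move=> qr [_ n1 n2]; case: TE => yin yX; split.
    - by apply/(yX q r); rewrite ?yin// eq_sym.
    - by move=> /(o' _ _ qr).
    - by move=> /o'; rewrite eq_sym => /(_ qr).
  case: mk => [[h1 h2 h3]|[[h1 h2 h3]|[[h1 h2 h3]|[h1 h2 h3]]]];
    [left|right; left|right; right; left|right; right; right]; split;
    (exact: o ij h1 || exact: wd ij h1 || exact: o ik h2 || exact: wd ik h2 ||
     exact: o jk h3 || exact: wd jk h3).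
- split=> [i j ij|i j k ijk].
    have [h1 h2] := signs i j ij; split; last exact: esym h2.
    by split; [exact: h1.2|exact: h1.1].
  have ikj : uniq [:: i; k; j].
    by move: ijk; rewrite /= !inE !negb_or => /and3P[/andP[-> ->]]; rewrite eq_sym => ->.
  have o := order _ _ _ ikj; split; [exact: o.2|exact: o.1].
Qed.

Lemma move3_developable D E : move3 D E -> developable rho L D -> developable rho L E.
Proof.
move=> [a [b [x [y [DE TD TE mk [signs order]]]]]] [mu dev].
case: mk => i [j [k [ijk mk]]].
have [ij ik jk] : [/\ i != j, i != k & j != k].
  by move: ijk; rewrite /= !inE negb_or => /and3P[/andP[? ?] ? _].
have overs (p w : bool) :
    (over D (x i j) (x j i) <-> p) /\ ~ over D (x j i) (x i j) ->
    (over D (x i k) (x k i) <-> p) /\ ~ over D (x k i) (x i k) ->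
    (over D (x j k) (x k j) <-> w) /\ ~ over D (x k j) (x j k) ->
  forall r q, r != q -> over D (x r q) (x q r) <->
    [|| [&& r == i, q == j & p], [&& r == i, q == k & p] | [&& r == j, q == k & w]].
  move=> [h1 h1'] [h2 h2'] [h3 h3'] r q.
  by have [->|->|->] := ord3P r ijk; have [->|->|->] := ord3P q ijk;
   rewrite ?eqxx ?(negbTE ij) ?(negbTE ik) ?(negbTE jk) ?(eq_sym j i) ?(eq_sym k i) ?(eq_sym k j)
     ?(negbTE ij) ?(negbTE ik) ?(negbTE jk) /= ?orbF.
have o_ q r : over D (x q r) (x r q) -> (over D (x q r) (x r q) <-> true) /\ ~ over D (x r q) (x q r).
  by move=> o; split; [split|exact: over_asym].
have w_ q r : welded D (x q r) (x r q) -> (over D (x q r) (x r q) <-> false) /\ ~ over D (x r q) (x q r).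
  by move=> [_ n1 n2]; split; [split|].
have [p [w overD]] : exists p w : bool, forall r q, r != q -> over D (x r q) (x q r) <->
    [|| [&& r == i, q == j & p], [&& r == i, q == k & p] | [&& r == j, q == k & w]].
  by case: mk => [[h1 h2 h3]|[[h1 h2 h3]|[[h1 h2 h3]|[h1 h2 h3]]]];
   [exists true, true|exists false, false|exists false, true|exists true, false];
   apply: overs; (exact: o_ || exact: w_).
have overE r q : r != q -> over E (y r q) (y q r) <->
    [|| [&& r == i, q == j & p], [&& r == i, q == k & p] | [&& r == j, q == k & w]].
  by move=> rq; rewrite -(overD r q rq); split; apply (signs r q rq).1.
exact: (move3_patch rho2 rhoL DE TD TE ijk overD overE order dev).
Qed.

(** Only the order of the parameters and the marking of the crossings enter in the
   definition of a developing map. *)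
Lemma developing_reparam D E (g : R -> R) nu :
  {homo g : s t / s < t} ->
  (forall u (e : R), 0 < e -> exists2 d : R, 0 < d & forall s, `|s - u| < d -> `|g s - g u| < e) ->
  (forall s, g (s + 1) = g s + 1) -> (forall s, exists t, g t = s) ->
  (forall s t, over D s t <-> over E (g s) (g t)) ->
  developing rho L E nu -> developing rho L D (nu \o g).
Proof.
move=> gm gc g1 gs DE [nul nuo nuf nuL].
have left_ u (P : R -> Prop) : (\forall s \near (g u)^'-, P s) -> \forall s \near u^'-, P (g s).
  move=> /near_leftP[d d0 H]; apply/near_leftP; have [e e0 ge] := gc u d d0.
  exists e => // s /andP[s1 s2]; apply: H; rewrite gm// andbT.
  have : `|s - u| < e by rewrite ltr_norml; apply/andP; split; lra.
  by move=> /ge; rewrite ltr_norml => /andP[h _]; lra.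
have right_ u (P : R -> Prop) : (\forall s \near (g u)^'+, P s) -> \forall s \near u^'+, P (g s).
  move=> /near_rightP[d d0 H]; apply/near_rightP; have [e e0 ge] := gc u d d0.
  exists e => // s /andP[s1 s2]; apply: H; rewrite gm//=.
  have : `|s - u| < e by rewrite ltr_norml; apply/andP; split; lra.
  by move=> /ge; rewrite ltr_norml => /andP[_ h]; lra.
split => /= [u|o u /DE ou|u uf|s]; last by rewrite g1 nuL.
- exact: (left_ u (fun v => nu v = nu (g u)) (nul _)).
- exact: (right_ u (fun v => nu v = _) (nuo _ _ ou)).
- apply: (right_ u (fun v => nu v = nu (g u)) (nuf _ _)) => o; have [ o' <-] := gs o => /DE; exact: uf.
Qed.

(** The reparametrization of a planar isotopy is an increasing homeomorphism of
   the line; both directions are instances of the previous lemma. *)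
Lemma planar_isotopy_developable D E : planar_isotopy D E ->
  (developable rho L D <-> developable rho L E).
Proof.
move=> [H [g [_ [sg dg g1] _ DE]]].
have gd (x : R) : is_derive x 1 g (derive1 g x).
  by rewrite derive1E; apply: derivableP; exact: smooth_derivable.
have gc : continuous g := smooth_continuous sg.
have gm : {homo g : s t / s < t}.
  move=> s t st; have [c _ gts] := MVT st (fun x _ => gd x) (continuous_subspaceT gc).
  by rewrite -subr_gt0 gts mulr_gt0// subr_gt0.
have gle : {mono g : s t / s <= t} := le_mono gm.
have glt : {mono g : s t / s < t} := leW_mono gle.
have gn (n : nat) s : g (s + n%:R) = g s + n%:R.
  by elim: n => [|n IH]; rewrite ?addr0// -natr1 !addrA g1 IH.
have gs s : exists t, g t = s.
  pose n := (Num.truncn `|s - g 0|).+1.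
  have nP : `|s - g 0| < n%:R by have := truncnS_gt `|s - g 0|.
  have gN : g (- n%:R) = g 0 - n%:R by have := gn n (- n%:R); rewrite addNr => ->; rewrite addrK.
  have gP : g n%:R = g 0 + n%:R by rewrite -gn add0r.
  move: nP; rewrite ltr_norml => /andP[n1 n2].
  have n0 : - n%:R <= n%:R :> R by lra.
  have [|t _ <-] := @IVT R g _ _ s n0 (continuous_subspaceT gc); last by exists t.
  by rewrite min_l ?max_r ?gle//; apply/andP; split; lra.
have [h gh] := choice gs.
have hg s : h (g s) = s by apply: (inc_inj gle); rewrite gh.
have hlt : {mono h : s t / s < t} by move=> s t; rewrite -glt !gh.
split=> -[mu dev].
  exists (mu \o h); apply: (developing_reparam (g := h) _ _ _ _ _ dev).
  - by move=> s t; rewrite hlt.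
  - move=> u e e0; exists (Num.min (u - g (h u - e)) (g (h u + e) - u)).
      by rewrite lt_min !subr_gt0 -{2}(gh u) -{3}(gh u) !glt; apply/andP; split; lra.
    move=> s; rewrite lt_min !ltr_norml => /andP[/andP[s1 _] /andP[_ s2]].
    have : g (h u - e) < s by lra.
    have : s < g (h u + e) by lra.
    by rewrite -(gh s) !glt hg => ? ?; apply/andP; split; lra.
  - by move=> s; apply: (inc_inj gle); rewrite g1 !gh.
  - by move=> s; exists (g s).
  - by move=> s t; rewrite DE !gh.
exists (mu \o g); apply: (developing_reparam (g := g) gm _ g1 gs DE dev).
move=> u e e0; have /cvgrPdist_lt/(_ e e0)/nbhs_ballP[d /= d0 Hd] := gc u.
exists d => // s sd; rewrite distrC; apply: Hd; rewrite /ball /= distrC; exact: sd.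
Qed.

Lemma welded_equiv_developable D E : welded_equiv D E -> (developable rho L D <-> developable rho L E).
Proof.
elim=> {D E} [D E [iso|[m1|[m2|m3]]]|D|D E _ [h1 h2]|D E F _ [h1 h2] _ [h3 h4]].
- exact: planar_isotopy_developable.
- split; first exact (move1_developable rho2 rhoL m1).
  exact (move1_developable_inv rho2 rhoL m1).
- exact (move2_developable rho2 rhoL m2).
- split; first exact (move3_developable m3).
  exact (move3_developable (move3_sym m3)).
- exact: iff_refl.
- exact (conj h2 h1).
- by split; [move/h1/h3|move/h4/h2].
Qed.

End Fixed.

(** Reversing the strand inverts the monodromy: the jumps are involutive, so
   they can be read backwards. *)
Lemma developable_reverse (rho L : gT) D E : rho ** rho = 1%g -> commute rho L ->
  (forall s t, over E s t <-> over D (- s) (- t)) ->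
  developable rho L D -> developable rho (L^-1)%g E.
Proof.
move=> rho2 rhoL ED [mu [mul muo muf muL]].
have after u : exists m, \forall s \near u^'+, mu s = m.
  have [[ o ou]|no] := pselect (exists o, over D o u).
    by exists (rho ** mu u ** rho ^^ mu o); exact: muo.
  by exists (mu u); apply: muf => o ou; apply: no; exists o.
have [post postP] := choice after.
have uniq u m d : 0 < d -> (forall s, u < s < u + d -> mu s = m) -> post u = m.
  move=> d0 H; have /near_rightP[e e0 He] := postP u.
  pose v := u + Num.min d e / 2.
  have [v1 v2 v3] : [/\ u < v, v < u + d & v < u + e].
    by rewrite /v; have [h|h] := leP d e; split; lra.
  by rewrite -(H v) ?v1// He ?v1.
have uniqn u m : (\forall s \near u^'+, mu s = m) -> post u = m.
  by move=> /near_rightP[d d0 H]; exact: uniq H.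
have post_shift u : post (u + 1) = L ** post u.
  apply: uniqn; have := near_right_shift 1 (postP u); apply: filterS => s.
  by rewrite -{2}(subrK 1 s) muL => ->.
have post_right u : exists2 d, 0 < d & forall s, u < s < u + d -> post s = post u.
  have /near_rightP[d d0 H] := postP u; exists d => // s /andP[s1 s2].
  apply: (uniq _ _ (u + d - s)); first by lra.
  by move=> v /andP[v1 v2]; apply: H; apply/andP; split; lra.
have post_left u : exists2 d, 0 < d & forall s, u - d < s < u -> post s = mu u.
  have /near_leftP[d d0 H] := mul u; exists d => // s /andP[s1 s2].
  apply: (uniq _ _ (u - s)); first by lra.
  by move=> v /andP[v1 v2]; apply: H; apply/andP; split; lra.
exists (fun s => post (- s)); split.
- move=> u; apply/near_leftP; have [d d0 H] := post_right (- u).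
  by exists d => // s /andP[s1 s2]; apply: H; apply/andP; split; lra.
- move=> o u /ED ou; apply/near_rightP; have [d d0 H] := post_left (- u).
  exists d => // s /andP[s1 s2]; rewrite H; last by apply/andP; split; lra.
  rewrite (uniqn _ _ (muo _ _ ou)) (uniqn (- o) (mu (- o))); last first.
    by apply: muf => o'; exact: over_top ou.
  by rewrite jumpK// conj_rho2.
- move=> u uf; apply/near_rightP; have [d d0 H] := post_left (- u).
  exists d => // s /andP[s1 s2]; rewrite H; last by apply/andP; split; lra.
  apply/esym/uniqn/muf => o ou; apply: (uf (- o)); apply/ED; by rewrite opprK.
- move=> s; rewrite opprD -{2}(subrK 1 (- s)) post_shift mulgA mulVg mul1g.
  by [].
Qed.

End Developing2.

(** * A longitude in the Mathieu group of degree 11 *)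

Section Tables.
Local Open Scope nat_scope.

(** Permutations of 0, ..., 10 are represented by the lists of their values, in
   order that the finite search below is a plain computation.  As for
   permutations, the left factor acts first. *)
Definition compose (x y : seq nat) : seq nat := [seq nth 0 y i | i <- x].
Definition conj_table (x c : seq nat) := compose (compose c x) c.

(** Generators of the Mathieu group of degree 11, and their inverses. *)
Definition tableA := [:: 1; 2; 3; 4; 5; 6; 7; 8; 9; 10; 0].
Definition tableB := [:: 0; 1; 6; 9; 5; 3; 10; 2; 8; 4; 7].
Definition tableA' := [:: 10; 0; 1; 2; 3; 4; 5; 6; 7; 8; 9].
Definition tableB' := [:: 0; 1; 7; 5; 9; 4; 2; 10; 8; 3; 6].
Definition table_rho := compose tableB tableB.
Definition table1 := iota 0 11.

(** The conjugacy class of the square of the second generator, the involutions of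
   the group, computed as an orbit under conjugation by the generators; ten
   rounds exhaust it, by [involutions_closed]. *)
Fixpoint orbit_tables n (s : seq (seq nat)) :=
  if n is n'.+1 then
    orbit_tables n' (undup (s ++ [seq compose (compose tableA' x) tableA | x <- s]
                              ++ [seq compose (compose tableB' x) tableB | x <- s]))
  else s.

Definition involutions := orbit_tables 10 [:: table_rho].

(** The knot: arc [i] ends by passing under arc [over_arc_of i], and arc [i.+1]
   begins, arc 9 being arc 0. *)
Definition over_arc_of := nth 0 [:: 2; 0; 6; 1; 6; 4; 2; 1; 4].

(* The colours of all arcs follow from those of the arcs 0, 2 and 6, and the
   arcs 2, 6 and 0 give one equation each. *)
Definition colouring_longitude (c0 c2 c6 : seq nat) : option (seq nat) :=
  let c1 := conj_table c0 c2 in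
  if conj_table c1 c0 != c2 then None else
  let c3 := conj_table c2 c6 in
  let c4 := conj_table c3 c1 in
  let c5 := conj_table c4 c6 in
  if conj_table c5 c4 != c6 then None else
  let c7 := conj_table c6 c2 in
  let c8 := conj_table c7 c1 in
  if conj_table c8 c4 != c0 then None else
  Some (foldl (fun m c => compose (compose table_rho m) c) table1
          [:: c2; c0; c6; c1; c6; c4; c2; c1; c4]).

Definition table_longitude := [:: 8; 1; 5; 7; 6; 3; 2; 10; 0; 4; 9].

Definition inverse_longitude c2 c6 :=
  if colouring_longitude table_rho c2 c6 is Some m
  then compose table_longitude m == table1 else false.

Definition first_equation c2 := conj_table (conj_table table_rho c2) table_rho == c2.

Lemma involutions_closed :
  all (fun x => (compose (compose tableA' x) tableA \in involutions) &&
                (compose (compose tableB' x) tableB \in involutions)) involutions &&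
  (table_rho \in involutions).
Proof. by vm_compute. Qed.

(** The search: conjugating, one may let arc 0 have the fixed colour; for the
   colours of arcs 2 and 6 there are at most 165 * 165 choices, and most of them
   already violate the equation at arc 2. *)
Lemma inverse_longitude_excluded :
  ~~ has (fun c2 => first_equation c2 && has (inverse_longitude c2) involutions) involutions.
Proof. by vm_compute. Qed.

Lemma foldl_arcs (T U : Type) (f : T -> U -> T) (x : nat -> T) (c : nat -> U) :
  (forall i, i < 9 -> f (x i) (c (over_arc_of i)) = x i.+1) ->
  foldl f (x 0) [:: c 2; c 0; c 6; c 1; c 6; c 4; c 2; c 1; c 4] = x 9.
Proof.
move=> fx; rewrite -(fx 8 isT) -(fx 7 isT) -(fx 6 isT) -(fx 5 isT) -(fx 4 isT).
by rewrite -(fx 3 isT) -(fx 2 isT) -(fx 1 isT) -(fx 0 isT).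
Qed.

Lemma colouring_longitudeE (c : nat -> seq nat) :
  (forall i, i < 9 -> c i.+1 = conj_table (c i) (c (over_arc_of i))) -> c 9 = c 0 ->
  conj_table (conj_table (c 0) (c 2)) (c 0) = c 2 /\
  colouring_longitude (c 0) (c 2) (c 6) =
  Some (foldl (fun m c => compose (compose table_rho m) c) table1
     [:: c 2; c 0; c 6; c 1; c 6; c 4; c 2; c 1; c 4]).
Proof.
move=> cS c90.
have e1 : c 1 = conj_table (c 0) (c 2) := cS 0 isT.
have e2 : c 2 = conj_table (c 1) (c 0) := cS 1 isT.
have e3 : c 3 = conj_table (c 2) (c 6) := cS 2 isT.
have e4 : c 4 = conj_table (c 3) (c 1) := cS 3 isT.
have e5 : c 5 = conj_table (c 4) (c 6) := cS 4 isT.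
have e6 : c 6 = conj_table (c 5) (c 4) := cS 5 isT.
have e7 : c 7 = conj_table (c 6) (c 2) := cS 6 isT.
have e8 : c 8 = conj_table (c 7) (c 1) := cS 7 isT.
have e9 : c 9 = conj_table (c 8) (c 4) := cS 8 isT.
rewrite /colouring_longitude -e1 -e2; split=> //.
rewrite eqxx /= -e3 -e4 -e5 -e6 eqxx /= -e7 -e8 -e9 c90 eqxx.
by [].
Qed.

End Tables.

Section Permutations.
Local Open Scope group_scope.

Definition table (p : {perm 'I_11}) : seq nat := mkseq (fun i => val (p (inord i))) 11.

Lemma nth_table p (i : 'I_11) : nth 0%N (table p) i = p i.
Proof. by rewrite nth_mkseq// inord_val. Qed.

Lemma table_inj : injective table.
Proof. by move=> p q pq; apply/permP => i; apply: val_inj; rewrite /= -!nth_table pq. Qed.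

Lemma tableM p q : table (p * q) = compose (table p) (table q).
Proof.
apply: (@eq_from_nth _ 0%N) => [|i]; rewrite size_mkseq ?size_map ?size_mkseq// => i11.
have -> : i = Ordinal i11 by [].
by rewrite /compose (nth_map 0%N) ?size_mkseq// !nth_table permM.
Qed.

Lemma table_id : table 1 = table1.
Proof.
apply: (@eq_from_nth _ 0%N) => [|i]; rewrite size_mkseq// => i11.
have -> : i = Ordinal i11 by [].
by rewrite nth_table perm1 nth_iota.
Qed.

Definition is_table (t : seq nat) := [&& size t == 11, uniq t & all (fun i => i < 11)%N t].

Lemma perm_of_table t : is_table t -> exists p, table p = t.
Proof.
move=> /and3P[/eqP st ut /allP lt].
have lti (i : 'I_11) : (nth 0%N t i < 11)%N by apply/lt/mem_nth; rewrite st.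
have inj : injective (fun i : 'I_11 => Ordinal (lti i)).
  move=> i j [] /eqP; rewrite nth_uniq ?st// => /eqP; exact: val_inj.
exists (perm inj); apply: (@eq_from_nth _ 0%N) => [|i]; rewrite size_mkseq ?st// => i11.
have -> : i = Ordinal i11 by [].
by rewrite nth_table permE.
Qed.

(** In the Mathieu group of degree 11 the elements of order 8 are not conjugate to
   their inverses, and every automorphism is inner.  So the longitude of a
   colouring may have order 8 without its inverse being the longitude of a
   colouring obtained from it by symmetry; that no other colouring yields the
   inverse is the finite check.  The positive half is the explicit colouring with
   [g 2] and [g 6] as [w2] and [w6], words in the generators. *)
Theorem chiral_longitude : exists (gT : finGroupType) (rho L : gT),
  [/\ rho * rho = 1, commute rho L,
      exists g : nat -> gT,
        (forall i, (i < 9)%N -> g i.+1 = rho * g i * rho ^ g (over_arc_of i)) /\ g 9%N = L * g 0%N &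
      ~ exists g : nat -> gT,
        (forall i, (i < 9)%N -> g i.+1 = rho * g i * rho ^ g (over_arc_of i)) /\ g 9%N = L^-1 * g 0%N].
Proof.
move: involutions involutions_closed inverse_longitude_excluded.
move=> involutions involutions_closed inverse_longitude_excluded.
have [pA tA] : exists p, table p = tableA by apply: perm_of_table.
have [pB tB] : exists p, table p = tableB by apply: perm_of_table.
have tA' : table pA^-1 = tableA'.
  have [p tp] : exists p, table p = tableA' by apply: perm_of_table.
  suff -> : pA^-1 = p by [].
  by apply/eqP; rewrite eq_invg_mul; apply/eqP/table_inj; rewrite tableM tA tp table_id.
have tB' : table pB^-1 = tableB'.
  have [p tp] : exists p, table p = tableB' by apply: perm_of_table.
  suff -> : pB^-1 = p by [].
  by apply/eqP; rewrite eq_invg_mul; apply/eqP/table_inj; rewrite tableM tB tp table_id.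
pose M := <<[set pA; pB]%SET>>%G.
have AM : pA \in M by apply: mem_gen; rewrite !inE eqxx.
have BM : pB \in M by apply: mem_gen; rewrite !inE eqxx orbT.
pose gA := subg M pA; pose gB := subg M pB.
pose tb (g : subg_of M) := table (sgval g).
have tbM g h : tb (g * h) = compose (tb g) (tb h) by rewrite /tb /= tableM.
have tbi : injective tb by move=> g h /table_inj/subg_inj.
have tb1 : tb 1 = table1 by rewrite /tb table_id.
have tbA : tb gA = tableA by rewrite /tb subgK.
have tbB : tb gB = tableB by rewrite /tb subgK.
have tbA' : tb gA^-1 = tableA' by rewrite /tb -[sgval gA^-1]/((sgval gA)^-1) subgK.
have tbB' : tb gB^-1 = tableB' by rewrite /tb -[sgval gB^-1]/((sgval gB)^-1) subgK.
pose rho := gB * gB.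
have tbrho : tb rho = table_rho by rewrite tbM tbB.
have rho2 : rho * rho = 1 by apply: tbi; rewrite tbM tbrho tb1.
have rho2J g : rho ^ g * rho ^ g = 1 by rewrite -conjMg rho2 conj1g.
have conjJ x g : x ^ (rho ^ g) = rho ^ g * x * rho ^ g.
  have -> : x ^ (rho ^ g) = (rho ^ g)^-1 * (x * rho ^ g) by [].
  have -> : (rho ^ g)^-1 = rho ^ g by apply/eqP; rewrite eq_invg_mul rho2J.
  by rewrite mulgA.
have in_class g : tb (rho ^ g) \in involutions.
  pose S := [set p | table p \in involutions]%SET.
  have /andP[/allP cl rS] := involutions_closed.
  have MS : M \subset 'N(S).
    rewrite gen_subG; apply/fintype.subsetP => x; rewrite !inE => /orP[]/eqP->;
      apply/fintype.subsetP => y /imsetP[p pS ->]; move: pS; rewrite !inE => /cl/andP[h1 h2].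
    - by rewrite conjgE !tableM tA tA' /compose -map_comp in h1 *.
    - by rewrite conjgE !tableM tB tB' /compose -map_comp in h2 *.
  have := memJ_norm (sgval rho) (fintype.subsetP MS _ (subgP g)).
  by rewrite !inE -[table (sgval rho)]/(tb rho) tbrho rS => H; exact: H.
have tbJA x : tb (x ^ gA) = compose (compose tableA' (tb x)) tableA.
  by rewrite conjgE !tbM tbA tbA' /compose -map_comp.
have tbJB x : tb (x ^ gB) = compose (compose tableB' (tb x)) tableB.
  by rewrite conjgE !tbM tbB tbB' /compose -map_comp.
have step g h : rho ^ (rho * g * rho ^ h) = rho ^ h * rho ^ g * rho ^ h.
  have -> : rho ^ (rho * g * rho ^ h) = (rho ^ (rho * g)) ^ (rho ^ h) by rewrite conjgM.
  by rewrite conjJ conjgM (_ : rho ^ rho = rho)// /conjg mulKg.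
have tbstep g h : tb (rho ^ (rho * g * rho ^ h)) = conj_table (tb (rho ^ g)) (tb (rho ^ h)).
  by rewrite step !tbM.
(* [rho ^ w2] and [rho ^ w6] are the colours of arcs 2 and 6; the recursion then
   yields all other arcs. *)
pose w2 := gA * gB * gB * gA * gB * gA.
pose w6 := gA * gA * gB * gA.
pose c2 := rho ^ w2; pose c6 := rho ^ w6.
have tb_c2 : tb c2 = [:: 0; 1; 4; 5; 2; 3; 8; 7; 6; 10; 9]%N.
  by rewrite /c2 /w2 !conjgM !(tbJA, tbJB) tbrho.
have tb_c6 : tb c6 = [:: 4; 3; 6; 1; 0; 9; 2; 7; 8; 5; 10]%N.
  by rewrite /c6 /w6 !conjgM !(tbJA, tbJB) tbrho.
pose g1 := rho * 1 * rho ^ w2; pose g2 := rho * g1 * rho ^ (1 : subg_of M).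
pose g3 := rho * g2 * rho ^ w6; pose g4 := rho * g3 * rho ^ g1.
pose g5 := rho * g4 * rho ^ w6; pose g6 := rho * g5 * rho ^ g4.
pose g7 := rho * g6 * rho ^ w2; pose g8 := rho * g7 * rho ^ g1.
pose g9 := rho * g8 * rho ^ g4.
have x0 : tb (rho ^ (1 : subg_of M)) = table_rho by rewrite conjg1.
have x1 : tb (rho ^ g1) = conj_table table_rho (tb c2) by rewrite (tbstep 1 w2) x0.
have x2 : tb (rho ^ g2) = tb c2 by rewrite (tbstep g1 1) x1 x0 tb_c2.
have x4 : tb (rho ^ g4) = conj_table (conj_table (tb c2) (tb c6)) (tb (rho ^ g1)).
  by rewrite (tbstep g3 g1) (tbstep g2 w6) x2.
have x6 : tb (rho ^ g6) = tb c6.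
  by rewrite (tbstep g5 g4) (tbstep g4 w6) -/c6 x4 x1 tb_c2 tb_c6.
have x9 : rho ^ g9 = rho.
  apply: tbi; rewrite (tbstep g8 g4) (tbstep g7 g1) (tbstep g6 w2) -/c2 x6 x4 x1.
  by rewrite tb_c2 tb_c6 tbrho.
have tbm g h : tb (rho * g * h) = compose (compose table_rho (tb g)) (tb h).
  by rewrite (tbM (rho * g)) (tbM rho) tbrho.
have tb9 : tb g9 = table_longitude.
  rewrite (tbm g8) (tbm g7) (tbm g6) (tbm g5) (tbm g4) (tbm g3) (tbm g2) (tbm g1) (tbm 1).
  by rewrite -/c2 -/c6 x4 x1 x0 tb1 tb_c2 tb_c6.
have c2E : rho ^ g2 = rho ^ w2 by apply: tbi; rewrite x2.
have c6E : rho ^ g6 = rho ^ w6 by apply: tbi; rewrite x6.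
exists (subg_of M), rho, g9; split => //.
- by apply/commgP/conjg_fixP.
- exists (nth 1 [:: 1; g1; g2; g3; g4; g5; g6; g7; g8; g9]); split; last by rewrite mulg1.
  by do 9![case=> [_|]; first by rewrite /= ?c2E ?c6E].
move=> [g [gS g9E]].
(* Normalized such that arc 0 has the colour [rho], as in the search. *)
pose h i := g i * (g 0%N)^-1.
have hS i : (i < 9)%N -> h i.+1 = rho * h i * rho ^ h (over_arc_of i).
  by move=> i9; rewrite /h gS// conjgM; move: (rho ^ g (over_arc_of i)) => C; rewrite /conjg !mulgA mulgK.
have h0 : h 0%N = 1 by rewrite /h mulgV.
have h9 : g9 * h 9%N = 1 by rewrite /h g9E !mulgA mulgV mul1g mulgV.
move: hS h0 h9; move: (h) => {}h {g gS g9E} hS h0 h9.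
pose c i := tb (rho ^ h i).
have cS i : (i < 9)%N -> c i.+1 = conj_table (c i) (c (over_arc_of i)).
  by move=> i9; rewrite /c hS// tbstep.
have c0 : c 0%N = table_rho by rewrite /c h0 conjg1.
have c9 : c 9%N = table_rho.
  rewrite /c (_ : h 9%N = g9^-1); last by apply/eqP; rewrite eq_sym eq_invg_mul h9.
  by rewrite -{1}x9 -conjgM mulgV conjg1.
have tL : foldl (fun m c => compose (compose table_rho m) c) table1
   [:: c 2%N; c 0%N; c 6%N; c 1%N; c 6%N; c 4%N; c 2%N; c 1%N; c 4%N] = tb (h 9%N).
  rewrite -tb1 -h0; apply: (foldl_arcs (x := fun i => tb (h i))) => i i9.
  by rewrite [in RHS]hS// tbm.
move/negP: inverse_longitude_excluded; apply; apply/hasP.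
have [E1 E2] := colouring_longitudeE cS (etrans c9 (esym c0)).
exists (c 2%N); first exact: in_class.
rewrite /first_equation -{1 2}c0 E1 eqxx; apply/hasP; exists (c 6%N); first exact: in_class.
rewrite /inverse_longitude -c0 E2 tL -tb9 -tbM h9 tb1.
exact: eqxx.
Qed.

End Permutations.

(** * Smooth square and triangle waves *)

Section Flat.
Variable R : realType.
Implicit Types (p : {poly R}) (x h : R).

(** Flatness at 0 follows from a quadratic bound, which is all that is needed
   there since the derivatives are again of the same form. *)
Lemma is_derive_quadratic (f : R -> R) (C : R) : 0 < C ->
  (forall h, `|h| <= 1 -> `|f h| <= C * h ^+ 2) ->
  is_derive (0 : R) (1 : R) f (0 : R).
Proof.
move=> C0 fC; have f0 : f 0 = 0.
  by apply/eqP; have := fC 0; rewrite normr0 ler01 expr0n mulr0 normr_le0 => /(_ isT).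
have lim0 : (fun h : R => h^-1 *: (f (h *: 1 + 0) - f 0)) @ 0^' --> (0 : R).
  apply/cvgr0Pnorm_le => e e0; near=> h.
  have h0 : h != 0 by near: h; exact: nbhs_dnbhs_neq.
  rewrite f0 subr0 addr0 -[h *: 1]/(h * 1) mulr1 normrM normfV ler_pdivrMl ?normr_gt0//.
  have h1 : `|h| <= 1.
    by near: h; apply: (@dnbhs0_le _ R) => //.
  apply: le_trans (fC h h1) _.
  rewrite -real_normK ?num_real// expr2 mulrCA ler_wpM2l//.
  have : `|h| <= e / C by near: h; apply: (@dnbhs0_le _ R); rewrite divr_gt0.
  by rewrite ler_pdivlMr// mulrC.
split; first by apply/cvg_ex; exists 0.
exact: cvg_lim lim0.
Unshelve. all: by end_near. Qed.

(** The functions [p (1/x) exp (- 1/x)], extended by 0, are closed under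
   differentiation; so they are smooth. *)
Definition flat p x : R := if x <= 0 then 0 else p.[x^-1] * expR (- x^-1).

Lemma flat_quadratic p : exists2 C, 0 < C & forall h, `|h| <= 1 -> `|flat p h| <= C * h ^+ 2.
Proof.
pose n := size p; pose S := \sum_(i < n) `|p`_i|.
have S0 : 0 <= S by apply: sumr_ge0.
exists (S * n.+2`!%:R + 1); first by rewrite ltr_wpDl// mulr_ge0.
move=> h; rewrite /flat; case: (leP h 0) => [_ _|h0 h1]; rewrite ?normr0.
  by rewrite mulr_ge0 ?sqr_ge0// addr_ge0// mulr_ge0.
rewrite gtr0_norm// in h1.
have y1 : 1 <= h^-1 by rewrite invf_ge1.
have y0 : 0 < h^-1 by rewrite invr_gt0.
rewrite normrM (ger0_norm (expR_ge0 _)).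
have b1 : `|p.[h^-1]| <= S * h^-1 ^+ n.
  rewrite horner_coef; apply: le_trans (ler_norm_sum _ _ _) _.
  rewrite mulr_suml; apply: ler_sum => i _.
  by rewrite normrM ler_wpM2l// normrX ger0_norm ?(ltW y0)// ler_weXn2l// ltnW.
have b2 : expR (- h^-1) <= n.+2`!%:R * h ^+ n.+2.
  have F0 : 0 < n.+2`!%:R :> R by rewrite ltr0n fact_gt0.
  have := expR_ge1Dxn n.+1 (ltW y0); rewrite -/(n.+2) => H.
  have hk := exprn_gt0 n.+2 h0; have Fh := mulr_gt0 F0 hk.
  rewrite expRN -[X in _ <= X]invrK lef_pV2 ?posrE ?expR_gt0 ?invr_gt0//.
  by apply: le_trans H; rewrite invfM -exprVn mulrC lerDr.
apply: le_trans (ler_pM (normr_ge0 _) (expR_ge0 _) b1 b2) _.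
have -> : S * h^-1 ^+ n * (n.+2`!%:R * h ^+ n.+2) = S * n.+2`!%:R * h ^+ 2.
  rewrite exprVn -addn2 exprD; have hn : h ^+ n != 0 by rewrite expf_neq0// gt_eqF.
  by field.
by rewrite ler_wpM2r ?sqr_ge0// lerDl.
Qed.

Lemma is_derive_flat p x : is_derive x (1 : R) (flat p) (flat ('X ^+ 2 * (p - p^`())) x).
Proof.
have [x0|x0|->] := ltgtP x 0.
- rewrite {2}/flat ltW//.
  apply: (@near_eq_is_derive R R R (fun=> 0)).
  by near=> y; rewrite /flat ifT//; apply: ltW; near: y; exact: lt_nbhsl.
- rewrite {2}/flat leNgt x0 /=.
  apply: (@near_eq_is_derive R R R (fun y => p.[y^-1] * expR (- y^-1))).
    near=> y; rewrite /flat ifF//; apply/negbTE; rewrite -ltNge.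
    by near: y; exact: lt_nbhsr.
  have xn : x != 0 by rewrite gt_eqF.
  have D1 := is_deriveV xn (is_derive_id x (1 : R)).
  have D2 := is_derive1_comp (is_derive_poly p _) D1.
  have D3 := is_derive1_comp (is_derive_expR _) (is_deriveN D1).
  apply: is_derive_eq (is_deriveM D2 D3) _.
  rewrite !hornerE /= -![_ *: _]/(_ * _) !exprVn /=.
  by field.
- have [C C0 H] := flat_quadratic p.
  by rewrite {2}/flat lexx; exact: is_derive_quadratic H.
Unshelve. all: by end_near. Qed.

Lemma smooth_flat p : smooth (flat p).
Proof.
apply: (@smooth_coind _ _ _ (fun f => exists p, f = flat p)); last by exists p.
move=> {p} _ [p ->]; split.
  move=> x; apply: differentiable_continuous; apply/derivable1_diffP.
  by have [] := is_derive_flat p x.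
move=> v; have Dv x : is_derive x v (flat p) (v * flat ('X ^+ 2 * (p - p^`())) x).
  exact: is_derive_chain (is_derive_id x v) (is_derive_flat p x).
split; first by move=> x; have [] := Dv x.
exists (v *: ('X ^+ 2 * (p - p^`()))); apply/funext => x; have [_ ->] := Dv x.
by rewrite /flat; case: ifP => _; rewrite ?mulr0// hornerZ mulrA.
Qed.

Definition bump x := flat 1 x.

Lemma smooth_bump : smooth bump. Proof. exact: smooth_flat. Qed.

Lemma bumpE x : 0 < x -> bump x = expR (- x^-1).
Proof. by move=> x0; rewrite /bump /flat leNgt x0 /= hornerC mul1r. Qed.

Lemma bump_gt0 x : (0 < bump x) = (0 < x).
Proof.
have [x0|x0] := ltP 0 x; first by rewrite bumpE// expR_gt0.
by rewrite /bump /flat x0 ltxx.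
Qed.

Lemma bump_ge0 x : 0 <= bump x.
Proof.
by rewrite /bump /flat; case: ifP => _ //; rewrite hornerC mul1r expR_ge0.
Qed.

Lemma bump_eq0 x : x <= 0 -> bump x = 0. Proof. by rewrite /bump /flat => ->. Qed.

(** The smooth step; its symmetry [stepC] is what makes the square wave odd, and
   hence the triangle wave periodic. *)
Definition step x := bump x / (bump x + bump (1 - x)).

Lemma step_den x : 0 < bump x + bump (1 - x).
Proof.
have [x0|x0] := ltP 0 x; first by rewrite ltr_pwDl ?bump_gt0 ?bump_ge0.
by rewrite ltr_wpDl ?bump_ge0// bump_gt0; lra.
Qed.

Lemma smooth_step : smooth step.
Proof.
apply: smoothM; first exact: smooth_bump.
apply: smoothV; first by move=> x; rewrite gt_eqF// step_den.
apply: smoothD; first exact: smooth_bump.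
apply: (smooth_comp smooth_bump); apply: smoothB; [exact: smooth_cst|exact: smooth_id].
Qed.

Lemma step0 x : x <= 0 -> step x = 0.
Proof. by move=> /bump_eq0 x0; rewrite /step x0 mul0r. Qed.

Lemma step1 x : 1 <= x -> step x = 1.
Proof.
move=> x1; rewrite /step [bump (1 - x)]bump_eq0; last by lra.
by rewrite addr0 divff// gt_eqF// bump_gt0; lra.
Qed.

Lemma step_ge0 x : 0 <= step x.
Proof. by rewrite divr_ge0 ?bump_ge0// ltW// step_den. Qed.

Lemma stepC x : step (1 - x) = 1 - step x.
Proof.
have := step_den x; rewrite /step (_ : 1 - (1 - x) = x); last by ring.
move: (bump x) (bump (1 - x)) => a b ab.
by field; rewrite gt_eqF//= addrC gt_eqF.
Qed.

Lemma step_le1 x : step x <= 1.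
Proof. by have := step_ge0 (1 - x); rewrite stepC subr_ge0. Qed.

Lemma step_gt_half x : 1 / 2 < x -> 1 / 2 < step x.
Proof.
move=> hx; rewrite /step ltr_pdivlMr ?step_den//.
have : bump (1 - x) < bump x; last by lra.
have [x1|x1] := lerP 1 x; first by rewrite bump_eq0 ?bump_gt0; lra.
have x0 : 0 < x by lra.
have x1' : 0 < 1 - x by lra.
by rewrite (bumpE x0) (bumpE x1') ltr_expR ltrN2 ltf_pV2 ?posrE//; lra.
Qed.

End Flat.

Section Antiderivative.
Variable R : realType.
Implicit Types (A B : R -> R) (x y : R).

Lemma antiderivative_right B : continuous B ->
  exists F, forall x, -1 < x -> is_derive x (1 : R) F (B x).
Proof.
move=> cB; exists (fun x => (\int[@lebesgue_measure R]_(t in [set` `[-1, x]]) B t)%R).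
move=> x x1; have ux : x < x + 1 by lra.
have iB : (@lebesgue_measure R).-integrable `[-1, x + 1] (EFin \o B).
  apply: continuous_compact_integrable; first exact: segment_compact.
  by apply: continuous_subspaceT.
have [dF F'] := continuous_FTC1_closed ux iB x1 (cB x).
by apply: DeriveDef; [exact: dF|rewrite -derive1E; exact: F'].
Qed.

(** Integrating from [-1] gives an antiderivative on the right of [-1] only; it
   is even near 0, and so continues to the left as an even function. *)
Lemma odd_antiderivative B : continuous B -> (forall x, B (- x) = - B x) ->
  exists A, (forall x, is_derive x (1 : R) A (B x)) /\ forall x, A (- x) = A x.
Proof.
move=> cB BN; have [F dF] := antiderivative_right cB.
have dFN x : x < 1 -> is_derive x (1 : R) (fun y => F (- y)) (B x).
  move=> x1; have Nx1 : -1 < - x by lra.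
  have := is_derive1_comp (dF _ Nx1) (is_deriveN (is_derive_id x (1 : R))).
  by rewrite BN mulrN1 opprK.
have ev x : 0 <= x < 1 -> F (- x) = F x.
  move=> /andP[]; rewrite le_eqVlt => /predU1P[<-|x0 x1]; first by rewrite oppr0.
  have D y : -1 < y < 1 -> is_derive y (1 : R) (fun y => F y - F (- y)) 0.
    move=> /andP[y0 y1]; have d1 := dF y y0; have d2 := dFN y y1.
    by have := is_deriveB d1 d2; rewrite subrr; exact.
  have [||c _] := @MVT _ (fun y => F y - F (- y)) (fun=> 0) 0 x x0.
  - by move=> y; rewrite in_itv /= => /andP[y0 y1]; apply: D; apply/andP; split; lra.
  - apply: derivable_within_continuous => y; rewrite in_itv /= => /andP[y0 y1].
    by have [|+ _] := D y; first by apply/andP; split; lra.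
  by rewrite mul0r oppr0 subrr subr0 => /eqP; rewrite subr_eq0 => /eqP.
exists (fun x => if 0 <= x then F x else F (- x)); split; last first.
  move=> x; rewrite oppr_ge0 opprK; case: (ltgtP x 0) => [//|//|->].
  by rewrite oppr0.
move=> x; have [x0|x0|->] := ltgtP x 0.
- have D := dFN x (lt_trans x0 ltr01).
  apply: (@near_eq_is_derive R R R (fun y => F (- y))).
  by near=> y; rewrite ifF//; apply/negbTE; rewrite -ltNge; near: y; exact: lt_nbhsl.
- have x1 : -1 < x by lra.
  have D := dF x x1.
  apply: (@near_eq_is_derive R R R F).
  by near=> y; rewrite ifT//; apply: ltW; near: y; exact: lt_nbhsr.
- have x1 : -1 < 0 :> R by lra.
  have D := dF 0 x1.
  apply: (@near_eq_is_derive R R R F).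
  near=> y; case: ifPn => //; rewrite -ltNge => y0.
  have y1 : - 1 < y by near: y; exact: lt_nbhsr.
  have yI : 0 <= - y < 1 by apply/andP; split; lra.
  by have := ev _ yI; rewrite opprK.
Unshelve. all: by end_near. Qed.

Lemma smooth_antiderivative A B : smooth B ->
  (forall x, is_derive x (1 : R) A (B x)) -> smooth A.
Proof.
move=> sB dA [|k].
  move=> x; apply: differentiable_continuous; apply/derivable1_diffP.
  by have [] := dA x.
move=> v; have D x : is_derive x v A (v * B x).
  exact: is_derive_chain (is_derive_id x v) (dA x).
split; first by move=> x; have [] := D x.
have -> : 'D_v A = fun x => v * B x by apply/funext => x; have [_ ->] := D x.
exact: (smoothM (smooth_cst _ v) sB).
Qed.

(** The increment over a period does not depend on the starting point, and it
   vanishes when the period is centred at 0. *)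
Lemma antiderivative_periodic A B : (forall x, is_derive x (1 : R) A (B x)) ->
  (forall x, A (- x) = A x) -> periodic1 B -> periodic1 A.
Proof.
move=> dA AN B1; apply: periodic1_step => x.
have D y : is_derive y (1 : R) (fun y => A (y + 1) - A y) 0.
  have d0 : is_derive y (1 : R) (fun y => y + 1) (1 : R).
    by apply: is_derive_eq; rewrite addr0.
  have d1 := @is_derive1_comp R A (fun y => y + 1) y _ _ (dA (y + 1)) d0.
  have := is_deriveB d1 (dA y); rewrite mulr1 (B1 (y + 1) y) ?subrr; first exact.
  by rewrite /cong1 addrC addKr rpred1.
have := is_derive_0_is_cst x (- (1 / 2)) D.
rewrite (_ : - (1 / 2) + 1 = 1 / 2); last by lra.
by rewrite (AN (1 / 2)) subrr => /eqP; rewrite subr_eq0 => /eqP.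
Qed.

(** With [B] locally constant this says that the curve is straight. *)
Lemma antiderivative_affine A B (b x y : R) : (forall x, is_derive x (1 : R) A (B x)) ->
  (forall t, Num.min x y <= t <= Num.max x y -> B t = b) -> A y - A x = b * (y - x).
Proof.
move=> dA; wlog xy : x y / x <= y => [H Bb|].
  have [xy|yx] := leP x y; first exact: H.
  rewrite -[LHS]opprB (H y x (ltW yx)); first by rewrite -mulrN opprB.
  by move=> t; rewrite minC maxC; exact: Bb.
rewrite min_l// max_r// => Bb.
have [|c] := @MVT_segment _ A B x y xy.
  by apply: derivable_within_continuous => z _; have [] := dA z.
by rewrite in_itv /= => /Bb ->.
Qed.

End Antiderivative.

Section Wave.
Variable R : realType.
Implicit Types x y : R.

Lemma sn_halfB x : sn (1 / 2 - x) = sn x.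
Proof.
rewrite /sn (_ : 2 * pi * (1 / 2 - x) = pi - 2 * pi * x); last by field.
by rewrite sinB sinpi cospi mul0r mulN1r sub0r opprK.
Qed.

Lemma sn_ge (a x : R) : 0 <= a -> a <= x <= 1 / 2 - a -> sn a <= sn x.
Proof.
move=> a0; wlog x4 : x / x <= 1 / 4 => [H|] /andP[ax xa].
  have [x4|x4] := lerP x (1 / 4); first by apply: H => //; rewrite ax.
  by rewrite -(sn_halfB x); apply: H; [lra|apply/andP; split; lra].
have p0 := pi_gt0 R.
have I y : 0 <= y <= 1 / 4 -> 2 * pi * y \in `[- (pi / 2), pi / 2].
  move=> /andP[y0 y4]; rewrite in_itv /=; apply/andP; split.
    by apply: le_trans (_ : 0 <= _); rewrite ?oppr_le0 ?divr_ge0 ?mulr_ge0// ltW.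
  rewrite (_ : 2 * pi * y = pi * (2 * y)); last by ring.
  by rewrite ler_pM2l//; lra.
rewrite /sn; case: (ltgtP a x) ax => // [ax _|-> _//].
have [Ia Ix] : 2 * pi * a \in `[- (pi / 2), pi / 2] /\ 2 * pi * x \in `[- (pi / 2), pi / 2].
  by split; apply: I; apply/andP; split; lra.
by rewrite ltW// ltr_sin// ltr_pM2l// mulr_gt0.
Qed.

Let beta : R := sn (1 / 40).

Let beta_gt0 : 0 < beta.
Proof. by apply: sn_gt0; apply/andP; split; lra. Qed.

(** A smooth square wave. *)
Definition slope x : R := 2 * step ((sn x / beta + 1) / 2) - 1.

Lemma smooth_slope : smooth slope.
Proof.
apply: smoothB; last exact: smooth_cst.
apply: smoothM; first exact: smooth_cst.
apply: (smooth_comp (@smooth_step R)).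
apply: smoothM; last exact: smooth_cst.
apply: smoothD; last exact: smooth_cst.
apply: smoothM; last exact: smooth_cst.
exact: smooth_sn.
Qed.

Lemma slope_periodic : periodic1 slope.
Proof. by move=> s t /sn_periodic st; rewrite /slope st. Qed.

Lemma slopeN x : slope (- x) = - slope x.
Proof.
rewrite /slope snN (_ : (- sn x / beta + 1) / 2 = 1 - (sn x / beta + 1) / 2); last by field; rewrite gt_eqF.
by rewrite stepC; ring.
Qed.

Lemma slope_norm x : `|slope x| <= 1.
Proof.
rewrite ler_norml /slope; have := step_ge0 ((sn x / beta + 1) / 2).
by have := step_le1 ((sn x / beta + 1) / 2); move=> *; apply/andP; split; lra.
Qed.

Lemma slope1 x : 1 / 40 <= x <= 19 / 40 -> slope x = 1.
Proof.
move=> /andP[x1 x2]; rewrite /slope step1; first by ring.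
have : 1 <= sn x / beta; last by lra.
by rewrite ler_pdivlMr// mul1r; apply: sn_ge; [lra|apply/andP; split; lra].
Qed.

Lemma slope_gt0 x : 0 < x < 1 / 2 -> 0 < slope x.
Proof.
move=> /sn_gt0 s0; rewrite /slope.
have : 1 / 2 < step ((sn x / beta + 1) / 2); last by lra.
by apply: step_gt_half; have := divr_gt0 s0 beta_gt0; lra.
Qed.

Lemma wave_exists : exists A : R -> R,
  (forall x, is_derive x (1 : R) A (slope x)) /\ forall x, A (- x) = A x.
Proof. exact: odd_antiderivative (smooth_continuous smooth_slope) slopeN. Qed.

(** A triangle wave with smoothed corners. *)
Definition wave : R -> R := projT1 (cid wave_exists).

Lemma is_derive_wave x : is_derive x (1 : R) wave (slope x).
Proof. by rewrite /wave; case: (cid wave_exists) => A /= [+ _]; exact. Qed.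

Lemma waveN x : wave (- x) = wave x.
Proof. by rewrite /wave; case: (cid wave_exists) => A /= [_]; exact. Qed.

Lemma smooth_wave : smooth wave.
Proof. exact: smooth_antiderivative smooth_slope is_derive_wave. Qed.

Lemma wave_periodic : periodic1 wave.
Proof. exact: antiderivative_periodic is_derive_wave waveN slope_periodic. Qed.

Lemma wave_inj : {in `[0, 1 / 2] &, injective wave}.
Proof.
have inc : {in `[0, 1 / 2] &, {homo wave : x y / x < y}}.
  apply: gtr0_derive1_lt_cc.
  - by move=> x _; have [] := is_derive_wave x.
  - by move=> x; rewrite in_itv /= derive1E => /slope_gt0; have [_ ->] := is_derive_wave x.
  - exact/continuous_subspaceT/smooth_continuous/smooth_wave.
move=> x y xI yI xy; case: (ltgtP x y) => // [lt|lt].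
  by have := inc _ _ xI yI lt; rewrite xy ltxx.
by have := inc _ _ yI xI lt; rewrite xy ltxx.
Qed.

Lemma wave_eq x y : wave x = wave y -> cong1 x y \/ cong1 x (- y).
Proof. exact: even_periodic_eq wave_periodic waveN wave_inj _ _. Qed.

Lemma slope_half (n : int) : exists2 b : R, b ^+ 2 = 1 & forall x, slope (x + n%:~R / 2) = b * slope x.
Proof.
have slopeD (m : int) x : slope (x + m%:~R) = slope x by apply/slope_periodic/cong1DZ.
have h x : slope (x + 1 / 2) = - slope x.
  rewrite -slopeN /slope; congr (2 * step ((_ / beta + 1) / 2) - 1).
  by rewrite -(sn_halfB (x + 1 / 2)); congr (sn _); ring.
have [[m ->]|[m ->]] : (exists m : int, n = 2 * m) \/ exists m : int, n = 2 * m + 1.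
  have [k nk] : exists k : int, n = 2 * k \/ n = 2 * k + 1.
    by exists (n %/ 2)%Z; lia.
  by case: nk => nk; [left|right]; exists k.
- exists 1; rewrite ?expr1n// => x.
  by rewrite intrM (_ : 2%:~R * m%:~R / 2 = m%:~R) ?slopeD ?mul1r//; field.
- exists (-1); rewrite ?sqrrN ?expr1n// => x.
  rewrite intrD intrM (_ : x + _ = x + 1 / 2 + m%:~R); last by field.
  by rewrite slopeD h mulN1r.
Qed.

(** [beta] is the sine at distance 1/40 from the half-integers, so that the
   transitions of the square wave take place closer than that; [d] leaves room for
   a neighbourhood. *)
Lemma slope_flat (x d : R) : 0 <= d -> (forall n : int, 1 / 20 + 2 * d <= `|2 * x - n%:~R|) ->
  exists2 b : R, b ^+ 2 = 1 & forall y, `|y - x| <= d -> slope y = b.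
Proof.
move=> d0 xn; pose n := Num.floor (2 * x).
have n1 : n%:~R <= 2 * x by exact: floor_le.
have n2 : 2 * x < n%:~R + 1 by have := floorD1_gt (2 * x); rewrite intrD.
have H1 := xn n; have H2 := xn (n + 1).
rewrite ger0_norm ?subr_ge0// in H1.
rewrite intrD ler0_norm in H2; last by lra.
have [b b2 Hb] := slope_half n; exists b => // y; rewrite ler_distl => /andP[y1 y2].
rewrite (_ : y = (y - n%:~R / 2) + n%:~R / 2); last by rewrite subrK.
by rewrite Hb slope1 ?mulr1//; apply/andP; split; lra.
Qed.

End Wave.

(** * A Lissajous curve with straight crossings *)

Section Grid.
Variable R : realType.

Lemma all_iota n (P : pred nat) : all P (iota 0 n) -> forall a, (a < n)%N -> P a.
Proof. by move=> /allP H a an; apply: H; rewrite mem_iota. Qed.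

Definition grid (a : nat) : R := a%:R / 80.

Lemma grid_cong a b : (a < 80)%N -> (b < 80)%N -> cong1 (grid a) (grid b) -> a = b.
Proof.
move=> a80 b80 ab; have : grid a = grid b.
  have i0 : 0 <= 80^-1 :> R by rewrite invr_ge0.
  apply: cong1_small ab _; rewrite /grid -mulrBl normrM (ger0_norm i0).
  rewrite ltr_pdivrMr// mul1r ltr_norml.
  have : a%:R < 80%:R :> R by rewrite ltr_nat.
  have : b%:R < 80%:R :> R by rewrite ltr_nat.
  have : 0 <= a%:R :> R by [].
  have : 0 <= b%:R :> R by [].
  by move=> *; apply/andP; split; lra.
move=> /(mulIf _) H; apply/eqP; rewrite -(eqr_nat R); apply/eqP/H.
by rewrite invr_neq0.
Qed.

(** The pairs of parameters, in 80ths, at which the curve below meets itself. *)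
Definition double_point (a b : nat) : bool :=
  [&& (a < 80)%N, (b < 80)%N &
    if odd a then (a.+1 %% 8 != 0)%N && (b == (790 - 9 * a) %% 80)%N
    else (a %% 10 != 0)%N && (b == 9 * a %% 80)%N].

Lemma double_point_fun a b b' : double_point a b -> double_point a b' -> b = b'.
Proof.
by rewrite /double_point; case: ifP => _ /and3P[_ _ /andP[_ /eqP->]] /and3P[_ _ /andP[_ /eqP->]].
Qed.

Lemma double_point_sym a b : double_point a b -> double_point b a.
Proof.
move=> ab; have /and3P[a80 b80 _] := ab; move: ab; apply/implyP.
pose P a b := double_point a b ==> double_point b a.
have H : all (fun a => all (P a) (iota 0 80)) (iota 0 80) by vm_compute.
exact: (all_iota (all_iota H a80) b80).
Qed.

Definition double_point_spec a b : bool :=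
  [&& a != b, (if odd a then (20 %| a + 80 - b) && (16 %| a + b + 2)
       else (20 %| a + b) && (16 %| a + 80 - b))%N, (a %% 10 != 0)%N & (a.+1 %% 8 != 0)%N].

Lemma double_pointP a b : double_point a b -> double_point_spec a b.
Proof.
move=> ab; have /and3P[a80 b80 _] := ab; move: ab; apply/implyP.
pose P a b := double_point a b ==> double_point_spec a b.
have H : all (fun a => all (P a) (iota 0 80)) (iota 0 80) by vm_compute.
exact: (all_iota (all_iota H a80) b80).
Qed.

(** Solutions of the two congruences for a double point, one coordinate being
   related by translation and the other by reflection. *)
Lemma odd_double_point n m : (n < 8)%N -> (m < 10)%N -> (n %% 4 != 0)%N ->
  double_point ((10 * n + 8 * m + 79) %% 80) ((159 + 8 * m - 10 * n) %% 80).
Proof.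
move=> n8 m10; apply/implyP.
pose P n m := (n %% 4 != 0)%N ==> double_point ((10 * n + 8 * m + 79) %% 80) ((159 + 8 * m - 10 * n) %% 80).
apply: (@all_iota 10 (P n)) m10.
apply: (@all_iota 8 (fun n => all (P n) (iota 0 10))) n8.
by vm_compute.
Qed.

Lemma even_double_point n m : (n < 10)%N -> (m < 8)%N -> (n %% 5 != 0)%N ->
  double_point ((10 * m + 8 * n) %% 80) ((80 + 10 * m - 8 * n) %% 80).
Proof.
move=> n10 m8; apply/implyP.
pose P n m := (n %% 5 != 0)%N ==> double_point ((10 * m + 8 * n) %% 80) ((80 + 10 * m - 8 * n) %% 80).
apply: (@all_iota 8 (P n)) m8.
apply: (@all_iota 10 (fun n => all (P n) (iota 0 8))) n10.
by vm_compute.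
Qed.

Lemma cong1_grid (x : R) (k : int) (a : nat) : 80 * x = k%:~R * 80 + a%:R ->
  cong1 x (grid (a %% 80)).
Proof.
move=> xa; apply/cong1P; exists (k + (a %/ 80)%N%:Z).
apply: (@mulfI _ 80) => //; rewrite xa {1}(divn_eq a 80) natrD natrM intrD.
by rewrite /grid -pmulrn; field.
Qed.

Lemma divz_split (d : nat) (n : int) : (0 < d)%N ->
  exists (k : int) (r : nat), (r < d)%N /\ n = k * d%:Z + r%:Z.
Proof.
move=> d0; exists (n %/ d%:Z)%Z, (absz (n %% d%:Z)%Z).
have dn0 : d%:Z != 0 by lia.
have m0 := modz_ge0 n dn0; have md : (n %% d%:Z < d%:Z)%Z by apply: ltz_pmod; lia.
by split; [lia|rewrite gez0_abs//; exact: divz_eq].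
Qed.

Lemma grid_dist (k l : int) : k != l -> 1 / 80 <= `|k%:~R / 80 - l%:~R / 80 : R|.
Proof.
move=> kl; rewrite -mulrBl normrM (ger0_norm (_ : 0 <= 80^-1)); last by rewrite invr_ge0.
rewrite ler_wpM2r ?invr_ge0// -intrB -intr_norm.
by have : 1 <= `|k - l|; [lia|rewrite -(ler_int R)].
Qed.

End Grid.

Section Curve.
Variable R : realType.
Implicit Types (s t x y : R).
Local Notation grid := (@grid R).

(** The shift by 1/16 separates the turning points of the two coordinates and
   moves all double points to multiples of 1/80. *)
Definition phase s : R := 5 * s + 1 / 16.
Definition liss s : R * R := (wave (4 * s) / 4, wave (phase s) / 5).
Definition velocity s : R * R := (slope (4 * s), slope (phase s)).

Lemma smooth_phase : smooth phase.
Proof. by apply: smoothD; [exact: smooth_scale|exact: smooth_cst]. Qed.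

Lemma smooth_liss : smooth liss.
Proof.
by apply: smooth_pair; (apply: smoothM; last exact: smooth_cst);
  apply: (smooth_comp (@smooth_wave R)); [exact: smooth_scale|exact: smooth_phase].
Qed.

Lemma smooth_velocity : smooth velocity.
Proof.
by apply: smooth_pair; apply: (smooth_comp (@smooth_slope R)); [exact: smooth_scale|exact: smooth_phase].
Qed.

Lemma cong1_mul4 s t : cong1 s t -> cong1 (4 * s) (4 * t).
Proof. by move=> /cong1P[n ->]; apply/cong1P; exists (4 * n); rewrite intrM; ring. Qed.

Lemma cong1_phase s t : cong1 s t -> cong1 (phase s) (phase t).
Proof. by move=> /cong1P[n ->]; apply/cong1P; exists (5 * n); rewrite intrM /phase; ring. Qed.

Lemma liss_periodic : periodic1 liss.
Proof.
move=> s t st; rewrite /liss; congr (_ / 4, _ / 5); apply: wave_periodic;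
  [exact: cong1_mul4|exact: cong1_phase].
Qed.

Lemma velocity_periodic : periodic1 velocity.
Proof.
move=> s t st; rewrite /velocity; congr (_, _); apply: slope_periodic;
  [exact: cong1_mul4|exact: cong1_phase].
Qed.

Lemma is_derive_liss1 s : is_derive s (1 : R) (fun s => wave (4 * s) / 4) (slope (4 * s)).
Proof.
have d0 : is_derive s (1 : R) (fun s => 4 * s) (4 : R).
  by apply: is_derive_eq; rewrite -[_ *: _]/(_ * _) mulr1.
have := is_deriveM (@is_derive1_comp R (@wave R) (fun s => 4 * s) s _ _ (is_derive_wave _) d0) (is_derive_cst (4^-1 : R) s 1).
by move/is_derive_eq; apply; rewrite /cst /comp -![_ *: _]/(_ * _); field.
Qed.

Lemma is_derive_liss2 s : is_derive s (1 : R) (fun s => wave (phase s) / 5) (slope (phase s)).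
Proof.
have d0 : is_derive s (1 : R) phase (5 : R).
  by apply: is_derive_eq; rewrite -[_ *: _]/(_ * _) addr0 mulr1.
have := is_deriveM (@is_derive1_comp R (@wave R) phase s _ _ (is_derive_wave _) d0) (is_derive_cst (5^-1 : R) s 1).
by move/is_derive_eq; apply; rewrite /cst /comp -![_ *: _]/(_ * _); field.
Qed.

Lemma is_derive_liss s : is_derive s (1 : R) liss (velocity s).
Proof. exact: is_derive_pair (is_derive_liss1 s) (is_derive_liss2 s). Qed.

Lemma derive1_liss s : derive1 liss s = velocity s.
Proof. by rewrite derive1E; have [_ ->] := is_derive_liss s. Qed.

Lemma double_point_cong a b : double_point a b ->
  (cong1 (4 * grid a) (4 * grid b) /\ cong1 (phase (grid a)) (- phase (grid b))) \/
  (cong1 (4 * grid a) (- (4 * grid b)) /\ cong1 (phase (grid a)) (phase (grid b))).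
Proof.
move=> ab; have /and3P[a80 b80 _] := ab; have /and4P[_ + _ _] := double_pointP ab.
case: ifP => _ /andP[/dvdnP[p ep] /dvdnP[q eq]]; [left|right]; split;
  rewrite /phase /cong1; apply/intrP.
- exists (p%:Z - 4); have : (a + 80)%:R = (p * 20 + b)%:R :> R by congr _%:R; lia.
  rewrite intrB -pmulrn !natrD natrM /grid; lra.
- exists (q%:Z); have : (a + b + 2)%:R = (q * 16)%:R :> R by congr _%:R; lia.
  rewrite -pmulrn !natrD natrM /grid; lra.
- exists (p%:Z); have : (a + b)%:R = (p * 20)%:R :> R by congr _%:R; lia.
  rewrite -pmulrn !natrD natrM /grid; lra.
- exists (q%:Z - 5); have : (a + 80)%:R = (q * 16 + b)%:R :> R by congr _%:R; lia.
  rewrite intrB -pmulrn !natrD natrM /grid; lra.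
Qed.

(** Both coordinates are even periodic functions of a phase.  If both phases agree
   up to the period then so do the parameters; if both are reflected, the two
   equations contradict each other modulo 2; the mixed cases give the double
   points. *)
Lemma liss_crossing s t : crossing liss s t <->
  exists a b, [/\ double_point a b, cong1 s (grid a) & cong1 t (grid b)].
Proof.
split.
  move=> [] [] /(mulIf _) H1 /(mulIf _) H2 st.
  have n4 : 4 != 0 :> R by rewrite pnatr_eq0.
  have n5 : 5 != 0 :> R by rewrite pnatr_eq0.
  have {}H1 := H1 (invr_neq0 n4); have {}H2 := H2 (invr_neq0 n5).
  have [] := wave_eq H1 => /cong1P[n sn]; have [] := wave_eq H2 => /cong1P[m sm].
  - case/negP: st; apply/cong1P; exists (m - n); move: sm; rewrite /phase intrB => sm; lra.
  - have [N [n0 [n8 nE]]] := divz_split n (isT : 0 < 8)%N.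
    have [M [m0 [m10 mE]]] := divz_split m (isT : 0 < 10)%N.
    exists ((10 * n0 + 8 * m0 + 79) %% 80)%N, ((159 + 8 * m0 - 10 * n0) %% 80)%N; split.
    + apply: odd_double_point => //; apply/negP => /eqP nn; case/negP: st.
      apply/cong1P; exists (N * 2 + (n0 %/ 4)%N%:Z).
      have : n = 4 * (N * 2 + (n0 %/ 4)%N%:Z) by lia.
      by move=> nE'; move: sn; rewrite nE' intrM; lra.
    + apply: (@cong1_grid _ _ (N + M - 1)); rewrite nE mE ?(intrD, intrM) -?pmulrn /phase in sn sm.
      rewrite ?(intrB, intrD, natrD, natrM) -?pmulrn; lra.
    + apply: (@cong1_grid _ _ (M - N - 2)); rewrite nE mE ?(intrD, intrM) -?pmulrn /phase in sn sm.
      have le : (10 * n0 <= 159 + 8 * m0)%N by lia.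
      rewrite natrB// ?(intrB, intrD, natrD, natrM) -?pmulrn; lra.
  - have [N [n0 [n8 nE]]] := divz_split m (isT : 0 < 10)%N.
    have [M [m0 [m10 mE]]] := divz_split n (isT : 0 < 8)%N.
    exists ((10 * m0 + 8 * n0) %% 80)%N, ((80 + 10 * m0 - 8 * n0) %% 80)%N; split.
    + apply: even_double_point => //; apply/negP => /eqP nn; case/negP: st.
      apply/cong1P; exists (N * 2 + (n0 %/ 5)%N%:Z).
      have : m = 5 * (N * 2 + (n0 %/ 5)%N%:Z) by lia.
      by move=> nE'; move: sm; rewrite /phase nE' intrM; lra.
    + apply: (@cong1_grid _ _ (N + M)); rewrite nE mE ?(intrD, intrM) -?pmulrn /phase in sn sm.
      rewrite ?(intrB, intrD, natrD, natrM) -?pmulrn; lra.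
    + apply: (@cong1_grid _ _ (M - N - 1)); rewrite nE mE ?(intrD, intrM) -?pmulrn /phase in sn sm.
      have le : (8 * n0 <= 80 + 10 * m0)%N by lia.
      rewrite natrB// ?(intrB, intrD, natrD, natrM) -?pmulrn; lra.
  - exfalso; have : (10 * n + 1)%:~R = (8 * m)%:~R :> R.
      by move: sn sm; rewrite /phase intrD !intrM; lra.
    by move=> /eqP; rewrite eqr_int; lia.
move=> [a [b [ab sa tb]]].
have /and3P[a80 b80 _] := ab; have /and4P[nab _ _ _] := double_pointP ab.
split; last first.
  apply/negP => st; case/negP: nab; apply/eqP/(@grid_cong R) => //.
  by apply: cong1_trans (cong1_trans st tb); rewrite cong1_sym.
rewrite (liss_periodic sa) (liss_periodic tb) /liss.
have [E1 E2] : wave (4 * grid a) = wave (4 * grid b) /\ wave (phase (grid a)) = wave (phase (grid b)).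
  by case: (double_point_cong ab) => -[/wave_periodic -> /wave_periodic ->]; rewrite ?waveN.
by rewrite E1 E2.
Qed.

Definition perp (p : R * R) : R * R := (- p.2, p.1).

(** Neither coordinate turns within 1/200 of such a parameter: twice its phase is
   at least 1/10, respectively 1/8, away from the integers. *)
Lemma straight_at a : (a %% 10 != 0)%N -> (a.+1 %% 8 != 0)%N ->
  exists b : R * R, [/\ b.1 ^+ 2 = 1, b.2 ^+ 2 = 1 &
    forall x, `|x| <= 1 / 200 -> velocity (grid a + x) = b].
Proof.
move=> a10 a8.
have N (k : nat) (l : int) (m : nat) : (0 < k)%N -> (m != l * k%:Z :> int) -> 1 / k%:R <= `|m%:R / k%:R - l%:~R : R|.
  move=> k0 ml; have k0' : 0 < k%:R :> R by rewrite ltr0n.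
  have -> : m%:R / k%:R - l%:~R = (m%:R - l%:~R * k%:R) / k%:R :> R by field; rewrite gt_eqF.
  have ik : 0 <= k%:R^-1 :> R by rewrite invr_ge0 ltW.
  rewrite normrM normfV (gtr0_norm k0') ler_wpM2r//.
  have : 1 <= `|m%:Z - l * k%:Z| by lia.
  by rewrite -(ler_int R) intr_norm intrB intrM -!pmulrn.
have e50 : 0 <= 1 / 50 :> R by lra.
have e40 : 0 <= 1 / 40 :> R by lra.
have [|b1 b12 B1] := @slope_flat R (4 * grid a) (1 / 50) e50.
  move=> n; have := @N 10 n a isT; rewrite /grid => H.
  rewrite (_ : 2 * (4 * (a%:R / 80)) = a%:R / 10%:R); last by field.
  by apply: le_trans (H _); [lra|lia].
have [|b2 b22 B2] := @slope_flat R (phase (grid a)) (1 / 40) e40.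
  move=> n; have := @N 8 n a.+1 isT; rewrite /grid => H.
  rewrite /phase (_ : 2 * (5 * (a%:R / 80) + 1 / 16) = a.+1%:R / 8%:R); last by rewrite -natr1; field.
  by apply: le_trans (H _); [lra|lia].
exists (b1, b2); split=> // x; rewrite ler_norml => /andP[x1 x2].
rewrite /velocity /phase B1 ?B2// ler_norml; apply/andP; split; rewrite /phase; lra.
Qed.

Lemma pairZ x (p q : R) : x *: (p, q) = (x * p, x * q). Proof. by []. Qed.

Lemma pairD (p q p' q' : R) : (p, q) + (p', q') = (p + p', q + q'). Proof. by []. Qed.

Lemma liss_affine s (b : R * R) (e x : R) : (forall x, `|x| <= e -> velocity (s + x) = b) ->
  `|x| <= e -> liss (s + x) = liss s + x *: b.
Proof.
move=> Hb xe; case: b Hb => b1 b2 Hb.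
have H t : Num.min s (s + x) <= t <= Num.max s (s + x) -> velocity t = (b1, b2).
  move=> ht; rewrite -(Hb (t - s)); first by rewrite addrC subrK.
  apply: le_trans xe; move: ht; rewrite ler_norml.
  have [x0|x0] := leP 0 x.
    rewrite ger0_norm// min_l ?max_r ?lerDl// => /andP[h1 h2]; apply/andP; split; lra.
  have sx : s + x <= s by rewrite gerDl ltW.
  by rewrite ltr0_norm// min_r ?max_l// => /andP[h1 h2]; apply/andP; split; lra.
have E1 := antiderivative_affine (B := fun s => slope (4 * s)) (b := b1) is_derive_liss1.
have E2 := antiderivative_affine (B := fun s => slope (phase s)) (b := b2) is_derive_liss2.
have {}E1 := E1 s (s + x) (fun t ht => congr1 fst (H t ht)).
have {}E2 := E2 s (s + x) (fun t ht => congr1 snd (H t ht)).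
rewrite [s + x]addrC addrK [x + s]addrC in E1 E2.
rewrite /liss pairZ pairD; congr (_, _); lra.
Qed.

(** No double point lies on a smoothed corner, so that a crossing consists of two
   straight diagonals.  They are perpendicular because at the second passage one
   coordinate is traversed in the same direction and the other one backwards. *)
Lemma crossing_chart s t : crossing liss s t -> exists (b : R * R) (g : R),
  [/\ b.1 ^+ 2 = 1, b.2 ^+ 2 = 1, g ^+ 2 = 1 & forall x, `|x| <= 1 / 200 ->
    [/\ velocity (s + x) = b, liss (s + x) = liss s + x *: b,
        velocity (t + x) = g *: perp b & liss (t + x) = liss s + x *: (g *: perp b)]].
Proof.
move=> st; have [a [b [ab sa tb]]] := (liss_crossing s t).1 st.
have /and4P[_ _ a10 a8] := double_pointP ab.
have /and4P[_ _ b10 b8] := double_pointP (double_point_sym ab).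
have [[b1 b2] /= [b12 b22 Va]] := straight_at a10 a8.
have [[d1 d2] /= [_ _ Vb]] := straight_at b10 b8.
have x0 : `|0 : R| <= 1 / 200 by rewrite normr0; lra.
have shift u c x : cong1 u c -> velocity (u + x) = velocity (c + x).
  by move=> uc; apply: velocity_periodic; rewrite /cong1 (_ : u + x - (c + x) = u - c)//; ring.
have Vs x : `|x| <= 1 / 200 -> velocity (s + x) = (b1, b2) by move=> /Va <-; exact: shift.
have Vt x : `|x| <= 1 / 200 -> velocity (t + x) = (d1, d2) by move=> /Vb <-; exact: shift.
have Va0 := Va 0 x0; have Vb0 := Vb 0 x0; rewrite !addr0 in Va0 Vb0.
case: Va0 => h3 h4; case: Vb0 => h1 h2.
have [g g2 Hg] : exists2 g, g ^+ 2 = 1 & (d1, d2) = g *: perp (b1, b2).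
  case: (double_point_cong ab) => -[/slope_periodic e1 /slope_periodic e2]; move: e1 e2;
    rewrite ?slopeN h1 h2 h3 h4 => e1 e2.
  - exists (- (b1 * b2)); first by rewrite sqrrN exprMn b12 b22 mulr1.
    rewrite /perp pairZ /= mulrNN -mulrA -expr2 b22 mulr1 e1; congr (_, _).
    by rewrite mulNr mulrAC -expr2 -e1 b12 mul1r e2 opprK.
  - exists (b1 * b2); first by rewrite exprMn b12 b22 mulr1.
    have A1 : b1 * b2 * - b2 = - b1 by rewrite -[RHS]mulr1 -b22; ring.
    have A2 : b1 * b2 * b1 = b2 by rewrite -[RHS]mulr1 -b12; ring.
    by rewrite /perp pairZ /= A1 A2 e1 opprK e2.
exists (b1, b2), g; split=> // x xe; split; [exact: Vs|exact: liss_affine Vs xe|by rewrite (Vt x xe)|].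
by rewrite (liss_affine Vt xe) -st.1 Hg.
Qed.

Lemma crossing_grid s t : crossing liss s t -> exists k : int, s = k%:~R / 80.
Proof.
move=> /liss_crossing[a [b [_ /cong1P[n ->] _]]]; exists (a%:Z + n * 80).
by rewrite intrD intrM -pmulrn /grid; field.
Qed.

(** The first coordinate turns at [n / 8] and the second one at [(8 m - 1) / 80]; as
   [10 n + 1] is odd, these differ by at least 1/80. *)
Lemma velocity_straight s :
  (exists2 b : R, b ^+ 2 = 1 & forall t, `|t - s| <= 1 / 2000 -> slope (4 * t) = b) \/
  (exists2 b : R, b ^+ 2 = 1 & forall t, `|t - s| <= 1 / 2000 -> slope (phase t) = b).
Proof.
have e1 : 0 <= 4 / 2000 :> R by lra.
have e2 : 0 <= 5 / 2000 :> R by lra.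
have scale (k x y : R) : 0 <= k -> `|x - y| <= 1 / 2000 -> `|k * x - k * y| <= k / 2000.
  by move=> k0 xy; rewrite -mulrBr normrM (ger0_norm k0) -[leRHS]mul1r mulrCA ler_wpM2l.
have odd_far (n m : int) : 1 <= `|10 * n + 1 - 8 * m| by lia.
have apart (n m x : R) : `|2 * (4 * x) - n| < 1 / 20 + 2 * (4 / 2000) ->
    `|2 * (5 * x + 1 / 16) - m| < 1 / 20 + 2 * (5 / 2000) -> `|10 * n + 1 - 8 * m| < 1.
  rewrite !ltr_norml => /andP[n1 n2] /andP[m1 m2]; apply/andP.
  by split; clear - n1 n2 m1 m2; lra.
have [[n Hn]|H] := pselect (exists n : int, `|2 * (4 * s) - n%:~R| < 1 / 20 + 2 * (4 / 2000)).
  right; have [|b b2 Hb] := @slope_flat R (phase s) (5 / 2000) e2.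
    move=> m; rewrite leNgt; apply/negP => /(apart _ _ _ Hn).
    have := odd_far n m; rewrite -(ler_int R) intr_norm intrB intrD !intrM => h.
    by rewrite ltNge h.
  exists b => // t ts; apply: Hb.
  by rewrite /phase opprD addrACA subrr addr0; apply: scale.
left; have [|b b2 Hb] := @slope_flat R (4 * s) (4 / 2000) e1.
  by move=> n; rewrite leNgt; apply/negP => Hn; apply: H; exists n.
by exists b => // t ts; apply: Hb; apply: scale.
Qed.

Lemma velocity_normsq s : 1 <= normsq (velocity s).
Proof.
have s0 : `|s - s| <= 1 / 2000 by rewrite subrr normr0; lra.
case: (velocity_straight s) => -[b b2 Hb]; rewrite /normsq /= (Hb s s0) b2.
  by rewrite lerDl sqr_ge0.
by rewrite lerDr sqr_ge0.
Qed.

Lemma velocity_neq0 s : velocity s != 0.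
Proof.
apply/eqP => v0; have := velocity_normsq s; rewrite v0 /normsq /= expr0n /= addr0.
by rewrite ler10.
Qed.

End Curve.

(** * The diagram and its mirror image *)

Section SmoothLinear.
Variables (R : realType) (V W U : normedModType R).

Lemma is_derive_linear (L : W -> U) (f : V -> W) x v df : linear L -> continuous L ->
  is_derive x v f df -> is_derive x v (L \o f) (L df).
Proof.
move=> linL cL [f1 f2].
have LE : forall h : R, h^-1 *: ((L \o f) (h *: v + x) - (L \o f) x) =
    L (h^-1 *: (f (h *: v + x) - f x)).
  move=> h; have L0 : L 0 = 0 by have := linL (-1) 0 0; rewrite scaler0 add0r scaleN1r addNr.
  have LZ a w : L (a *: w) = a *: L w by rewrite -[a *: w]addr0 linL L0 addr0.
  have LB a b : L (a - b) = L a - L b by rewrite [a - b]addrC -scaleN1r linL scaleN1r addrC.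
  by rewrite LZ LB.
have H : (fun h : R => h^-1 *: ((L \o f) (h *: v + x) - (L \o f) x)) @ 0^' --> L df.
  under eq_fun do rewrite LE.
  have H1 : (fun h : R => h^-1 *: (f (h *: v + x) - f x)) @ 0^' --> df by rewrite -f2; exact: f1.
  exact: (cvg_comp _ _ H1 (cL df)).
split; first by apply/cvg_ex; exists (L df).
exact: cvg_lim H.
Qed.

Lemma smooth_linear_comp (L : W -> U) (f : V -> W) : linear L -> continuous L ->
  smooth f -> smooth (L \o f).
Proof.
move=> linL cL sf.
apply: (@smooth_coind _ _ _ (fun g => exists2 f : V -> W, smooth f & g = L \o f)); last by exists f.
move=> {f sf} _ [f sf ->]; split.
  by move=> x; apply: continuous_comp; [exact: (smooth_continuous sf)|exact: cL].
move=> v; have D x : is_derive x v (L \o f) (L ('D_v f x)).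
  by apply: is_derive_linear => //; split; [exact: smooth_derivable|].
split; first by move=> x; have [] := D x.
exists ('D_v f); first exact: smooth_derive.
by apply/funext => x; have [_ ->] := D x.
Qed.

End SmoothLinear.

Section SmoothProjections.
Variables (R : realType) (V W1 W2 : normedModType R).

Lemma smooth_comp_fst (f : V -> W1 * W2) : smooth f -> smooth (fun x => (f x).1).
Proof.
move=> sf; apply: (smooth_linear_comp (L := fst)) => //.
by move=> x; exact: cvg_fst.
Qed.

Lemma smooth_comp_snd (f : V -> W1 * W2) : smooth f -> smooth (fun x => (f x).2).
Proof.
move=> sf; apply: (smooth_linear_comp (L := snd)) => //.
by move=> x; exact: cvg_snd.
Qed.

Lemma smooth_comp_coord n (f : V -> 'rV[R]_n) i : smooth f -> smooth (fun x => f x ord0 i).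
Proof.
move=> sf; apply: (smooth_linear_comp (L := fun u : 'rV[R]_n => u ord0 i)) => //.
  by move=> a u v; rewrite !mxE.
exact: smooth_continuous (@smooth_coord R n i).
Qed.

End SmoothProjections.

Section Diagram.
Variable R : realType.
Local Notation grid := (@grid R).

(** In the order of the strand, crossing [i] has the parameters [over_at i] and
   [under_at i], in 80ths; all other double points are welded.  The choice is one
   for which [chiral_longitude] holds. *)
Definition under_params := [:: 2; 17; 24; 25; 37; 48; 59; 64; 66]%N.
Definition over_params := [:: 18; 77; 56; 5; 57; 32; 19; 16; 34]%N.
Definition under_at i := nth 0%N under_params i.
Definition over_at i := nth 0%N over_params i.

Definition liss_over (s t : R) : Prop :=
  exists i, [/\ (i < 9)%N, cong1 s (grid (over_at i)) & cong1 t (grid (under_at i))].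

Lemma double_point_at i : (i < 9)%N -> double_point (over_at i) (under_at i).
Proof. by move: i; apply: (@all_iota 9 (fun i => double_point (over_at i) (under_at i))). Qed.

Lemma over_not_under i j : (i < 9)%N -> (j < 9)%N -> over_at i != under_at j.
Proof.
move=> i9 j9; have := @all_iota 9 (fun i => all (fun j => over_at i != under_at j) (iota 0 9)) isT i i9.
by move/all_iota; apply.
Qed.

Lemma under_at_inj i j : (i < 9)%N -> (j < 9)%N -> under_at i = under_at j -> i = j.
Proof.
move=> i9 j9 /eqP ij; apply/eqP; move: ij; apply/implyP.
have := @all_iota 9 (fun i => all (fun j => (under_at i == under_at j) ==> (i == j)) (iota 0 9)) isT i i9.
by move/all_iota; apply.
Qed.

Lemma liss_over_crossing s t : liss_over s t -> crossing (@liss R) s t.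
Proof.
move=> [i [i9 so tu]]; apply/liss_crossing; exists (over_at i), (under_at i); split=> //.
exact: double_point_at.
Qed.

Lemma liss_over_asym s t : liss_over s t -> ~ liss_over t s.
Proof.
move=> [i [i9 so tu]] [j [j9 to su]].
have /and3P[ o80 _ _] := double_point_at i9; have /and3P[_ u80 _] := double_point_at j9.
have /eqP := over_not_under i9 j9; apply; apply: (@grid_cong R) => //.
by apply: cong1_trans su; rewrite cong1_sym.
Qed.

Lemma liss_transverse s t : crossing (@liss R) s t ->
  det2 (derive1 (@liss R) s) (derive1 (@liss R) t) != 0.
Proof.
move=> /crossing_chart[b [g [b1 b2 g1 /(_ 0)]]]; rewrite normr0 !addr0 => -[|vs _ vt _]; first by lra.
rewrite !derive1_liss vs vt /det2 /perp; case: b b1 b2 {vs vt} => b1 b2 /= b12 b22.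
rewrite -![_ *: _]/(_ * _) (_ : _ - _ = g * (b1 ^+ 2 + b2 ^+ 2)); last by ring.
rewrite b12 b22 mulf_neq0//.
by apply/eqP => g0; move: g1; rewrite g0 expr0n /=; lra.
Qed.

Lemma liss_no_triple s t u : crossing (@liss R) s t -> crossing (@liss R) s u -> cong1 t u.
Proof.
move=> /liss_crossing[a [b [ab sa tb]]] /liss_crossing[a' [b' [ab' sa' ub']]].
have /and3P[a80 _ _] := ab; have /and3P[a80' _ _] := ab'.
have aa : a = a' by apply: (@grid_cong R) => //; apply: cong1_trans sa'; rewrite cong1_sym.
rewrite -aa in ab'; have bb := double_point_fun ab ab'.
by apply: cong1_trans tb _; rewrite bb cong1_sym.
Qed.

Lemma liss_over_periodic s s' t t' : cong1 s s' -> cong1 t t' -> liss_over s t -> liss_over s' t'.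
Proof.
move=> ss tt [i [i9 so tu]]; exists i; split=> //.
  by apply: cong1_trans so; rewrite cong1_sym.
by apply: cong1_trans tu; rewrite cong1_sym.
Qed.

Lemma liss_immersive s : derive1 (@liss R) s != 0.
Proof. by rewrite derive1_liss velocity_neq0. Qed.

Definition chiral_diagram : welded_diagram R :=
  WeldedDiagram (@smooth_liss R) (@liss_periodic R) liss_immersive liss_transverse
    liss_no_triple liss_over_crossing liss_over_asym liss_over_periodic.

End Diagram.

Section Mirror.
Variable R : realType.
Variable D : welded_diagram R.
Implicit Types s t u : R.

Definition mirror_curve s : R * R := ((D (- s)).1, - (D (- s)).2).

Lemma is_derive_curve s : is_derive s (1 : R) D (derive1 D s).
Proof.
split; last by rewrite derive1E.
exact: smooth_derivable (@curve_smooth _ D) s 1.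
Qed.

Lemma smooth_reverse (V : normedModType R) (f : R -> V) : smooth f -> smooth (fun s => f (- s)).
Proof.
move=> sf.
apply: (@smooth_coind _ _ _ (fun g => exists2 f : R -> V, smooth f & g = fun s => f (- s))); last by exists f.
move=> {f sf} _ [f sf ->]; split.
  by move=> x; apply: continuous_comp; [exact: opp_continuous|exact: (smooth_continuous sf)].
move=> v; have Df x : is_derive (- x) (1 : R) f ('D_1 f (- x)).
  by split; [exact: smooth_derivable|].
have D' x : is_derive x v (fun s => f (- s)) ((- v) *: 'D_1 f (- x)).
  exact: is_derive_chain (is_deriveN (is_derive_id x v)) (Df x).
split; first by move=> x; have [] := D' x.
exists ('D_(- v) f); first exact: smooth_derive.
apply/funext => x; have [_ ->] := D' x.
have [_] := is_derive_chain (is_derive_id (- x) (- v)) (Df x).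
by move=> <-.
Qed.

Lemma smooth_mirror : smooth mirror_curve.
Proof.
have sD := smooth_reverse (@curve_smooth _ D).
by apply: smooth_pair; [exact: smooth_comp_fst sD|apply: smoothN; exact: smooth_comp_snd sD].
Qed.

Lemma mirror_periodic : periodic1 mirror_curve.
Proof.
move=> s t st; rewrite /mirror_curve (@curve_periodic _ D (- s) (- t))//.
by rewrite cong1N.
Qed.

Lemma derive1_mirror s : derive1 mirror_curve s = (- (derive1 D (- s)).1, (derive1 D (- s)).2).
Proof.
have d1 := is_derive_chain (is_deriveN (is_derive_id s (1 : R))) (is_derive_curve (- s)).
have d2 := is_derive_linear (L := fun p : R * R => (p.1, - p.2)) _ _ d1.
rewrite derive1E; have [||_ ->] := d2.
- move=> a [p q] [p' q']; apply: f_equal2 => //=.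
  by rewrite opprD -mulrN.
- apply: smooth_continuous; apply: smooth_pair; first exact: smooth_fst.
  exact/smoothN/smooth_snd.
by rewrite /= !scaleN1r /= opprK.
Qed.

Lemma mirror_crossing s t : crossing mirror_curve s t <-> crossing D (- s) (- t).
Proof.
rewrite /crossing cong1N; split=> -[e st]; split=> //; last by rewrite /mirror_curve e.
by case: e => e1 /oppr_inj e2; rewrite [LHS]surjective_pairing [RHS]surjective_pairing e1 e2.
Qed.

Lemma mirror_immersive s : derive1 mirror_curve s != 0.
Proof.
rewrite derive1_mirror; apply/eqP => -[/eqP]; rewrite oppr_eq0 => /eqP e1 e2.
have /eqP := @curve_immersive _ D (- s); apply.
by rewrite [LHS]surjective_pairing e1 e2.
Qed.

Lemma mirror_transverse s t : crossing mirror_curve s t ->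
  det2 (derive1 mirror_curve s) (derive1 mirror_curve t) != 0.
Proof.
move=> /mirror_crossing /(@curve_transverse _ D); rewrite !derive1_mirror /det2.
move: (derive1 D (- s)) (derive1 D (- t)) => [a b] [c d] /=; apply: contraNneq => e.
by apply/eqP; lra.
Qed.

Lemma mirror_no_triple s t u :
  crossing mirror_curve s t -> crossing mirror_curve s u -> cong1 t u.
Proof.
by move=> /mirror_crossing st /mirror_crossing su; have := curve_no_triple st su; rewrite cong1N.
Qed.

Definition mirror_over s t := over D (- s) (- t).

Lemma mirror_over_crossing s t : mirror_over s t -> crossing mirror_curve s t.
Proof. by move=> /over_crossing/mirror_crossing. Qed.

Lemma mirror_over_asym s t : mirror_over s t -> ~ mirror_over t s.
Proof. exact: over_asym. Qed.

Lemma mirror_over_periodic s s' t t' :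
  cong1 s s' -> cong1 t t' -> mirror_over s t -> mirror_over s' t'.
Proof. by move=> ss tt; apply: over_periodic; rewrite cong1N. Qed.

(** The reflection alone would exchange the left and right sides of the
   over-strands; running the curve backwards restores them. *)
Definition mirror_diagram : welded_diagram R :=
  WeldedDiagram smooth_mirror mirror_periodic mirror_immersive mirror_transverse
    mirror_no_triple mirror_over_crossing mirror_over_asym mirror_over_periodic.

End Mirror.

(** * The diagram is not equivalent to its mirror image *)

Section Longitude.
Variables (R : realType) (gT : finGroupType) (rho L : gT).
Hypotheses (rho2 : mulg rho rho = 1%g) (rhoL : commute rho L).
Local Notation grid := (@grid R).
Local Notation "x ** y" := (mulg x y) (at level 40, left associativity).
Local Notation "x ^^ y" := (conjg x y) (at level 30, right associativity).
Local Notation D := (chiral_diagram R).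
Implicit Types (s t u x : R) (mu : R -> gT).

Definition discrete_developing (g : nat -> gT) : Prop :=
  (forall i, (i < 9)%N -> g i.+1 = rho ** g i ** rho ^^ g (over_arc_of i)) /\ g 9%N = L ** g 0%N.

(** Arc 9 is arc 0 one period later, and so it ends at 82. *)
Definition arc_end i := nth 0%N (rcons under_params 82%N) i.

Lemma arc_end_under i : (i < 9)%N -> arc_end i = under_at i.
Proof. by move=> i9; rewrite /arc_end nth_rcons i9. Qed.

Definition no_under (a b : nat) : bool :=
  all (fun k => (k %% 80)%N \notin under_params) (iota a.+1 (b - a.+1)).

Lemma grid_lt (a b : nat) : (grid a < grid b) = (a < b)%N.
Proof. by rewrite /grid ltr_pM2r ?invr_gt0// ltr_nat. Qed.

Lemma grid_le (a b : nat) : (grid a <= grid b) = (a <= b)%N.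
Proof. by rewrite /grid ler_pM2r ?invr_gt0// ler_nat. Qed.

Lemma grid80 (a : nat) : grid (a + 80) = grid a + 1.
Proof. by rewrite /grid natrD; field. Qed.

Lemma no_underP a b u : no_under a b -> grid a < u < grid b -> forall o, ~ over D o u.
Proof.
move=> /allP H /andP[au ub] o [i [i9 _ /cong1P[n un]]].
have [k uk] : exists k : int, u = k%:~R / 80.
  by exists ((under_at i)%:Z + n * 80); rewrite un intrD intrM -pmulrn /grid; lra.
have k1 : (a%:Z < k)%R.
  by rewrite -(ltr_int R) -pmulrn; move: au; rewrite uk /grid ltr_pM2r ?invr_gt0.
have k2 : (k < b%:Z)%R.
  by rewrite -(ltr_int R) -pmulrn; move: ub; rewrite uk /grid ltr_pM2r ?invr_gt0.
have kE : k = (under_at i)%:Z + n * 80.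
  apply/eqP; rewrite -(eqr_int R) intrD intrM -pmulrn; apply/eqP.
  by move: un; rewrite uk /grid; lra.
have u80 : (under_at i < 80)%N by have /and3P[] := double_point_at i9.
have := H (absz k); rewrite mem_iota => /(_ ltac:(lia)) /negP; apply.
have -> : (absz k %% 80)%N = under_at i by lia.
exact: mem_nth.
Qed.

Lemma developing_constant mu x y : developing rho L D mu -> x <= y ->
  (forall u, x <= u < y -> forall o, ~ over D o u) -> mu y = mu x.
Proof.
move=> [mul _ mur _] xy H; apply: locally_constant => // u uI; exact/mur/H.
Qed.

Lemma conj_longitude g : rho ^^ (L ** g) = rho ^^ g.
Proof. by rewrite conjgM (_ : rho ^^ L = rho)//; apply/conjg_fixP/commgP. Qed.

(** A developing map is constant on each arc, so that its values at the ends of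
   the arcs carry the same information. *)
Lemma developing_discrete mu : developing rho L D mu ->
  discrete_developing (fun i => mu (grid (arc_end i))).
Proof.
move=> dev; have [_ jump _ muL] := dev.
have e9 : mu (grid (arc_end 9)) = L ** mu (grid (arc_end 0)).
  by rewrite -muL; congr mu; exact: grid80 2.
split=> // i i9.
have ov : over D (grid (over_at i)) (grid (under_at i)).
  by exists i; split=> //; exact: cong1_refl.
have arc : no_under (arc_end i) (arc_end i.+1) && (arc_end i < arc_end i.+1)%N.
  exact: (@all_iota 9 (fun i => no_under (arc_end i) (arc_end i.+1) && (arc_end i < arc_end i.+1)%N)) i9.
have {arc} [/no_underP arc lt] := andP arc.
have overE : rho ^^ mu (grid (over_at i)) = rho ^^ mu (grid (arc_end (over_arc_of i))).
  have : [|| (over_at i == 77%N) && (over_arc_of i == 0%N) |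
      no_under (over_at i).-1 (arc_end (over_arc_of i)) && (0 < over_at i <= arc_end (over_arc_of i))%N].
    exact: (@all_iota 9 (fun i => [|| (over_at i == 77%N) && (over_arc_of i == 0%N) |
      no_under (over_at i).-1 (arc_end (over_arc_of i)) && (0 < over_at i <= arc_end (over_arc_of i))%N])) i9.
  (* 77 is beyond the last under-crossing, on arc 0 of the next period *)
  case/orP => [/andP[/eqP -> /eqP ->]|/andP[/no_underP nu /andP[ o0 oa]]].
    have nu : no_under 76 82 by [].
    rewrite -[in RHS]conj_longitude -e9; congr (_ ^^ _); apply/esym/(developing_constant dev).
      by rewrite grid_le.
    move=> u /andP[u1 u2]; apply: (no_underP nu); rewrite u2 andbT.
    by apply: lt_le_trans u1; rewrite grid_lt.
  congr (_ ^^ _); apply/esym/(developing_constant dev); first by rewrite grid_le.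
  move=> u /andP[u1 u2]; apply: nu; rewrite u2 andbT.
  by apply: lt_le_trans u1; rewrite grid_lt prednK.
have /near_rightP[d d0 dP] := jump _ _ ov.
have lt' : grid (arc_end i) < grid (arc_end i.+1) by rewrite grid_lt.
pose x := Num.min (grid (arc_end i) + d / 2) (grid (arc_end i.+1)).
have xr : x <= grid (arc_end i.+1) by rewrite ge_min lexx orbT.
have xl : grid (arc_end i) < x by rewrite lt_min lt' andbT ltrDl; lra.
have xd : x < grid (arc_end i) + d.
  by apply: le_lt_trans (_ : x <= grid (arc_end i) + d / 2) _; [rewrite ge_min lexx|lra].
rewrite (developing_constant dev xr); last first.
  by move=> u /andP[u1 u2]; apply: arc; rewrite u2 (lt_le_trans xl u1).
rewrite arc_end_under// in xl xd *.
by rewrite dP ?xl ?xd// overE.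
Qed.

Section Step.
Variable g : nat -> gT.
Hypothesis dg : discrete_developing g.

(** Integer powers, reduced modulo the order to natural ones. *)
Definition longitude_power (n : int) : gT := (L ^+ absz (modz n (fingroup.order L)))%g.

Lemma longitude_powerD1 (n : int) : longitude_power (n + 1) = L ** longitude_power n.
Proof.
have o0 : (0 < fingroup.order L)%N by exact: order_gt0.
rewrite /longitude_power -expgS -[in RHS]expg_mod_order; congr (L ^+ _)%g.
have r0 : (n %% fingroup.order L)%Z = absz (n %% fingroup.order L)%Z.
  by rewrite gez0_abs// modz_ge0; lia.
by rewrite -modzDml r0 -[1]/(1%:Z) -PoszD modz_nat absz_nat addn1 -r0.
Qed.

Lemma commute_power n : commute rho (longitude_power n).
Proof. exact: commuteX. Qed.

(** For [x] within the period, the arc on which [x] lies; an under-crossing belongs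
   to the arc that ends there. *)
Definition arc_index x := count (fun a => grid a < x) under_params.

(** The period containing [x], periods being cut just after the last
   under-crossing. *)
Definition wrap x : int := Num.ceil (x - grid 66).

(** The step function that takes the given values on the arcs, extended by the
   monodromy. *)
Definition step_map s : gT := longitude_power (wrap s) ** g (arc_index (s - (wrap s)%:~R)).

Lemma wrapE x (n : int) : grid 66 - 1 < x <= grid 66 -> wrap (x + n%:~R) = n.
Proof.
move=> /andP[x1 x2]; rewrite /wrap; apply/eqP.
apply/eqP/Num.Theory.ceil_def; apply/andP; split; rewrite ?intrB; lra.
Qed.

Lemma arc_index_small x : x <= grid 2 -> arc_index x = 0%N.
Proof.
move=> x2; apply/eqP; rewrite -leqn0 leqNgt -has_count; apply/hasPn => a aU.
rewrite -leNgt; apply: le_trans x2 _; rewrite grid_le.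
by move: a aU; apply/allP.
Qed.

Lemma arc_index_large x : grid 66 < x -> arc_index x = 9%N.
Proof.
move=> x66; apply/eqP; rewrite -[9%N]/(size under_params) -all_count; apply/allP => a aU.
apply: le_lt_trans x66; rewrite grid_le.
by move: a aU; apply/allP.
Qed.

(** The formula remains valid beyond the cut up to the first under-crossing of the
   next period, since arc 9 is arc 0 displaced by the monodromy. *)
Lemma step_mapE x (n : int) : grid 66 - 1 < x <= grid 82 ->
  step_map (x + n%:~R) = longitude_power n ** g (arc_index x).
Proof.
move=> /andP[x1 x2]; have [x66|x66] := leP x (grid 66).
  by rewrite /step_map wrapE ?x1// addrK.
have xw : grid 66 - 1 < x - 1 <= grid 66.
  by apply/andP; split; [lra|move: x2; rewrite (grid80 2) /grid; lra].
rewrite (_ : x + n%:~R = x - 1 + (n + 1)%:~R); last by rewrite intrD; ring.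
rewrite /step_map (wrapE _ xw) addrK (arc_index_large x66) longitude_powerD1.
rewrite arc_index_small; last by move: x2; rewrite (grid80 2); lra.
have c : commute L (longitude_power n) by exact: commuteX.
by rewrite dg.2 mulgA c.
Qed.

Lemma over_arc_index i : (i < 9)%N -> exists2 n : int,
  grid 66 - 1 < grid (over_at i) <= grid 82 &
  rho ^^ g (arc_index (grid (over_at i))) = rho ^^ g (over_arc_of i).
Proof.
move=> i9; exists 0.
  rewrite grid_le; apply/andP; split.
    by apply: lt_le_trans (_ : 0 <= _); [rewrite /grid; lra|rewrite /grid divr_ge0].
  by move: i i9; apply: (@all_iota 9 (fun i => over_at i <= 82)%N).
have -> : arc_index (grid (over_at i)) = count (fun a => a < over_at i)%N under_params.
  by apply: eq_count => a; rewrite grid_lt.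
have : (count (fun a => a < over_at i)%N under_params == over_arc_of i) ||
   (count (fun a => a < over_at i)%N under_params == 9%N) && (over_arc_of i == 0%N).
  exact: (@all_iota 9 (fun i => (count (fun a => a < over_at i)%N under_params == over_arc_of i) ||
   (count (fun a => a < over_at i)%N under_params == 9%N) && (over_arc_of i == 0%N))) i9.
by case/orP => [/eqP->//|/andP[/eqP-> /eqP->]]; rewrite dg.2 conj_longitude.
Qed.

Lemma arc_index_left x : \forall y \near x^'-, arc_index y = arc_index x.
Proof.
rewrite /arc_index; elim: under_params => [|a s IH] /=; first by apply: filterE.
have [ax|xa] := ltP (grid a) x; near=> y; (congr (_ + _)%N; last by near: y); congr (nat_of_bool _).
  have ay : grid a < y by near: y; exact: nbhs_left_gt.
  by rewrite ay.
have yx : y <= x by near: y; exact: nbhs_left_le.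
by rewrite ltNge (le_trans yx xa).
Unshelve. all: by end_near. Qed.

Lemma arc_index_right x :
  \forall y \near x^'+, arc_index y = count (fun a => grid a <= x) under_params.
Proof.
rewrite /arc_index; elim: under_params => [|a s IH] /=; first by apply: filterE.
have [ax|xa] := leP (grid a) x; near=> y; (congr (_ + _)%N; last by near: y); congr (nat_of_bool _).
  have xy : x < y by near: y; exact: nbhs_right_gt.
  by rewrite (le_lt_trans ax xy).
have ya : y <= grid a by near: y; exact: nbhs_right_le.
by rewrite ltNge ya.
Unshelve. all: by end_near. Qed.

Lemma reduce u : exists (x : R) (n : int), u = x + n%:~R /\ grid 66 - 1 < x <= grid 66.
Proof.
exists (u - (wrap u)%:~R), (wrap u); split; first by rewrite subrK.
have h1 := ceil_ge (u - grid 66); have h2 := ceilB1_lt (u - grid 66).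
rewrite -/(wrap u) in h1 h2; rewrite intrB in h2.
by apply/andP; split; lra.
Qed.

Lemma near_right_reduce x (n : int) (P : R -> Prop) :
  (\forall y \near x^'+, P (y + n%:~R)) -> \forall s \near (x + n%:~R)^'+, P s.
Proof. by move=> /(near_right_shift n%:~R); apply: filterS => s; rewrite subrK. Qed.

Lemma near_left_reduce x (n : int) (P : R -> Prop) :
  (\forall y \near x^'-, P (y + n%:~R)) -> \forall s \near (x + n%:~R)^'-, P s.
Proof. by move=> /(near_left_shift n%:~R); apply: filterS => s; rewrite subrK. Qed.

Lemma conj_power n m : rho ^^ (longitude_power n ** m) = rho ^^ m.
Proof.
by rewrite conjgM (_ : rho ^^ longitude_power n = rho)//; apply/conjg_fixP/commgP/commute_power.
Qed.

Lemma grid_66_82 : grid 66 < grid 82. Proof. by rewrite grid_lt. Qed.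

Lemma discrete_step : developing rho L D step_map.
Proof.
split.
- move=> u; have [x [n [-> /andP[x1 x2]]]] := reduce u; apply: near_left_reduce.
  near=> y.
  have yx : y <= x by near: y; exact: nbhs_left_le.
  have y1 : grid 66 - 1 < y by near: y; exact: nbhs_left_gt.
  have h82 := grid_66_82.
  rewrite !step_mapE; last 2 first.
    by rewrite y1; apply: le_trans yx (le_trans x2 (ltW h82)).
    by rewrite x1; apply: le_trans x2 (ltW h82).
  congr (_ ** g _); near: y; exact: arc_index_left.
- move=> o u [i [i9 /cong1P[m ->] /cong1P[n ->]]].
  have [_ oI oE] := over_arc_index i9.
  rewrite (step_mapE _ oI) conj_power oE.
  have uI : grid 66 - 1 < grid (under_at i) <= grid 66.
    have /andP[h1 h2] := (@all_iota 9 (fun i => 0 < under_at i <= 66)%N isT i i9).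
    rewrite grid_le h2 andbT; apply: lt_trans (_ : 0 < _); first by rewrite /grid; lra.
    by rewrite divr_gt0 ?ltr0n.
  have h82 := grid_66_82; have /andP[u1 u2] := uI.
  rewrite step_mapE; last by rewrite u1; apply: le_trans u2 (ltW h82).
  apply: near_right_reduce; near=> y.
  have yu : grid (under_at i) < y by near: y; exact: nbhs_right_gt.
  have y2 : y <= grid 82 by near: y; apply: nbhs_right_le; apply: le_lt_trans u2 h82.
  rewrite step_mapE ?(lt_trans u1 yu)//.
  have -> : arc_index y = i.+1.
    have -> : arc_index y = count (fun a => grid a <= grid (under_at i)) under_params.
      by near: y; exact: arc_index_right.
    rewrite (eq_count (a2 := fun a => a <= under_at i)%N); last by move=> a; rewrite grid_le.
    apply/eqP; exact: (@all_iota 9 (fun i => count (fun a => a <= under_at i)%N under_params == i.+1)) i9.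
  have -> : arc_index (grid (under_at i)) = i.
    rewrite /arc_index (eq_count (a2 := fun a => a < under_at i)%N); last by move=> a; rewrite grid_lt.
    apply/eqP; exact: (@all_iota 9 (fun i => count (fun a => a < under_at i)%N under_params == i)) i9.
  by rewrite dg.1// !mulgA (commute_power n).
- move=> u nou; have [x [n [ux /andP[x1 x2]]]] := reduce u.
  have h82 := grid_66_82; rewrite ux; apply: near_right_reduce.
  rewrite step_mapE; last by rewrite x1; apply: le_trans x2 (ltW h82).
  near=> y.
  have yx : x < y by near: y; exact: nbhs_right_gt.
  have y2 : y <= grid 82 by near: y; apply: nbhs_right_le; apply: le_lt_trans x2 h82.
  rewrite step_mapE ?(lt_trans x1 yx)//; congr (_ ** g _).
  have -> : arc_index y = count (fun a => grid a <= x) under_params.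
    by near: y; exact: arc_index_right.
  apply: eq_in_count => a aU; rewrite le_eqVlt; case: eqP => //= ax.
  case: (nou (grid (over_at (index a under_params)))).
  exists (index a under_params); split; rewrite ?cong1_refl//.
    by rewrite -[9%N]/(size under_params) index_mem.
  by rewrite /under_at nth_index// ux -ax; exact: cong1DZ.
- move=> u; have [x [n [-> /andP[x1 x2]]]] := reduce u.
  have xI : grid 66 - 1 < x <= grid 82 by rewrite x1; apply: le_trans x2 (ltW grid_66_82).
  rewrite (_ : x + n%:~R + 1 = x + (n + 1)%:~R); last by rewrite intrD addrA.
  by rewrite !step_mapE// longitude_powerD1 mulgA.
Unshelve. all: by end_near. Qed.

End Step.

Lemma developable_discrete : developable rho L D <-> exists g, discrete_developing g.
Proof.
split=> [[mu dev]|[g dg]]; first by eexists; exact: developing_discrete dev.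
by exists (step_map g); exact: discrete_step.
Qed.

End Longitude.

Section NotEquivalent.
Variable R : realType.

(** Colourings do not see the reflection, and reversal inverts the longitude. *)
Lemma mirror_not_equivalent :
  ~ welded_equiv (chiral_diagram R) (mirror_diagram (chiral_diagram R)).
Proof.
have [gT [rho [L [rho2 rhoL yes no]]]] := chiral_longitude.
have rhoL' : commute rho (L^-1)%g by exact: commuteV.
move=> eqv; apply: no; apply/(developable_discrete R rhoL').
apply/(welded_equiv_developable rho2 rhoL' eqv).
apply: (@developable_reverse _ _ rho L (chiral_diagram R)) => //.
by apply/(developable_discrete R rhoL).
Qed.

End NotEquivalent.

(** * Altitude, radius and height of the tube *)

Section Spots.
Variable R : realType.
Implicit Types (s t x y : R).
Local Notation grid := (@grid R).

Lemma cs_lt x y : 0 <= x -> x < y -> y <= 1 / 2 -> cs y < cs x.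
Proof.
move=> x0 xy y2; have p0 := pi_gt0 R.
have I (u : R) : 0 <= u <= 1 / 2 -> 2 * pi * u \in `[0, pi].
  move=> /andP[u0 u2]; rewrite in_itv /= mulr_ge0 ?mulr_ge0 ?(ltW p0)//=.
  by rewrite (_ : 2 * pi * u = pi * (2 * u)) ?ger_pMr//; [lra|ring].
have Ix : 2 * pi * x \in `[0, pi] by apply: I; apply/andP; split; lra.
have Iy : 2 * pi * y \in `[0, pi] by apply: I; apply/andP; split; lra.
by rewrite /cs ltr_cos// ltr_pM2l// mulr_gt0.
Qed.

(** The cosine measures the distance to the integers. *)
Lemma cs_near x (e : R) : 0 <= e <= 1 / 2 -> cs e < cs x -> exists n : int, `|x - n%:~R| < e.
Proof.
move=> /andP[e0 e2] ex; have [y /andP[y0 y2] xy] := fold_half x.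
have cxy : cs x = cs y by case: xy => /cs_periodic ->; rewrite ?csN.
have ye : y < e.
  rewrite ltNge; apply/negP; rewrite le_eqVlt => /predU1P[ey|ey].
    by move: ex; rewrite cxy ey ltxx.
  by have := cs_lt e0 ey y2; rewrite -cxy => /(lt_trans ex); rewrite ltxx.
by case: xy => /cong1P[n ->]; exists n; rewrite addrK ?normrN ger0_norm.
Qed.

Lemma cs_gt x (e : R) : e <= 1 / 2 -> `|x| < e -> cs e < cs x.
Proof.
move=> e2 xe; have -> : cs x = cs `|x|.
  by have [x0|x0] := leP 0 x; [rewrite ger0_norm|rewrite ltr0_norm// csN].
exact: cs_lt.
Qed.

(** Half the width of the windows around the crossings. *)
Definition window : R := 1 / 400.

(** A periodic bump at [w], supported in the window around [w]. *)
Definition spot (w s : R) : R := bump (cs (s - w) - cs window).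

Lemma smooth_shift (w : R) : smooth (fun s => s - w).
Proof. by apply: smoothB; [exact: smooth_id|exact: smooth_cst]. Qed.

Lemma smooth_spot w : smooth (spot w).
Proof.
apply: (smooth_comp (@smooth_bump R)); apply: smoothB; last exact: smooth_cst.
exact: smooth_comp (@smooth_cs R) (smooth_shift w).
Qed.

Lemma cong1B s t w : cong1 s t -> cong1 (s - w) (t - w).
Proof. by rewrite /cong1 opprB addrA subrK. Qed.

Lemma spot_periodic w : periodic1 (spot w).
Proof. by move=> s t st; rewrite /spot (cs_periodic (cong1B w st)). Qed.

Lemma spot_ge0 w s : 0 <= spot w s. Proof. exact: bump_ge0. Qed.

Lemma spot_gt0 w s : `|s - w| < window -> 0 < spot w s.
Proof. by move=> sw; rewrite bump_gt0 subr_gt0 cs_gt// /window; lra. Qed.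

Lemma cs_far (e x : R) : 0 <= e <= 1 / 2 -> (forall n : int, e <= `|x - n%:~R|) -> cs x <= cs e.
Proof.
move=> eI xe; rewrite leNgt; apply/negP => /(cs_near eI)[n].
by rewrite ltNge xe.
Qed.

Lemma spot_eq0 w s : (forall n : int, window <= `|s - w - n%:~R|) -> spot w s = 0.
Proof.
move=> H; apply: bump_eq0; rewrite subr_le0; apply: cs_far => //.
by rewrite /window; apply/andP; split; lra.
Qed.

Lemma grid_far a b (n : int) s : (a < 80)%N -> (b < 80)%N -> a != b ->
  `|s - grid b| <= 1 / 200 -> 3 / 400 <= `|s - grid a - n%:~R|.
Proof.
move=> a80 b80 ab sb.
have kl : b%:Z != a%:Z + n * 80 by apply/eqP; move/eqP: ab; lia.
have := @grid_dist R _ _ kl; rewrite intrD intrM -!pmulrn mulrDl => H.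
have := ler_normB (s - grid a - n%:~R) (s - grid b).
rewrite (_ : _ - _ - (s - grid b) = b%:R / 80 - (a%:R / 80 + n%:~R * 80%:~R / 80)); last first.
  by rewrite /grid; field.
move: sb; rewrite /grid; lra.
Qed.

Lemma spot_other a b s : (a < 80)%N -> (b < 80)%N -> a != b ->
  `|s - grid b| <= 1 / 200 -> spot (grid a) s = 0.
Proof.
move=> a80 b80 ab sb; apply: spot_eq0 => n.
by have := grid_far n a80 b80 ab sb; rewrite /window; lra.
Qed.

(** Of the two strands of a welded crossing, the earlier one is raised. *)
Definition raised_param a : bool :=
  [&& has (fun b => double_point a b && (a < b)%N) (iota 0 80),
      a \notin under_params & a \notin over_params].

Definition raised_params := [seq a <- iota 0 80 | raised_param a].

Definition altitude s : R := \sum_(a <- raised_params) spot (grid a) s.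

(** Equal to 1 in the window around [a] and to 0 outside the window of twice the
   width. *)
Definition thin a s : R :=
  step ((cs (s - grid a) - cs (2 * window)) / (cs window - cs (2 * window))).

(** Ratio of the radius of the tube to its radius at the under-crossings. *)
Definition girth s : R := 1 + \prod_(a <- under_params) (1 - thin a s).

Lemma smooth_altitude : smooth altitude.
Proof. by apply: smooth_sum => a; exact: smooth_spot. Qed.

Lemma smooth_prod (I : Type) (l : seq I) (f : I -> R -> R) :
  (forall i, smooth (f i)) -> smooth (fun x => \prod_(i <- l) f i x).
Proof.
move=> sf; elim: l => [|i l IH].
  by rewrite (_ : (fun x => _) = fun=> 1); [exact: smooth_cst|apply/funext => x; rewrite big_nil].
rewrite (_ : (fun x => _) = fun x => f i x * \prod_(i <- l) f i x); first exact: smoothM.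
by apply/funext => x; rewrite big_cons.
Qed.

Lemma smooth_girth : smooth girth.
Proof.
apply: smoothD; first exact: smooth_cst.
apply: smooth_prod => a; apply: smoothB; first exact: smooth_cst.
apply: (smooth_comp (@smooth_step R)); apply: smoothM; last exact: smooth_cst.
apply: smoothB; last exact: smooth_cst.
exact: smooth_comp (@smooth_cs R) (smooth_shift _).
Qed.

Lemma altitude_periodic : periodic1 altitude.
Proof. by move=> s t st; apply: eq_bigr => a _; exact: spot_periodic. Qed.

Lemma girth_periodic : periodic1 girth.
Proof.
move=> s t st; congr (1 + _); apply: eq_bigr => a _; congr (1 - step ((_ - _) / _)).
exact/cs_periodic/cong1B.
Qed.

Lemma girth_bounds s : 1 <= girth s <= 2.
Proof.
have H : 0 <= \prod_(a <- under_params) (1 - thin a s) <= 1.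
  elim: under_params => [|a l /andP[l0 l1]]; first by rewrite big_nil ler01 lexx.
  have h0 := step_ge0 ((cs (s - grid a) - cs (2 * window)) / (cs window - cs (2 * window))).
  have h1 := step_le1 ((cs (s - grid a) - cs (2 * window)) / (cs window - cs (2 * window))).
  rewrite big_cons mulr_ge0 ?subr_ge0//= mulr_ile1// ?subr_ge0//.
  by rewrite lerBlDr lerDl.
by move: H; rewrite /girth => /andP[h0 h1]; apply/andP; split; lra.
Qed.

Lemma girth_under a s : a \in under_params -> `|s - grid a| <= window -> girth s = 1.
Proof.
move=> aU sa; rewrite /girth (bigD1_seq a)//= /thin step1 ?subrr ?mul0r ?addr0//.
have lt : cs (2 * window) < cs window by apply: cs_lt; rewrite /window; lra.
rewrite ler_pdivlMr ?subr_gt0// mul1r lerD2r.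
have -> : cs (s - grid a) = cs `|s - grid a|.
  by have [x0|x0] := leP 0 (s - grid a); [rewrite ger0_norm|rewrite ltr0_norm// csN].
have [->//|lt'] := eqVneq `|s - grid a| window.
by apply/ltW/cs_lt; rewrite ?lt_neqAle ?lt'//= /window; lra.
Qed.

Lemma girth_other b s : (b < 80)%N -> b \notin under_params -> `|s - grid b| <= window -> girth s = 2.
Proof.
move=> b80 bU sb; rewrite /girth big_seq big1 => [|a aU]; first by lra.
rewrite /thin step0 ?subr0//.
have lt : cs (2 * window) < cs window by apply: cs_lt; rewrite /window; lra.
rewrite pmulr_lle0 ?invr_gt0 ?subr_gt0// subr_le0; apply: cs_far => [|n].
  by rewrite /window; apply/andP; split; lra.
have a80 : (a < 80)%N by move: a aU; apply/allP.
have ab : a != b by apply: contraNneq bU => <-.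
have := grid_far n a80 b80 ab (_ : `|s - grid b| <= 1 / 200).
by move: sb; rewrite /window => sb /(_ ltac:(lra)); lra.
Qed.

Lemma altitude_classical b s : b \in under_params ++ over_params ->
  `|s - grid b| <= window -> altitude s = 0.
Proof.
move=> bU sb; rewrite /altitude big_seq big1// => a; rewrite mem_filter => /andP[aR].
rewrite mem_iota => /andP[_ a80].
have b80 : (b < 80)%N by move: b bU {sb}; apply/allP.
apply: (spot_other a80 b80); last by move: sb; rewrite /window; lra.
apply: contraTneq bU => <-; rewrite mem_cat negb_or.
by have /and3P[_ -> ->] := aR.
Qed.

Lemma spots_eq0 (l : seq nat) c : all (fun a => a < 80)%N l -> (c < 80)%N -> c \notin l ->
  \sum_(a <- l) spot (grid a) (grid c) = 0.
Proof.
move=> l80 c80 cl; rewrite big_seq big1// => d dl.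
have d80 : (d < 80)%N by move: d dl; apply/allP.
apply: (spot_other d80 c80); last by rewrite subrr normr0; lra.
by apply: contraNneq cl => <-.
Qed.

Lemma spots_gt0 (l : seq nat) c : uniq l -> c \in l -> 0 < \sum_(a <- l) spot (grid a) (grid c).
Proof.
move=> lu cl; rewrite (bigD1_seq c)//= ltr_pwDl//.
  by apply: spot_gt0; rewrite subrr normr0 /window; lra.
by apply: sumr_ge0 => *; exact: spot_ge0.
Qed.

Lemma altitude_welded a b : double_point a b -> a \notin under_params ++ over_params ->
  altitude (grid a) != altitude (grid b).
Proof.
move=> ab aUO; have /and3P[a80 b80 _] := ab.
have x : (a \in raised_params) != (b \in raised_params).
  pose P a b := double_point a b ==> (a \notin under_params ++ over_params) ==>
    ((a \in raised_params) != (b \in raised_params)).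
  have H : all (fun a => all (P a) (iota 0 80)) (iota 0 80) by vm_compute.
  by move: (all_iota (all_iota H a80) b80); rewrite /P ab aUO.
have l80 : all (fun a => a < 80)%N raised_params.
  by apply/allP => c; rewrite mem_filter mem_iota => /andP[_].
have lu : uniq raised_params by exact: filter_uniq (iota_uniq _ _).
rewrite /altitude; move: raised_params x l80 lu => l x l80 lu.
have [aR|aR] := boolP (a \in l); [have bR : b \notin l|have bR : b \in l].
- by move: x; rewrite aR; case: (b \in l).
- by rewrite (spots_eq0 l80 b80 bR) gt_eqF// spots_gt0.
- by move: x; rewrite (negbTE aR); case: (b \in l).
- by rewrite (spots_eq0 l80 a80 aR) lt_eqF// spots_gt0.
Qed.

(** The sign of the i-th classical crossing. *)
Definition sign_at i : R :=
  det2 (velocity (grid (over_at i))) (velocity (grid (under_at i))) / 2.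

(** At an under-crossing the height is, up to a positive factor, minus the sign of
   the crossing times the displacement along the under-strand: a strand that
   passes from the right to the left of the over-strand, at a positive crossing,
   has to be above on the right and below on the left. *)
Definition height s : R :=
  - \sum_(i <- iota 0 9) sign_at i * (sn (s - grid (under_at i)) * spot (grid (under_at i)) s).

Lemma smooth_height : smooth height.
Proof.
apply: smoothN; apply: smooth_sum => i; apply: smoothM; first exact: smooth_cst.
by apply: smoothM; [exact: smooth_comp (@smooth_sn R) (smooth_shift _)|exact: smooth_spot].
Qed.

Lemma height_periodic : periodic1 height.
Proof.
move=> s t st; congr (- _); apply: eq_bigr => i _; congr (_ * _).
by rewrite (sn_periodic (cong1B _ st)) (spot_periodic _ st).
Qed.

Lemma under_at80 i : (i < 9)%N -> (under_at i < 80)%N.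
Proof. by move=> /double_point_at/and3P[]. Qed.

Lemma over_at80 i : (i < 9)%N -> (over_at i < 80)%N.
Proof. by move=> /double_point_at/and3P[]. Qed.

Lemma height_away s :
  (forall o u, over (chiral_diagram R) o u -> window < `|s - u|) -> height s = 0.
Proof.
move=> H; rewrite /height big_seq big1 ?oppr0// => i; rewrite mem_iota => /andP[_ i9].
rewrite spot_eq0 ?mulr0// => n; rewrite -addrA -opprD; apply/ltW.
apply: (H (grid (over_at i))); exists i; split=> //; first exact: cong1_refl.
exact: cong1DZ.
Qed.

Lemma height_other b s : (b < 80)%N -> b \notin under_params -> `|s - grid b| <= window ->
  height s = 0.
Proof.
move=> b80 bU sb; rewrite /height big_seq big1 ?oppr0// => i; rewrite mem_iota => /andP[_ i9].
rewrite (@spot_other _ b) ?mulr0 ?under_at80//; last by move: sb; rewrite /window; lra.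
by apply: contraNneq bU => <-; exact: mem_nth.
Qed.

Lemma height_under i x : (i < 9)%N -> `|x| <= window ->
  height (grid (under_at i) + x) = - sign_at i * (sn x * bump (cs x - cs window)).
Proof.
have iI : (i < 9)%N -> i \in iota 0 9 by rewrite mem_iota.
move=> i9 xe; rewrite /height (bigD1_seq i (iI i9) (iota_uniq 0 9)) big_seq_cond big1.
  by rewrite [X in - X]addr0 /spot [grid _ + x]addrC addrK mulNr.
move=> j; rewrite mem_iota => /andP[/andP[_ j9] ji].
rewrite (@spot_other _ (under_at i)) ?mulr0 ?under_at80//.
  by apply: contraNneq ji => /under_at_inj ->.
by rewrite [grid _ + x]addrC addrK; move: xe; rewrite /window; lra.
Qed.

(** All data of the tube at a classical crossing, in the frame of the two
   perpendicular strands: [b] is the velocity of the over-strand and [g] the sign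
   of the crossing. *)
Lemma classical_chart o u : over (chiral_diagram R) o u -> exists (b : R * R) (g : R),
  [/\ b.1 ^+ 2 = 1, b.2 ^+ 2 = 1 & g ^+ 2 = 1] /\ forall x, `|x| <= window ->
  [/\ [/\ velocity (o + x) = b, liss (o + x) = liss o + x *: b,
          velocity (u + x) = g *: perp b & liss (u + x) = liss o + x *: (g *: perp b)],
      [/\ girth (o + x) = 2, girth (u + x) = 1, altitude (o + x) = 0 & altitude (u + x) = 0],
      height (o + x) = 0 & height (u + x) = - g * (sn x * bump (cs x - cs window))].
Proof.
move=> /[dup] /over_crossing/crossing_chart[b [g [b1 b2 g2 H]]] [i [i9 oi ui]].
exists b, g; split=> // x xe.
have xe' : `|x| <= 1 / 200 by move: xe; rewrite /window; lra.
have sh c d : cong1 c d -> cong1 (c + x) (d + x).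
  by rewrite /cong1 (_ : c + x - (d + x) = c - d)//; ring.
have near c : `|grid c + x - grid c| <= window by rewrite [grid c + x]addrC addrK.
have uU : under_at i \in under_params by exact: mem_nth.
have oO : over_at i \in over_params by exact: mem_nth.
have oU : over_at i \notin under_params.
  apply/negP => /(nthP 0%N)[j j9 e]; have /eqP := over_not_under i9 (j9 : (j < 9)%N).
  by apply; rewrite /under_at e.
have o80 := over_at80 i9.
have gE : g = sign_at i.
  have e0 : `|0 : R| <= 1 / 200 by rewrite normr0; lra.
  have [Vo _ Vu _] := H 0 e0; rewrite !addr0 in Vo Vu.
  rewrite /sign_at -(velocity_periodic oi) -(velocity_periodic ui) Vo Vu /det2 /perp.
  case: b b1 b2 {H Vo Vu} => b1 b2 /= b12 b22; rewrite -![_ *: _]/(_ * _).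
  have -> : b1 * (g * b1) - b2 * (g * - b2) = g * (b1 ^+ 2 + b2 ^+ 2) by ring.
  by rewrite b12 b22; field.
split.
- exact: H.
- rewrite (girth_periodic (sh _ _ oi)) (girth_periodic (sh _ _ ui)).
  rewrite (altitude_periodic (sh _ _ oi)) (altitude_periodic (sh _ _ ui)).
  split; [exact: girth_other (near _)|exact: girth_under (near _)|
          apply: altitude_classical (near _)..]; by rewrite mem_cat ?uU ?oO ?orbT.
- by rewrite (height_periodic (sh _ _ oi)); exact: height_other (near _).
- by rewrite (height_periodic (sh _ _ ui)) height_under// gE.
Qed.

End Spots.

(** * The tube near a classical crossing *)

Section TubeFormulas.
Variable R : realType.
Implicit Types (s t x y eps : R) (p q : R * R).

Definition radius eps s : R := eps * girth s.

Lemma smooth_radius eps : smooth (radius eps).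
Proof. by apply: smoothM; [exact: smooth_cst|exact: smooth_girth]. Qed.

Lemma radius_periodic eps : periodic1 (radius eps).
Proof. by move=> s t /girth_periodic st; rewrite /radius st. Qed.

Lemma radius_bounds eps s : 0 < eps -> eps <= radius eps s <= 2 * eps.
Proof.
move=> e0; have /andP[g1 g2] := girth_bounds s; rewrite /radius.
by apply/andP; split; [rewrite ler_peMr// ltW|rewrite mulrC ler_wpM2r// ltW].
Qed.

Lemma radius_gt0 eps s : 0 < eps -> 0 < radius eps s.
Proof. by move=> e0; have /andP[h _] := radius_bounds s e0; exact: lt_le_trans h. Qed.

Definition normal s : R * R := (Num.sqrt (normsq (velocity s)))^-1 *: perp (velocity s).

Lemma unit_normal_liss s : unit_normal (@liss R) s = normal s.
Proof. by rewrite /unit_normal derive1_liss. Qed.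

Lemma normal_periodic : periodic1 normal.
Proof. by move=> s t /velocity_periodic st; rewrite /normal st. Qed.

Definition tube eps s p : (R * R) * R :=
  (liss s + (radius eps s * p.1) *: normal s, altitude s + radius eps s * p.2).

Lemma tubeE eps s p : tube_disc (@liss R) (radius eps) (@altitude R) s p = tube eps s p.
Proof. by rewrite /tube_disc unit_normal_liss. Qed.

Lemma tube_periodic eps s t p : cong1 s t -> tube eps s p = tube eps t p.
Proof.
move=> st; rewrite /tube (liss_periodic st) (radius_periodic eps st) (normal_periodic st).
by rewrite (altitude_periodic st).
Qed.

(** Up to sign, both coordinates of a unit vector on a diagonal of the plane. *)
Definition diag : R := (Num.sqrt 2)^-1.

Lemma diag2 : diag ^+ 2 = 1 / 2.
Proof. by rewrite /diag exprVn sqr_sqrtr//; field. Qed.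

Lemma diag_gt0 : 0 < diag. Proof. by rewrite invr_gt0 sqrtr_gt0. Qed.

Lemma diag_lt1 : diag < 1.
Proof.
rewrite -(@ltr_pXn2r _ 2) ?nnegrE ?ler01 ?(ltW diag_gt0)// diag2 expr1n; lra.
Qed.

Lemma normal_diagonal s (b : R * R) : velocity s = b -> b.1 ^+ 2 = 1 -> b.2 ^+ 2 = 1 ->
  normal s = diag *: perp b.
Proof. by move=> vb b1 b2; rewrite /normal vb /normsq b1 b2. Qed.

Section Crossing.
Variables (o u : R) (b : R * R) (g : R).
Hypotheses (b1 : b.1 ^+ 2 = 1) (b2 : b.2 ^+ 2 = 1) (g2 : g ^+ 2 = 1).
Hypothesis chart : forall x, `|x| <= window R ->
  [/\ [/\ velocity (o + x) = b, liss (o + x) = liss o + x *: b,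
          velocity (u + x) = g *: perp b & liss (u + x) = liss o + x *: (g *: perp b)],
      [/\ girth (o + x) = 2, girth (u + x) = 1, altitude (o + x) = 0 & altitude (u + x) = 0],
      height (o + x) = 0 & height (u + x) = - g * (sn x * bump (cs x - cs (window R)))].

(** At a crossing both tubes are straight round cylinders, of radii [2 * eps] and
   [eps], with perpendicular axes that meet. *)
Lemma tube_over eps x q : `|x| <= window R ->
  tube eps (o + x) q = (liss o + x *: b + (2 * eps * q.1 * diag) *: perp b, 2 * eps * q.2).
Proof.
move=> /chart[[vo lo _ _] [go _ ao _] _ _]; rewrite /tube lo ao add0r (normal_diagonal vo b1 b2).
by rewrite /radius go scalerA; congr (_ + _ *: _, _); ring.
Qed.

Lemma tube_under eps x p : `|x| <= window R ->
  tube eps (u + x) p = (liss o - (eps * p.1 * diag * g) *: b + (x * g) *: perp b, eps * p.2).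
Proof.
move=> /chart[[_ _ vu lu] [_ gu _ au] _ _].
have n : normal (u + x) = - (diag * g) *: b.
  rewrite (normal_diagonal vu).
  - case: (b) => c d; rewrite /perp !pairZ /=; congr (_, _); ring.
  - by case: (b) b2 => c d /= d2; rewrite -[_ *: _]/(_ * _) exprMn g2 sqrrN d2 mulr1.
  - by case: (b) b1 => c d /= c2; rewrite -[_ *: _]/(_ * _) exprMn g2 c2 mulr1.
rewrite /tube lu au add0r n /radius gu !scalerA mulr1 addrAC.
have -> : eps * p.1 * - (diag * g) = - (eps * p.1 * diag * g) by ring.
by rewrite scaleNr.
Qed.

Lemma frame_inj (x y x' y' : R) : x *: b + y *: perp b = x' *: b + y' *: perp b -> x = x' /\ y = y'.
Proof.
case: (b) b1 b2 => c d /= c2 d2; rewrite /perp !pairZ !pairD => -[e1 e2].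
have h1 : (x - x') * (c ^+ 2 + d ^+ 2) = 0.
  by rewrite (_ : _ * _ = c * ((x * c + y * - d) - (x' * c + y' * - d)) +
     d * ((x * d + y * c) - (x' * d + y' * c))); [rewrite e1 e2 !subrr !mulr0 addr0|ring].
have h2 : (y - y') * (c ^+ 2 + d ^+ 2) = 0.
  by rewrite (_ : _ * _ = c * ((x * d + y * c) - (x' * d + y' * c)) -
     d * ((x * c + y * - d) - (x' * c + y' * - d))); [rewrite e1 e2 !subrr !mulr0 subr0|ring].
by move: h1 h2; rewrite c2 d2; split; lra.
Qed.

Lemma tube_meet eps x y p q : `|x| <= window R -> `|y| <= window R ->
  tube eps (o + x) q = tube eps (u + y) p <->
  [/\ x = - (eps * p.1 * diag * g), 2 * eps * diag * q.1 = y * g & 2 * eps * q.2 = eps * p.2].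
Proof.
move=> xe ye; rewrite tube_over// tube_under//; split=> [/pair_equal_spec[e1 e2]|[-> e1 ->]].
  move: e1; rewrite -!addrA => /addrI; rewrite -scaleNr => /frame_inj[-> <-].
  by split=> //; ring.
by rewrite scaleNr -e1; congr (_ + _ *: _, _); ring.
Qed.

Variable eps : R.
Hypotheses (eps0 : 0 < eps) (epsw : 2 * eps < window R).

Lemma shift_small p : disc p -> `|- (eps * p.1 * diag * g)| <= window R.
Proof.
have d0 := diag_gt0; have d1 := diag_lt1; have e0 := eps0; have ew := epsw.
move=> dp; have p1 : p.1 ^+ 2 <= 1 by move: dp; rewrite /disc /= /normsq; have := sqr_ge0 p.2; lra.
have p1' : `|p.1| <= 1 by rewrite -(@ler_pXn2r _ 2) ?nnegrE// expr1n real_normK ?num_real.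
have g1 : `|g| = 1 by apply/eqP; rewrite -(@eqrXn2 _ 2)// expr1n real_normK ?num_real// g2.
rewrite normrN !normrM g1 mulr1 (gtr0_norm eps0) (gtr0_norm d0).
apply: (@le_trans _ _ (eps * 1 * 1)); last by rewrite !mulr1; lra.
by rewrite ler_pM ?mulr_ge0// ?(ltW eps0) ?(ltW d0) ?(ltW d1)// ler_wpM2l// ltW.
Qed.

(** A line of the thin cylinder enters and leaves the thick one at the distance
   [W] from the crossing, on the two sides. *)
Lemma liss_tube_crossing :
  tube_crossing (@liss R) (radius eps) (@altitude R) (@height R) (window R) o u.
Proof.
have d0 := diag_gt0; have d1 := diag_lt1; have e0 := eps0; have ew := epsw.
have en : eps != 0 by rewrite gt_eqF.
have split_at c s : s = c + (s - c) by rewrite addrC subrK.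
split.
  move=> s t so tu; rewrite (split_at o s) (split_at u t) /radius.
  have [_ [-> _ _ _] _ _] := chart so; have [_ [_ -> _ _] _ _] := chart tu.
  by rewrite mulr1; lra.
move=> v hit; pose p := meridian v.
have pc : p.1 ^+ 2 + p.2 ^+ 2 = 1 by rewrite addrC cos2Dsin2.
have p2 : p.2 ^+ 2 <= 1 by rewrite -pc lerDr sqr_ge0.
have dp : disc p by rewrite /disc /= /normsq pc.
pose k := 2 * eps * diag; have k0 : 0 < k by rewrite !mulr_gt0.
have kw : k < window R.
  by apply: le_lt_trans epsw; rewrite /k ger_pMr ?mulr_gt0// ltW.
pose W := k * Num.sqrt (1 - p.2 ^+ 2 / 4).
have rt0 : 0 < 1 - p.2 ^+ 2 / 4 by lra.
have W0 : 0 < W by rewrite mulr_gt0 ?sqrtr_gt0.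
have W2 : W ^+ 2 = k ^+ 2 * (1 - p.2 ^+ 2 / 4) by rewrite exprMn sqr_sqrtr// ltW.
have Ww : W < window R.
  apply: le_lt_trans kw; rewrite /W ger_pMr// -(@ler_pXn2r _ 2) ?nnegrE ?sqrtr_ge0//.
  by rewrite sqr_sqrtr ?(ltW rt0)// expr1n; have := sqr_ge0 p.2; lra.
have g1 : `|g| = 1 by apply/eqP; rewrite -(@eqrXn2 _ 2)// expr1n real_normK ?num_real// g2.
have gW : `|g * W| < window R by rewrite normrM g1 mul1r gtr0_norm.
(* in coordinates along the two strands the meeting points solve a linear system *)
have hitP t s q : `|t - u| <= window R ->
    (hit t s q <-> [/\ s = o - eps * p.1 * diag * g, k * q.1 = (t - u) * g & 2 * q.2 = p.2]).
  move=> tu; rewrite /hit !tubeE; split=> [[so]|[-> e1 e2]].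
    rewrite {1}(split_at o s) {1}(split_at u t) => /(tube_meet _ _ _ so tu)[e1 e2 e3].
    split=> //; first by rewrite (split_at o s) e1.
    by apply: (mulfI en); rewrite -e3; ring.
  have sw := shift_small dp; split; first by rewrite addrC addKr.
  rewrite [in RHS](split_at u t); apply/(tube_meet _ _ _ sw tu); split=> //.
  by rewrite -e2; ring.
have normE t q : k * q.1 = (t - u) * g -> 2 * q.2 = p.2 ->
    k ^+ 2 * (normsq q - 1) = (t - u) ^+ 2 - W ^+ 2.
  move=> e1 e2; by rewrite W2 /normsq mulrBr mulrDr -exprMn e1 exprMn g2 -e2; field.
exists (u + g * W), (u - g * W); split.
- by rewrite addrC addKr ltW.
- by rewrite addrC addKr normrN ltW.
- have gW' : `|- (g * W)| <= window R by rewrite normrN ltW.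
  have [_ _ _ ->] := chart (ltW gW); have [_ _ _ ->] := chart gW'.
  have gs : g * sn (g * W) = sn W.
    have : g = 1 \/ g = -1 by move: g2 => /eqP; rewrite sqrf_eq1 => /orP[]/eqP->; [left|right].
    by case=> ->; rewrite ?mul1r ?mulN1r ?snN ?opprK.
  have e1 X : - g * (sn (g * W) * X) = - (sn W * X) by rewrite -gs; ring.
  have e2 X : - g * (- sn (g * W) * X) = sn W * X by rewrite -gs; ring.
  rewrite snN e1 e2.
  have sW : 0 < sn W by apply: sn_gt0; rewrite W0 /=; move: Ww; rewrite /window; lra.
  have w2 : window R <= 1 / 2 by rewrite /window; lra.
  rewrite oppr_lt0; apply/andP; split; rewrite mulr_gt0// bump_gt0 subr_gt0 cs_gt//.
  by rewrite normrN.
- move=> t tu; have -> : (t - (u + g * W)) * (t - (u - g * W)) = (t - u) ^+ 2 - W ^+ 2.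
    by rewrite -[W ^+ 2]mul1r -g2; ring.
  split=> [[s [q [dq /(hitP _ _ _ tu)[_ e1 e2]]]]|H].
    rewrite -(normE _ _ e1 e2) pmulr_rle0 ?exprn_gt0//.
    by move: dq; rewrite /disc /=; lra.
  pose q := ((t - u) * g / k, p.2 / 2).
  have e1 : k * q.1 = (t - u) * g by rewrite /q /=; field; rewrite gt_eqF.
  have e2 : 2 * q.2 = p.2 by rewrite /q /=; field.
  exists (o - eps * p.1 * diag * g), q; split; last exact/hitP.
  by move: H; rewrite -(normE _ _ e1 e2) pmulr_rle0 ?exprn_gt0// /disc /=; lra.
move=> t tu.
have circ q : k * q.1 = (t - u) * g -> 2 * q.2 = p.2 -> circle q -> (t - u) ^+ 2 = W ^+ 2.
  move=> e1 e2 cq; apply/eqP; rewrite -subr_eq0 -(normE _ _ e1 e2) cq subrr mulr0//.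
have pos q : k * q.1 = (t - u) * g -> (0 < q.1) = (0 < (t - u) * g).
  by move=> <-; rewrite pmulr_rgt0.
have neg q : k * q.1 = (t - u) * g -> (q.1 < 0) = ((t - u) * g < 0).
  by move=> <-; rewrite pmulr_rlt0.
have sides q : k * q.1 = (t - u) * g -> 2 * q.2 = p.2 -> circle q ->
    (t - u) * g = W \/ (t - u) * g = - W.
  move=> e1 e2 /(circ _ e1 e2) e; have : ((t - u) * g) ^+ 2 = W ^+ 2 by rewrite exprMn g2 mulr1.
  by move=> /eqP; rewrite eqf_sqr => /orP[]/eqP; [left|right].
have solve y : (t - u) * g = y -> t = u + g * y.
  by move=> <-; rewrite mulrCA -expr2 g2 mulr1 addrC subrK.
have exq y : t = u + g * y -> y ^+ 2 = W ^+ 2 -> exists s q, [/\ circle q, hit t s q & k * q.1 = y].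
  move=> te y2; pose q := (y / k, p.2 / 2).
  have tg : (t - u) * g = y by rewrite te addrC addKr mulrAC -expr2 g2 mul1r.
  have e1 : k * q.1 = (t - u) * g by rewrite /q /= tg; field; rewrite gt_eqF.
  have e2 : 2 * q.2 = p.2 by rewrite /q /=; field.
  exists (o - eps * p.1 * diag * g), q; split; [|exact/hitP|by rewrite e1].
  have := normE _ _ e1 e2; rewrite (_ : (t - u) ^+ 2 = W ^+ 2).
    rewrite subrr => /eqP; rewrite mulf_eq0 expf_eq0 /= (gt_eqF k0) /= subr_eq0 => /eqP; exact.
  by rewrite te addrC addKr exprMn g2 mul1r.
split.
- split=> [[s [q [cq /(hitP _ _ _ tu)[_ e1 e2]]]]|te].
    rewrite (pos _ e1) => h; apply: solve.
    by case: (sides _ e1 e2 cq) => // e; move: h; rewrite e; lra.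
  have [s [q [cq hq kq]]] := exq W te erefl; exists s, q; split=> //.
  by rewrite -(pmulr_rgt0 _ k0) kq.
- split=> [[s [q [cq /(hitP _ _ _ tu)[_ e1 e2]]]]|te].
    rewrite (neg _ e1) => h; rewrite -mulrN; apply: solve.
    by case: (sides _ e1 e2 cq) => // e; move: h; rewrite e; lra.
  rewrite -mulrN in te.
  have [s [q [cq hq kq]]] := exq (- W) te (sqrrN W); exists s, q; split=> //.
  by rewrite -(pmulr_rlt0 _ k0) kq; lra.
- move=> s q cq /(hitP _ _ _ tu)[_ e1 e2]; apply/eqP => q0; move: e1; rewrite q0 mulr0 => e1.
  have := circ q; rewrite q0 mulr0 => /(_ e1 e2 cq) /eqP; apply/negP.
  have /eqP : (t - u) * g = 0 by [].
  rewrite mulf_eq0 => /orP[/eqP->|/eqP g0]; last by move: g2; rewrite g0 expr0n /=; lra.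
  by rewrite expr0n /= eq_sym expf_eq0 /= gt_eqF.
Qed.

End Crossing.

End TubeFormulas.

(** * Thin tubes meet themselves only at classical crossings *)

Section Bounds.
Variable R : realType.
Implicit Types (s t x y eps : R).

Lemma slope_derive_bounded : exists2 C : R, 0 < C & forall x, `|'D_1 (@slope R) x| <= C.
Proof.
pose d := 'D_1 (@slope R).
have cd : continuous d by exact/smooth_continuous/smooth_derive/smooth_slope.
have ds x : is_derive x (1 : R) (@slope R) (d x) by split; [exact: (smooth_derivable (@smooth_slope R))|reflexivity].
have d1 : periodic1 d.
  apply: periodic1_step => x.
  have sh : is_derive x (1 : R) (fun y => y + 1) (1 : R) by apply: is_derive_eq; rewrite addr0.
  have := @is_derive1_comp R (@slope R) (fun y => y + 1) x _ _ (ds (x + 1)) sh.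
  rewrite mulr1 (_ : _ \o _ = @slope R); first by case=> _ <-.
  by apply/funext => y /=; apply/slope_periodic/(cong1DZ y 1).
have [c _ cM] : exists2 c, c \in `[0, 1] & forall t, t \in `[(0 : R), 1] -> `|d t| <= `|d c|.
  apply: (@EVT_max R (fun x => `|d x|)) => //; apply: continuous_subspaceT => x.
  by apply: continuous_comp; [exact: cd|exact: norm_continuous].
exists (`|d c| + 1); first by rewrite ltr_wpDl.
move=> x; have f0 : 0 <= x - (Num.floor x)%:~R by rewrite subr_ge0 floor_le.
have f1 : x - (Num.floor x)%:~R <= 1 by have := floorD1_gt x; rewrite intrD => ?; lra.
have xf : cong1 x (x - (Num.floor x)%:~R) by apply/cong1P; exists (Num.floor x); rewrite subrK.
rewrite -/(d x) (d1 _ _ xf); apply: le_trans (cM _ _) _; last by rewrite lerDl.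
by rewrite in_itv /= f0.
Qed.

Lemma mean_value (A B : R -> R) s t : (forall x, is_derive x (1 : R) A (B x)) ->
  exists2 x, `|x - t| <= `|s - t| & A s - A t = B x * (s - t).
Proof.
move=> dA; have [st|ts] := leP s t.
  have [|c] := @MVT_segment _ A B s t st.
    by apply: derivable_within_continuous => z _; have [] := dA z.
  rewrite in_itv /= => /andP[c1 c2] e; exists c; last by rewrite -opprB e; ring.
  by rewrite !ler0_norm; lra.
have [|c] := @MVT_segment _ A B t s (ltW ts).
  by apply: derivable_within_continuous => z _; have [] := dA z.
rewrite in_itv /= => /andP[c1 c2] e; exists c => //.
by rewrite !ger0_norm; lra.
Qed.

Lemma velocity_bounded : exists K : R, [/\ 1 <= K,
  (forall s t, `|(velocity s).1 - (velocity t).1| <= K * `|s - t|),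
  (forall s t, `|(velocity s).2 - (velocity t).2| <= K * `|s - t|) &
  forall s, exists2 d : R * R, is_derive s (1 : R) (@velocity R) d & `|d.1| <= K /\ `|d.2| <= K].
Proof.
have [C C0 HC] := slope_derive_bounded.
have ds x : is_derive x (1 : R) (@slope R) ('D_1 (@slope R) x).
  by split; [exact: (smooth_derivable (@smooth_slope R))|reflexivity].
have lip x y : `|slope x - slope y| <= C * `|x - y|.
  by have [c _ ->] := mean_value x y ds; rewrite normrM ler_wpM2r.
exists (5 * C + 1); split; first by lra.
- move=> s t; apply: le_trans (lip _ _) _; rewrite -mulrBr normrM ger0_norm//.
  by rewrite mulrA ler_wpM2r//; lra.
- move=> s t; apply: le_trans (lip _ _) _; rewrite /phase (_ : _ - _ = 5 * (s - t)); last by ring.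
  by rewrite normrM ger0_norm// mulrA ler_wpM2r//; lra.
move=> s; have d4 : is_derive s (1 : R) (fun s => 4 * s) (4 : R).
  by apply: is_derive_eq; rewrite -[_ *: _]/(_ * _) mulr1.
have d5 : is_derive s (1 : R) (@phase R) (5 : R).
  by apply: is_derive_eq; rewrite -[_ *: _]/(_ * _) addr0 mulr1.
have D4 := @is_derive1_comp R (@slope R) (fun s => 4 * s) s _ _ (ds _) d4.
have D5 := @is_derive1_comp R (@slope R) (@phase R) s _ _ (ds _) d5.
eexists; first exact: is_derive_pair D4 D5.
rewrite /= !normrM !(ger0_norm (ler0n _ _)); split.
  by apply: le_trans (_ : C * 4 <= _); [rewrite ler_wpM2r|lra].
by apply: le_trans (_ : C * 5 <= _); [rewrite ler_wpM2r|lra].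
Qed.

Lemma normal_unit s : normsq (normal s) = 1.
Proof.
have v1 := velocity_normsq s; rewrite /normal; case: (velocity s) v1 => a b; rewrite /normsq /= => v1.
rewrite -![_ *: _]/(_ * _) !exprMn sqrrN -mulrDr exprVn sqr_sqrtr; last by lra.
by rewrite [b ^+ 2 + _]addrC mulVf// gt_eqF//; lra.
Qed.

Lemma normalE s : exists2 c : R, 0 < c <= 1 &
  normal s = (- (c * (velocity s).2), c * (velocity s).1).
Proof.
have v1 := velocity_normsq s; exists (Num.sqrt (normsq (velocity s)))^-1.
  have s1 : 1 <= Num.sqrt (normsq (velocity s)).
    by rewrite -[X in X <= _](@sqrtr1 R) ler_wsqrtr.
  have s0 : 0 < Num.sqrt (normsq (velocity s)) by apply: lt_le_trans s1.
  by rewrite invr_gt0 s0 invf_le1.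
by rewrite /normal /perp pairZ mulrN.
Qed.

Lemma sqr_le_norm (x y : R) : `|x| <= y -> x ^+ 2 <= y ^+ 2.
Proof. by move=> xy; rewrite -real_normK ?num_real// lerXn2r ?nnegrE// (le_trans _ xy). Qed.

Lemma disc_le1 (p : R * R) : disc p -> `|p.1| <= 1 /\ `|p.2| <= 1.
Proof.
rewrite /disc /= /normsq => dp; have h1 := sqr_ge0 p.1; have h2 := sqr_ge0 p.2.
by split; rewrite -(@ler_pXn2r _ 2) ?nnegrE// expr1n real_normK ?num_real//; lra.
Qed.

Lemma tube_fiber_inj eps s p q : 0 < eps -> tube eps s p = tube eps s q -> p = q.
Proof.
move=> e0 /pair_equal_spec[/addrI e1 /addrI e2].
have r0 := radius_gt0 s e0; have rn : radius eps s != 0 by rewrite gt_eqF.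
have [c /andP[c0 _] nE] := normalE s; have v1 := velocity_normsq s.
move: e1; rewrite nE !pairZ => -[h1 h2]; move/(mulfI rn): e2 => e2.
rewrite [p]surjective_pairing [q]surjective_pairing e2; congr (_, _).
apply: (mulfI rn); apply/eqP; rewrite -subr_eq0; apply/eqP.
have : (radius eps s * p.1 - radius eps s * q.1) * (c ^+ 2 * normsq (velocity s)) = 0.
  rewrite /normsq (_ : _ * _ = (radius eps s * p.1 * (c * (velocity s).1) - radius eps s * q.1 * (c * (velocity s).1)) * (c * (velocity s).1)
    - (radius eps s * p.1 * - (c * (velocity s).2) - radius eps s * q.1 * - (c * (velocity s).2)) * (c * (velocity s).2)); last by ring.
  by rewrite h1 h2 !subrr !mul0r subrr.
move=> /eqP; rewrite mulf_eq0 => /orP[/eqP//|]; rewrite mulf_eq0 expf_eq0 /= (gt_eqF c0) /=.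
by rewrite gt_eqF//; lra.
Qed.

Lemma velocity_dot_ge x1 x2 t : `|x1 - t| <= 1 / 2000 -> `|x2 - t| <= 1 / 2000 ->
  `|(velocity x1).1 - (velocity t).1| <= 1 / 2 -> `|(velocity x2).2 - (velocity t).2| <= 1 / 2 ->
  1 / 2 <= (velocity x1).1 * (velocity t).1 + (velocity x2).2 * (velocity t).2.
Proof.
move=> x1t x2t B1 B2.
have vb (a b : R) : `|a - b| <= 1 / 2 -> `|b| <= 1 -> - (1 / 2) <= a * b.
  move=> ab b1; have : `|(a - b) * b| <= 1 / 2 * 1 by rewrite normrM ler_pM.
  by move: (sqr_ge0 b); rewrite expr2 ler_norml mulrBl; clear; move=> ? /andP[] *; lra.
have half (x : R) : - (1 / 2) <= x -> 1 / 2 <= 1 + x by clear; lra.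
have near0 : `|t - t| <= 1 / 2000 by apply: le_trans x1t; rewrite subrr normr0.
have [[b b2 Hb]|[b b2 Hb]] := velocity_straight t.
  by rewrite [_.1](Hb _ x1t) [(velocity t).1](Hb _ near0) -expr2 b2 half// vb// slope_norm.
by rewrite [_.2 in X in _ + X](Hb _ x2t) [(velocity t).2](Hb _ near0) -expr2 b2 addrC half// vb// slope_norm.
Qed.

(** Nearby normal discs of the plane curve are disjoint.  If two of them met, then
   projecting the difference of the two points to the direction of the curve
   would bound [|s - t|] by a small multiple of itself: the left side of [main]
   is at least [|s - t| / 2] since one velocity component is constant nearby, and
   the right side is [O (eps * |s - t|)]. *)
Lemma tube_local : exists e1 eta : R, [/\ 0 < e1, 0 < eta & forall eps s t p q,
  0 < eps < e1 -> disc p -> disc q -> `|s - t| <= eta -> tube eps s p = tube eps t q -> s = t].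
Proof.
have [K [K1 L1 L2 _]] := velocity_bounded.
have K0 : 0 < K by lra.
have lin (A B p q c c' y y' : R) :
    A + y * - (c * p) = B + y' * - (c' * q) -> A - B = y * c * p - y' * c' * q by lra.
have lin' (A B p q c c' y y' : R) :
    A + y * (c * p) = B + y' * (c' * q) -> A - B = y' * c' * q - y * c * p by lra.
have small (d e : R) : 0 <= d -> 8 * e * K < 1 -> d * (1 / 2) <= 2 * e * 1 * (2 * (K * d)) -> d <= 0.
  move=> d0 eK H; have : d * (1 / 2 - 4 * e * K) <= 0 by lra.
  by rewrite pmulr_lle0//; lra.
exists (1 / (16 * K)), (Num.min (1 / 2000) (1 / (2 * K))); split.
- by rewrite divr_gt0 ?mulr_gt0.
- by rewrite lt_min; apply/andP; split; [lra|rewrite divr_gt0 ?mulr_gt0].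
move=> eps s t p q /andP[e0 e1] dp dq; rewrite le_min => /andP[st1 st2].
have eK : 8 * eps * K < 1 by move: e1; rewrite ltr_pdivlMr ?mulr_gt0//; lra.
have stK : K * `|s - t| <= 1 / 2 by move: st2; rewrite ler_pdivlMr ?mulr_gt0//; lra.
move=> /pair_equal_spec[e _].
have /andP[_ r2] := radius_bounds s e0; have r0 := radius_gt0 s e0.
have [p1 _] := disc_le1 dp.
have y2 : `|radius eps s * p.1| <= 2 * eps.
  by rewrite normrM (gtr0_norm r0) -[2 * eps]mulr1 ler_pM// ltW.
have [c /andP[c0 c1] nE] := normalE s; have [c' _ nE'] := normalE t.
move: e; rewrite nE nE'; move: (radius eps s * p.1) y2 (radius eps t * q.1) => y y2 y'.
rewrite /liss !pairZ !pairD => -[h1 h2].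
have [x1 x1t E1] := mean_value s t (@is_derive_liss1 R).
have [x2 x2t E2] := mean_value s t (@is_derive_liss2 R).
have B1 : `|(velocity x1).1 - (velocity t).1| <= 1 / 2.
  by apply: le_trans (L1 _ _) _; apply: le_trans stK; rewrite ler_wpM2l// ltW.
have B2 : `|(velocity x2).2 - (velocity t).2| <= 1 / 2.
  by apply: le_trans (L2 _ _) _; apply: le_trans stK; rewrite ler_wpM2l// ltW.
have D1 := L1 s t; have D2 := L2 s t.
have main : (s - t) * ((velocity x1).1 * (velocity t).1 + (velocity x2).2 * (velocity t).2) =
    y * c * ((velocity s).2 * (velocity t).1 - (velocity s).1 * (velocity t).2).
  rewrite mulrDr !mulrA ![(s - t) * _]mulrC.
  rewrite -[(velocity x1).1 * (s - t)]/(slope (4 * x1) * (s - t)) -E1.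
  rewrite -[(velocity x2).2 * (s - t)]/(slope (phase x2) * (s - t)) -E2.
  by rewrite (lin _ _ _ _ _ _ _ _ h1) (lin' _ _ _ _ _ _ _ _ h2) /=; ring.
have low : 1 / 2 <= (velocity x1).1 * (velocity t).1 + (velocity x2).2 * (velocity t).2.
  by apply: velocity_dot_ge B1 B2; [exact: le_trans st1|exact: le_trans st1].
have up : `|(velocity s).2 * (velocity t).1 - (velocity s).1 * (velocity t).2| <= 2 * (K * `|s - t|).
  have -> : (velocity s).2 * (velocity t).1 - (velocity s).1 * (velocity t).2 =
    ((velocity s).1 - (velocity t).1) * - (velocity t).2 + ((velocity s).2 - (velocity t).2) * (velocity t).1 by ring.
  apply: le_trans (ler_normD _ _) _; rewrite !normrM normrN mulr2n mulrDl mul1r.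
  by apply: lerD; rewrite -[leRHS]mulr1; apply: ler_pM => //; exact: slope_norm.
have : `|s - t| * (1 / 2) <= 2 * eps * 1 * (2 * (K * `|s - t|)).
  apply: (@le_trans _ _ (`|y * c * ((velocity s).2 * (velocity t).1 - (velocity s).1 * (velocity t).2)|)).
    by rewrite -main normrM ler_wpM2l// (le_trans low)// ler_norm.
  by rewrite !normrM (gtr0_norm c0); apply: ler_pM => //; rewrite ?mulr_ge0// ?(ltW c0)// ler_pM// ltW.
by move=> /(small _ _ (normr_ge0 _) eK); rewrite normr_le0 subr_eq0 => /eqP.
Qed.

(** The squared distance between two points of the core of the tube. *)
Definition gap (x : R * R) : R := ((liss x.1).1 - (liss x.2).1) ^+ 2 +
  ((liss x.1).2 - (liss x.2).2) ^+ 2 + (altitude x.1 - altitude x.2) ^+ 2.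

Lemma smooth_gap : smooth gap.
Proof.
have B (f : R -> R) : smooth f -> smooth (fun x : R * R => (f x.1 - f x.2) ^+ 2).
  move=> sf; have sB : smooth (fun x : R * R => f x.1 - f x.2).
    by apply: smoothB; [exact: smooth_comp sf (@smooth_fst _ _ _)|exact: smooth_comp sf (@smooth_snd _ _ _)].
  exact: (smoothM sB sB).
apply: smoothD; [apply: smoothD|exact: B (@smooth_altitude R)].
  exact: B (smooth_comp_fst (@smooth_liss R)).
exact: B (smooth_comp_snd (@smooth_liss R)).
Qed.

Lemma tube_gap eps s t p q : 0 < eps -> disc p -> disc q -> tube eps s p = tube eps t q ->
  gap (s, t) <= 48 * eps ^+ 2.
Proof.
move=> e0 dp dq /pair_equal_spec[h1 h2].
have n1 (u : R) : `|(normal u).1| <= 1 /\ `|(normal u).2| <= 1.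
  by apply: disc_le1; rewrite /disc /= normal_unit.
have rb u (x : R) : `|x| <= 1 -> `|radius eps u * x| <= 2 * eps.
  have /andP[_ r2] := radius_bounds u e0; have r0 := radius_gt0 u e0.
  by move=> x1; rewrite normrM (gtr0_norm r0) -[2 * eps]mulr1 ler_pM// ltW.
have rb2 u (x y : R) : `|x| <= 1 -> `|y| <= 1 -> `|radius eps u * x * y| <= 2 * eps.
  by move=> x1 y1; rewrite -mulrA rb// normrM -[1]mulr1 ler_pM.
have [p1 p2] := disc_le1 dp; have [q1 q2] := disc_le1 dq.
have [ns1 ns2] := n1 s; have [nt1 nt2] := n1 t.
have P u v (x y : R) : (u + x = v + y) -> `|x| <= 2 * eps -> `|y| <= 2 * eps -> (u - v) ^+ 2 <= (4 * eps) ^+ 2.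
  move=> e x2 y2; apply: sqr_le_norm; rewrite (_ : u - v = y - x); last by lra.
  by apply: le_trans (ler_normB _ _) _; lra.
have G1 := P _ _ _ _ (congr1 fst h1) (rb2 _ _ _ p1 ns1) (rb2 _ _ _ q1 nt1).
have G2 := P _ _ _ _ (congr1 snd h1) (rb2 _ _ _ p1 ns2) (rb2 _ _ _ q1 nt2).
have G3 := P _ _ _ _ h2 (rb _ _ p2) (rb _ _ q2).
by rewrite /gap -[(s, t).1]/s -[(s, t).2]/t; lra.
Qed.

Definition pass s t : Prop :=
  exists o u, [/\ over (chiral_diagram R) o u, `|s - o| <= window R & `|t - u| <= window R].

Lemma pass_near o u : over (chiral_diagram R) o u -> \forall x \near (o, u), pass x.1 x.2.
Proof.
have w0 : 0 < window R by rewrite /window; lra.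
move=> ou; exists (ball o (window R), ball u (window R)); first by split; exact: nbhsx_ballx.
move=> [s t] /= [so tu]; exists o, u; split=> //; rewrite distrC; exact: ltW.
Qed.

(** Compactness of the torus of pairs of parameters reduces the claim to a
   neighbourhood of each pair.  Where the two points of the core differ, thin
   tubes are disjoint; on the diagonal [tube_local] applies; a welded crossing is
   not a double point of the core, thanks to the altitude; and near a classical
   crossing meeting is allowed. *)
Lemma tube_disjoint : \forall eps \near (0 : R)^'+, forall s t p q, disc p -> disc q ->
  tube eps s p = tube eps t q -> [\/ cong1 s t, pass s t | pass t s].
Proof.
pose P eps (x : R * R) := forall p q, disc p -> disc q ->
  tube eps x.1 p = tube eps x.2 q -> [\/ cong1 x.1 x.2, pass x.1 x.2 | pass x.2 x.1].
have cov : \forall eps \near (0 : R)^'+, `[0, 1] `*` `[0, 1] `<=` P eps.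
  have cK : compact (`[(0 : R), 1] `*` `[(0 : R), 1]).
    by apply: compact_setX; exact: segment_compact.
  suff cover (s t : R) : \forall x' \near (s, t) & i \near (0 : R)^'+, P i x'.
    by apply: (compact_near_coveringP _).1 cK _ _ _ _ _ => -[s t] _; exact: cover.
  have [gst|gst] := eqVneq (gap (s, t)) 0; last first.
    have g0 : 0 < gap (s, t).
      by rewrite lt_neqAle eq_sym gst /gap !addr_ge0 ?sqr_ge0.
    pose d := Num.min 1 (gap (s, t) / 96).
    have d0 : 0 < d by rewrite lt_min ltr01 divr_gt0.
    exists ([set x | gap (s, t) / 2 < gap x], [set eps : R | 0 < eps < d]).
      split; last first.
        near=> eps; rewrite /=; apply/andP; split; first by near: eps; exact: nbhs_right_gt.
        by near: eps; exact: nbhs_right_lt.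
      have nG : nbhs (gap (s, t)) [set y | gap (s, t) / 2 < y].
        apply: open_nbhs_nbhs; split; first exact: open_gt.
        by rewrite /=; lra.
      exact: (smooth_continuous smooth_gap nG).
    move=> [[s' t'] eps] [/= gx /andP[e0]]; rewrite lt_min => /andP[ee1 ed] p q dp dq.
    move=> /(tube_gap e0 dp dq) /= H; exfalso; move: gx; apply/negP; rewrite -leNgt.
    apply: le_trans H _; rewrite expr2.
    have : eps * eps <= 1 * (gap (s, t) / 96) by apply: ler_pM; rewrite ltW.
    by lra.
  have [e1 [eta [e10 eta0 loc]]] := tube_local.
  have [ls lz] : liss s = liss t /\ altitude s = altitude t.
    move/eqP: gst; rewrite /gap /= paddr_eq0 ?addr_ge0 ?sqr_ge0// paddr_eq0 ?sqr_ge0//.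
    rewrite !sqrf_eq0 !subr_eq0 => /andP[/andP[/eqP a /eqP b] /eqP c]; split=> //.
    by rewrite /liss a b.
  have [/cong1P[n st]|st] := boolP (cong1 s t).
    exists ([set x : R * R | `|x.1 - x.2 - n%:~R| < eta], [set eps : R | 0 < eps < e1]).
      split; last first.
        near=> eps; rewrite /=; apply/andP; split; first by near: eps; exact: nbhs_right_gt.
        by near: eps; exact: nbhs_right_lt.
      have sN : smooth (fun x : R * R => x.1 - x.2 - n%:~R).
        by apply: smoothB; [apply: smoothB; [exact: smooth_fst|exact: smooth_snd]|exact: smooth_cst].
      have cN : continuous (fun x : R * R => `|x.1 - x.2 - n%:~R|).
        move=> x; apply: (@continuous_comp _ _ _ (fun x : R * R => x.1 - x.2 - n%:~R) (fun y : R => `|y|) x).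
          exact: smooth_continuous sN x.
        exact: norm_continuous.
      apply: (cN (s, t) [set y | y < eta]); apply: open_nbhs_nbhs; split; first exact: open_lt.
      by rewrite /= st addrAC addrK subrr normr0.
    move=> [[s' t'] eps] [/= gx eI] p q dp dq e; apply: Or31.
    have cs' : cong1 s' (s' - n%:~R) by apply/cong1P; exists n; rewrite subrK.
    rewrite /= (tube_periodic _ _ cs') in e.
    have h : `|s' - n%:~R - t'| <= eta by rewrite addrAC ltW.
    by rewrite -(loc _ _ _ _ _ eI dp dq h e).
  have cr : crossing (@liss R) s t by split.
  have [ov|nov] := pselect (over (chiral_diagram R) s t).
    exists ([set x | pass x.1 x.2], setT); first by split; [exact: pass_near|exact: filterT].
    by move=> [x eps] [/= px _] p q _ _ _; exact: Or32.
  have [ov|nov'] := pselect (over (chiral_diagram R) t s).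
    exists ([set x | pass x.2 x.1], setT).
      split; last exact: filterT.
      have [[A B] /= [nA nB] AB] := pass_near ov.
      by exists (B, A); [split|move=> [x y] /= [Bx Ay]; apply: (AB (y, x)); split].
    by move=> [x eps] [/= px _] p q _ _ _; exact: Or33.
  exfalso; have [a [b [ab sa tb]]] := (liss_crossing s t).1 cr.
  have : a \notin under_params ++ over_params.
    rewrite mem_cat negb_or; apply/andP; split; apply/negP => /(nthP 0%N)[i i9 ai].
      apply: nov'; exists i; split=> //; last by rewrite /under_at ai.
      have ob := double_point_sym (double_point_at (i9 : (i < 9)%N)).
      have ob' : double_point a (over_at i) by rewrite -ai; exact: ob.
      by rewrite -(double_point_fun ab ob').
    apply: nov; exists i; split=> //; first by rewrite /over_at ai.
    have ob := double_point_at (i9 : (i < 9)%N).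
    have ob' : double_point a (under_at i) by rewrite -ai; exact: ob.
    by rewrite -(double_point_fun ab ob').
  move=> /(altitude_welded R ab) /eqP; apply.
  by rewrite -(altitude_periodic sa) -(altitude_periodic tb).
apply: filterS cov => eps H s t p q dp dq e.
pose f x := x - (Num.floor x)%:~R : R.
have fI x : [set` `[(0 : R), 1]] (f x).
  have f0 : 0 <= f x by rewrite subr_ge0 floor_le.
  have f1 : f x <= 1 by have := floorD1_gt x; rewrite intrD /f => ?; lra.
  by rewrite /= in_itv /= f0.
have fc x : cong1 x (f x) by apply/cong1P; exists (Num.floor x); rewrite subrK.
have pf x y : pass (f x) (f y) -> pass x y.
  move=> [ o [u [ou xo yu]]]; exists (o + (Num.floor x)%:~R), (u + (Num.floor y)%:~R); split.
  - by apply: over_periodic ou; rewrite cong1_sym cong1DZ.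
  - by rewrite (_ : x - _ = f x - o)//; rewrite /f; ring.
  - by rewrite (_ : y - _ = f y - u)//; rewrite /f; ring.
rewrite (tube_periodic _ _ (fc s)) (tube_periodic _ _ (fc t)) in e.
have [|h|h|h] := H (f s, f t) _ p q dp dq e.
- by split; exact: fI.
- by apply: Or31; apply: cong1_trans (fc s) (cong1_trans h _); rewrite cong1_sym.
- by apply: Or32; exact: pf.
- by apply: Or33; exact: pf.
Unshelve. all: by end_near. Qed.

Lemma windows_apart s s' t t' : crossing (chiral_diagram R) s s' -> crossing (chiral_diagram R) t t' ->
  s != t -> 2 * window R < `|s - t|.
Proof.
move=> /crossing_grid[k ->] /crossing_grid[l ->] st.
have kl : k != l by apply: contraNneq st => ->.
by have := grid_dist R kl; rewrite /window; lra.
Qed.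

Lemma chiral_tube_data eps : 0 < eps -> 2 * eps < window R ->
  (forall s t p q, disc p -> disc q -> tube eps s p = tube eps t q ->
     [\/ cong1 s t, pass s t | pass t s]) ->
  tube_data (chiral_diagram R) (radius eps) (@altitude R) (@height R).
Proof.
move=> e0 ew dis; split.
- by split; [exact: smooth_radius|split; [exact: smooth_altitude|exact: smooth_height]].
- by split; [exact: radius_periodic|split; [exact: altitude_periodic|exact: height_periodic]].
- by move=> s; exact: radius_gt0.
exists (window R); first by rewrite /window; lra.
split.
- exact: windows_apart.
- by move=> s t p q dp dq; rewrite !tubeE => /(dis _ _ _ _ dp dq).
- exact: height_away.
move=> o u /classical_chart[b [g [[b1 b2 g2] H]]].
exact: liss_tube_crossing b1 b2 g2 H _ e0 ew.
Qed.

End Bounds.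

(** * Stereographic projection *)

Section Stereographic.
Variable R : realType.
Implicit Types x : 'rV[R]_4.

Lemma dot_ge0 n (x : 'rV[R]_n) : 0 <= dot x x.
Proof. by apply: sumr_ge0 => i _; rewrite -expr2 sqr_ge0. Qed.

Lemma dot1_gt0 n (x : 'rV[R]_n) : 0 < dot x x + 1.
Proof. by rewrite ltr_wpDl ?dot_ge0. Qed.

Lemma dot_split (y w : 'rV[R]_(4 + 1)) : dot y w =
  dot (lsubmx y) (lsubmx w) + y ord0 (rshift 4 ord0) * w ord0 (rshift 4 ord0).
Proof.
rewrite /dot big_split_ord /= big_ord1; congr (_ + _).
by apply: eq_bigr => i _; rewrite !mxE.
Qed.

Lemma dotC n (x y : 'rV[R]_n) : dot x y = dot y x.
Proof. by apply: eq_bigr => i _; rewrite mulrC. Qed.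

Lemma dotDr n (x y z : 'rV[R]_n) : dot x (y + z) = dot x y + dot x z.
Proof. by rewrite /dot -big_split; apply: eq_bigr => i _; rewrite mxE mulrDr. Qed.

Lemma dotZr n a (x y : 'rV[R]_n) : dot x (a *: y) = a * dot x y.
Proof. by rewrite /dot mulr_sumr; apply: eq_bigr => i _; rewrite mxE mulrCA. Qed.

Lemma row5P (u w : 'rV[R]_(4 + 1)) :
  (forall j, u ord0 (lshift 1 j) = w ord0 (lshift 1 j)) ->
  (forall j, u ord0 (rshift 4 j) = w ord0 (rshift 4 j)) -> u = w.
Proof. by move=> ul ur; apply/rowP => i; have [j ->|j ->] := split_ordP i. Qed.

Lemma stereo_l x i : (stereo x : 'rV[R]_(4 + 1)) ord0 (lshift 1 i) = (dot x x + 1)^-1 * (2 * x ord0 i).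
Proof. by rewrite /stereo mxE row_mxEl mxE. Qed.

Lemma stereo_r x i : (stereo x : 'rV[R]_(4 + 1)) ord0 (rshift 4 i) = (dot x x + 1)^-1 * (dot x x - 1).
Proof. by rewrite /stereo mxE row_mxEr mxE. Qed.

Lemma stereo_lsub x : lsubmx (stereo x : 'rV[R]_(4 + 1)) = (2 * (dot x x + 1)^-1) *: x.
Proof. by apply/rowP => i; rewrite mxE stereo_l !mxE; ring. Qed.

Lemma stereo_sphere x : sphere4 (stereo x).
Proof.
rewrite /sphere4 /= (dot_split (stereo x) (stereo x)) stereo_lsub !stereo_r.
rewrite dotZr dotC dotZr; have := dot1_gt0 x; move: (dot x x) => n n0.
by field; rewrite gt_eqF.
Qed.

Lemma stereo_inj : injective (@stereo R).
Proof.
move=> x y e.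
have er := congr1 (fun u : 'rV[R]_(4 + 1) => u ord0 (rshift 4 ord0)) e.
have el := congr1 (fun u : 'rV[R]_(4 + 1) => lsubmx u) e.
rewrite /= !stereo_r in er; rewrite /= !stereo_lsub in el.
have x0 := dot1_gt0 x; have y0 := dot1_gt0 y.
have n0 : dot x x = dot y y.
  move: er x0 y0; move: (dot x x) (dot y y) => a b er a0 b0.
  have : (a + 1) * (b + 1) * ((a + 1)^-1 * (a - 1)) = (a + 1) * (b + 1) * ((b + 1)^-1 * (b - 1)) by rewrite er.
  rewrite (_ : _ * _ = (b + 1) * (a - 1)); last by field; rewrite gt_eqF.
  rewrite (_ : (a + 1) * _ * _ = (a + 1) * (b - 1)); last by field; rewrite gt_eqF.
  lra.
move: el; rewrite n0 => /scalerI; apply.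
by rewrite mulf_neq0// invr_neq0// gt_eqF.
Qed.

(** The differential of the inverse stereographic projection. *)
Definition dstereo x (xi : 'rV[R]_4) : 'rV[R]_5 :=
  (row_mx ((2 / (dot x x + 1)) *: xi - (4 * dot x xi / (dot x x + 1) ^+ 2) *: x)
    (const_mx (4 * dot x xi / (dot x x + 1) ^+ 2) : 'rV[R]_1) : 'rV[R]_(4 + 1)).

Lemma dstereo_l x xi i : (dstereo x xi : 'rV[R]_(4 + 1)) ord0 (lshift 1 i) =
  2 / (dot x x + 1) * xi ord0 i - 4 * dot x xi / (dot x x + 1) ^+ 2 * x ord0 i.
Proof. by rewrite /dstereo row_mxEl !mxE. Qed.

Lemma dstereo_r x xi i : (dstereo x xi : 'rV[R]_(4 + 1)) ord0 (rshift 4 i) =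
  4 * dot x xi / (dot x x + 1) ^+ 2.
Proof. by rewrite /dstereo row_mxEr mxE. Qed.

Lemma dstereo0 x xi : dstereo x xi = 0 -> xi = 0.
Proof.
move=> e; have n0 := dot1_gt0 x.
have er := congr1 (fun u : 'rV[R]_(4 + 1) => u ord0 (rshift 4 ord0)) e.
have el := congr1 (fun u : 'rV[R]_(4 + 1) => lsubmx u) e.
rewrite /= row_mxEr !mxE in er; rewrite /= row_mxKl er scale0r subr0 in el.
have {}el : (2 / (dot x x + 1)) *: xi = 0 by rewrite el; apply/rowP => i; rewrite !mxE.
by move/eqP: el; rewrite scaler_eq0 mulf_eq0 invr_eq0 (gt_eqF n0) pnatr_eq0 => /eqP.
Qed.

Lemma dstereoD x a b : dstereo x (a + b) = dstereo x a + dstereo x b.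
Proof.
apply: row5P => j; rewrite [in RHS]mxE.
  by rewrite !dstereo_l dotDr !mxE; ring.
by rewrite !dstereo_r dotDr; ring.
Qed.

(** The differential is onto the tangent space of the sphere, by an explicit
   preimage. *)
Lemma dstereo_tangent x w : dot w (stereo x) = 0 -> exists xi, w = dstereo x xi.
Proof.
move=> wx; pose w' := lsubmx (w : 'rV[R]_(4 + 1)); pose w5 := (w : 'rV[R]_(4 + 1)) ord0 (rshift 4 ord0).
have n0 := dot1_gt0 x.
have xw : dot x w' = - w5 * (dot x x - 1) / 2.
  have : (dot x x + 1) * (dot w' ((2 * (dot x x + 1)^-1) *: x) + w5 * ((dot x x + 1)^-1 * (dot x x - 1))) = 0.
    by rewrite -stereo_lsub -(stereo_r x ord0) -dot_split wx mulr0.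
  rewrite dotZr (dotC w') (_ : _ * _ = 2 * dot x w' + w5 * (dot x x - 1)); first by lra.
  by field; rewrite gt_eqF.
exists (((dot x x + 1) / 2) *: (w' + w5 *: x)).
have dE : 4 * dot x (((dot x x + 1) / 2) *: (w' + w5 *: x)) / (dot x x + 1) ^+ 2 = w5.
  by rewrite dotZr dotDr dotZr xw; field; rewrite gt_eqF.
apply: row5P => j; last by rewrite dstereo_r dE (ord1 j).
rewrite dstereo_l dE (_ : (w : 'rV[R]_(4 + 1)) ord0 (lshift 1 j) = w' ord0 j); last by rewrite mxE.
by rewrite !mxE; field; rewrite gt_eqF.
Qed.

End Stereographic.

Section Maps.
Variable R : realType.
Variable V : normedModType R.

Lemma is_derive_mx n (f : V -> 'rV[R]_n) x v (df : 'rV[R]_n) :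
  (forall i, is_derive x v (fun y => f y ord0 i) (df ord0 i)) -> is_derive x v f df.
Proof.
move=> H; have D : derivable f x v.
  by apply/derivable_mxP => i j; rewrite (ord1 i); have [] := H j.
split=> //; apply/rowP => i; rewrite derive_mx// mxE.
by have [_ ->] := H i.
Qed.

Lemma is_derive_bigsum (I : Type) (l : seq I) (f : I -> V -> R) x v (df : I -> R) :
  (forall i, is_derive x v (f i) (df i)) ->
  is_derive x v (fun y => \sum_(i <- l) f i y) (\sum_(i <- l) df i).
Proof.
move=> D; elim: l => [|i l IH].
  rewrite big_nil (_ : (fun y => _) = cst 0); first exact: is_derive_cst.
  by apply/funext => y; rewrite big_nil.
rewrite big_cons (_ : (fun y => _) = f i + fun y => \sum_(i <- l) f i y); first exact: is_deriveD.
by apply/funext => y; rewrite big_cons.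
Qed.

Lemma is_derive_dot (f : V -> 'rV[R]_4) x v df : is_derive x v f df ->
  is_derive x v (fun y => dot (f y) (f y)) (2 * dot (f x) df).
Proof.
move=> D; have Di i : is_derive x v (fun y => f y ord0 i) (df ord0 i).
  have [d dE] := D; split.
    by have /derivable_mxP/(_ ord0 i) := d.
  by rewrite -dE derive_mx// mxE.
have := is_derive_bigsum (index_enum 'I_4) (fun i => is_deriveM (Di i) (Di i)).
move/is_derive_eq; apply; rewrite /dot.
rewrite mulr_sumr; apply: eq_bigr => i _; rewrite -![_ *: _]/(_ * _); ring.
Qed.

Lemma is_derive_inv (f : V -> R) x v df : f x != 0 -> is_derive x v f df ->
  is_derive x v (fun y => (f y)^-1) (- df / f x ^+ 2).
Proof.
move=> f0 D; have Vf := is_deriveV f0 (is_derive_id (f x) (1 : R)).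
have := is_derive_chain D (@is_deriveV R id (f x) 1 1 f0 (is_derive_id (f x) (1 : R))).
move/is_derive_eq; apply; rewrite -![_ *: _]/(_ * _); ring.
Qed.

Lemma is_derive_stereo (f : V -> 'rV[R]_4) x v df : is_derive x v f df ->
  is_derive x v (fun y => stereo (f y)) (dstereo (f x) df).
Proof.
move=> D; have n0 := dot1_gt0 (f x); have nn : dot (f x) (f x) + 1 != 0 by rewrite gt_eqF.
have Di i : is_derive x v (fun y => f y ord0 i) (df ord0 i).
  have [d dE] := D; split.
    by have /derivable_mxP/(_ ord0 i) := d.
  by rewrite -dE derive_mx// mxE.
have Dd := is_derive_dot D.
have Dn : is_derive x v (fun y => dot (f y) (f y) + 1) (2 * dot (f x) df).
  by apply: is_derive_eq; rewrite addr0.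
have DV := is_derive_inv nn Dn.
apply: is_derive_mx => i; have [j ->|j ->] := @split_ordP 4 1 i.
  rewrite (_ : (fun y => _) = (fun y => (dot (f y) (f y) + 1)^-1 * (2 * f y ord0 j))); last first.
    by apply/funext => y; rewrite stereo_l.
  have := is_deriveM DV (is_deriveM (is_derive_cst (2 : R) x v) (Di j)).
  move/is_derive_eq; apply; rewrite dstereo_l -![_ *: _]/(_ * _) -[(_ * (fun y : V => f y ord0 j)) x]/(2 * f x ord0 j).
  by field.
rewrite (_ : (fun y => _) = (fun y => (dot (f y) (f y) + 1)^-1 * (dot (f y) (f y) - 1))); last first.
  by apply/funext => y; rewrite stereo_r.
have := is_deriveM DV (is_deriveB Dd (is_derive_cst (1 : R) x v)).
move/is_derive_eq; apply; rewrite dstereo_r -![_ *: _]/(_ * _) -[(_ - cst (1 : R)) x]/(dot (f x) (f x) - 1).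
by field.
Qed.

Lemma smooth_stereo (f : V -> 'rV[R]_4) : (forall i, smooth (fun x => f x ord0 i)) ->
  smooth (fun x => stereo (f x)).
Proof.
move=> sf; have sd : smooth (fun x => dot (f x) (f x)).
  by apply: smooth_sum => i; apply: smoothM.
have sn : smooth (fun x => (dot (f x) (f x) + 1)^-1).
  apply: smoothV; first by move=> x; rewrite gt_eqF// dot1_gt0.
  by apply: smoothD => //; exact: smooth_cst.
apply: smooth_mx => i; have [j ->|j ->] := @split_ordP 4 1 i.
  rewrite (_ : (fun y => _) = (fun y => (dot (f y) (f y) + 1)^-1 * (2 * f y ord0 j))).
    by apply: smoothM => //; apply: smoothM; [exact: smooth_cst|exact: sf].
  by apply/funext => y; rewrite stereo_l.
rewrite (_ : (fun y => _) = (fun y => (dot (f y) (f y) + 1)^-1 * (dot (f y) (f y) - 1))).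
  by apply: smoothM => //; apply: smoothB => //; exact: smooth_cst.
by apply/funext => y; rewrite stereo_r.
Qed.

End Maps.

(** * The tube in four-space *)

Section Tube4.
Variable R : realType.
Implicit Types (s t eps : R) (p q : R * R).

(** The unit normal is smooth since the speed is at least 1. *)
Definition speed_inv s : R := (Num.sqrt (normsq (velocity s)))^-1.

Lemma smooth_speed_inv : smooth speed_inv.
Proof.
have pos s : 0 < normsq (velocity s) by apply: lt_le_trans (velocity_normsq s).
have sv := @smooth_velocity R.
apply: smoothV; first by move=> s; rewrite gt_eqF// sqrtr_gt0.
apply: smooth_sqrt => //; apply: smoothD.
  by rewrite (_ : (fun x => _) = fun x => (velocity x).1 * (velocity x).1) //; apply: smoothM; exact: smooth_comp_fst.
by rewrite (_ : (fun x => _) = fun x => (velocity x).2 * (velocity x).2) //; apply: smoothM; exact: smooth_comp_snd.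
Qed.

Definition normal1 s : R := speed_inv s * - (velocity s).2.
Definition normal2 s : R := speed_inv s * (velocity s).1.

Lemma normal12 s : normal s = (normal1 s, normal2 s).
Proof. by rewrite /normal /perp pairZ. Qed.

Lemma smooth_normal1 : smooth normal1.
Proof. by apply: smoothM smooth_speed_inv _; apply/smoothN/smooth_comp_snd/smooth_velocity. Qed.

Lemma smooth_normal2 : smooth normal2.
Proof. by apply: smoothM smooth_speed_inv _; apply/smooth_comp_fst/smooth_velocity. Qed.

Definition row4 (a b c d : R) : 'rV[R]_4 := \row_i [:: a; b; c; d]`_i.

Lemma row4E a b c d (i : 'I_4) : row4 a b c d ord0 i = [:: a; b; c; d]`_i.
Proof. by rewrite mxE. Qed.

Lemma row4_inj a b c d a' b' c' d' : row4 a b c d = row4 a' b' c' d' ->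
  [/\ a = a', b = b', c = c' & d = d'].
Proof.
move=> e; have E k (k4 : (k < 4)%N) : [:: a; b; c; d]`_k = [:: a'; b'; c'; d']`_k.
  by have := congr1 (fun u : 'rV[R]_4 => u ord0 (Ordinal k4)) e; rewrite !row4E.
by split; [exact: (E 0%N)|exact: (E 1%N)|exact: (E 2%N)|exact: (E 3%N)].
Qed.

Lemma row4D a b c d a' b' c' d' :
  row4 a b c d + row4 a' b' c' d' = row4 (a + a') (b + b') (c + c') (d + d').
Proof. by apply/rowP => i; rewrite mxE !row4E; case: i => -[|[|[|[|]]]]. Qed.

Definition tube4 eps s p : 'rV[R]_4 :=
  row4 (tube eps s p).1.1 (tube eps s p).1.2 (tube eps s p).2 (height s).

Lemma tube4E eps s p : tube4 eps s p =
  row4 ((liss s).1 + radius eps s * p.1 * normal1 s) ((liss s).2 + radius eps s * p.1 * normal2 s)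
       (altitude s + radius eps s * p.2) (height s).
Proof. by rewrite /tube4 /tube normal12. Qed.

Lemma tube4_eq eps s t p q : tube4 eps s p = tube4 eps t q <->
  tube eps s p = tube eps t q /\ height s = height t.
Proof.
split=> [/row4_inj[e1 e2 e3 e4]|[e1 e2]]; last by rewrite /tube4 e1 e2.
split=> //; move: e1 e2 e3; case: (tube eps s p) => -[a b] c; case: (tube eps t q) => -[a' b'] c' /=.
by move=> -> -> ->.
Qed.

Lemma tube4_periodic eps s t p : cong1 s t -> tube4 eps s p = tube4 eps t p.
Proof. by move=> st; apply/tube4_eq; rewrite (tube_periodic _ _ st) (height_periodic st). Qed.

(** The derivative of the solid tube in direction [(a, q)]. *)
Definition dtube4 eps s p (a : R) q : 'rV[R]_4 :=
  let r := radius eps s in let dr := a * 'D_1 (radius eps) s in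
  row4 (a * (velocity s).1 + ((dr * p.1 + r * q.1) * normal1 s + r * p.1 * (a * 'D_1 normal1 s)))
       (a * (velocity s).2 + ((dr * p.1 + r * q.1) * normal2 s + r * p.1 * (a * 'D_1 normal2 s)))
       (a * 'D_1 (@altitude R) s + (dr * p.2 + r * q.2))
       (a * 'D_1 (@height R) s).

Section Chain.
Variables (V : normedModType R) (f g1 g2 : V -> R).

Lemma smooth_tube4 eps : smooth f -> smooth g1 -> smooth g2 ->
  smooth (fun x => stereo (tube4 eps (f x) (g1 x, g2 x))).
Proof.
move=> sf sg1 sg2; apply: smooth_stereo => i.
have sr := smooth_comp (@smooth_radius R eps) sf.
have -> : (fun x => tube4 eps (f x) (g1 x, g2 x) ord0 i) = fun x =>
    [:: (liss (f x)).1 + radius eps (f x) * g1 x * normal1 (f x);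
        (liss (f x)).2 + radius eps (f x) * g1 x * normal2 (f x);
        altitude (f x) + radius eps (f x) * g2 x; height (f x)]`_i.
  by apply/funext => x; rewrite tube4E row4E.
case: i => -[|[|[|[|//]]]] i4 /=.
- apply: smoothD; first exact: smooth_comp (smooth_comp_fst (@smooth_liss R)) sf.
  by apply: smoothM; [exact: smoothM|exact: smooth_comp smooth_normal1 sf].
- apply: smoothD; first exact: smooth_comp (smooth_comp_snd (@smooth_liss R)) sf.
  by apply: smoothM; [exact: smoothM|exact: smooth_comp smooth_normal2 sf].
- by apply: smoothD; [exact: smooth_comp (@smooth_altitude R) sf|exact: smoothM].
- exact: smooth_comp (@smooth_height R) sf.
Qed.

Lemma is_derive_smooth (h : R -> R) x w (a : R) : smooth h -> is_derive x w f a ->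
  is_derive x w (fun y => h (f y)) (a * 'D_1 h (f x)).
Proof.
move=> sh Df; have Dh : is_derive (f x) (1 : R) h ('D_1 h (f x)).
  by split; [exact: smooth_derivable|reflexivity].
exact: is_derive_chain Df Dh.
Qed.

Lemma is_derive_tube4 eps x w a b1 b2 : is_derive x w f a -> is_derive x w g1 b1 ->
  is_derive x w g2 b2 ->
  is_derive x w (fun y => tube4 eps (f y) (g1 y, g2 y)) (dtube4 eps (f x) (g1 x, g2 x) a (b1, b2)).
Proof.
move=> Df D1 D2; apply: is_derive_mx => i.
have Dr := is_derive_smooth (@smooth_radius R eps) Df.
have Dn1 := is_derive_smooth smooth_normal1 Df.
have Dn2 := is_derive_smooth smooth_normal2 Df.
have Dz := is_derive_smooth (@smooth_altitude R) Df.
have Dh := is_derive_smooth (@smooth_height R) Df.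
have L1 : is_derive x w (fun y => (liss (f y)).1) (a * (velocity (f x)).1).
  exact: is_derive_chain Df (is_derive_liss1 (f x)).
have L2 : is_derive x w (fun y => (liss (f y)).2) (a * (velocity (f x)).2).
  exact: is_derive_chain Df (is_derive_liss2 (f x)).
have -> : (fun y => tube4 eps (f y) (g1 y, g2 y) ord0 i) = fun y =>
    [:: (liss (f y)).1 + radius eps (f y) * g1 y * normal1 (f y);
        (liss (f y)).2 + radius eps (f y) * g1 y * normal2 (f y);
        altitude (f y) + radius eps (f y) * g2 y; height (f y)]`_i.
  by apply/funext => y; rewrite tube4E row4E.
rewrite /dtube4 row4E; case: i => -[|[|[|[|//]]]] i4 /=.
- move: (is_deriveD L1 (is_deriveM (is_deriveM Dr D1) Dn1)) => /is_derive_eq; apply.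
  rewrite -![_ *: _]/(_ * _) -[(_ * _) x]/(radius eps (f x) * g1 x) /velocity /=; ring.
- move: (is_deriveD L2 (is_deriveM (is_deriveM Dr D1) Dn2)) => /is_derive_eq; apply.
  rewrite -![_ *: _]/(_ * _) -[(_ * _) x]/(radius eps (f x) * g1 x) /velocity /=; ring.
- move: (is_deriveD Dz (is_deriveM Dr D2)) => /is_derive_eq; apply.
  rewrite -![_ *: _]/(_ * _); ring.
- exact: Dh.
Qed.

End Chain.

(** The radius of the tube, at most [2 * eps], is less than the radius of
   curvature. *)
Definition curvature_bound eps := forall s, exists2 d : R * R,
  is_derive s (1 : R) (@velocity R) d & 2 * eps * (`|d.1| + `|d.2|) < 1.

(** The tube is immersed because its radius is less than the radius of curvature
   of the curve. *)
Lemma dtube4_inj eps s p a q : 0 < eps -> curvature_bound eps -> disc p ->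
  dtube4 eps s p a q = 0 -> a = 0 /\ q = 0.
Proof.
move=> e0 /(_ s)[d dv dsmall] dp.
have -> : (0 : 'rV[R]_4) = row4 0 0 0 0 by apply/rowP => -[[|[|[|[|//]]]] i4]; rewrite row4E mxE.
move=> /row4_inj[E1 E2 E3 _].
have r0 := radius_gt0 s e0; have /andP[_ r2] := radius_bounds s e0.
have [p1 _] := disc_le1 dp.
have v1 := velocity_normsq s.
have orth u : normal1 u * (velocity u).1 + normal2 u * (velocity u).2 = 0.
  by rewrite /normal1 /normal2; ring.
have dorth : 'D_1 normal1 s * (velocity s).1 + 'D_1 normal2 s * (velocity s).2 =
    - (normal1 s * d.1 + normal2 s * d.2).
  have Dv1 : is_derive s (1 : R) (fun u => (velocity u).1) d.1.
    apply: (is_derive_linear (L := fst) (f := @velocity R)) => //.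
    by move=> x; exact: cvg_fst.
  have Dv2 : is_derive s (1 : R) (fun u => (velocity u).2) d.2.
    apply: (is_derive_linear (L := snd) (f := @velocity R)) => //.
    by move=> x; exact: cvg_snd.
  have Dn1 := is_derive_smooth smooth_normal1 (is_derive_id s (1 : R)).
  have Dn2 := is_derive_smooth smooth_normal2 (is_derive_id s (1 : R)).
  have := is_deriveD (is_deriveM Dn1 Dv1) (is_deriveM Dn2 Dv2).
  rewrite (_ : _ + _ = cst 0); last by apply/funext => u; exact: orth.
  move=> -[_]; rewrite derive_cst -![_ *: _]/(_ * _); lra.
have n1 : `|normal1 s| <= 1 /\ `|normal2 s| <= 1.
  have := normal_unit s; rewrite normal12 => n1.
  by have := @disc_le1 R (normal1 s, normal2 s); apply; rewrite /disc /= n1.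
have main : a * (normsq (velocity s) - radius eps s * p.1 * (normal1 s * d.1 + normal2 s * d.2)) = 0.
  have := orth s; move: E1 E2 dorth; rewrite /normsq.
  move: (velocity s) (normal1 s) (normal2 s) ('D_1 normal1 s) ('D_1 normal2 s) (a * _ * _ + _) => [w1 w2] n1' n2' m1 m2 k /=.
  move=> E1 E2 Em Eo.
  have : (a * w1 + (k * n1' + radius eps s * p.1 * (a * m1))) * w1 +
         (a * w2 + (k * n2' + radius eps s * p.1 * (a * m2))) * w2 = 0 by rewrite E1 E2 !mul0r addr0.
  rewrite (_ : _ + _ = a * (w1 ^+ 2 + w2 ^+ 2) + k * (n1' * w1 + n2' * w2) +
     radius eps s * p.1 * a * (m1 * w1 + m2 * w2)); last by ring.
  by rewrite Em Eo mulr0 addr0 => <-; ring.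
have a0 : a = 0.
  move/eqP: main; rewrite mulf_eq0 => /orP[/eqP//|/eqP]; rewrite -/(normsq _) => H; exfalso.
  have : `|radius eps s * p.1 * (normal1 s * d.1 + normal2 s * d.2)| < 1.
    apply: le_lt_trans dsmall; rewrite normrM; apply: ler_pM => //.
      by rewrite normrM (gtr0_norm r0) -[2 * eps]mulr1 ler_pM// ltW.
    apply: le_trans (ler_normD _ _) _; rewrite (normrM (normal1 s)) (normrM (normal2 s)).
    by apply: lerD; rewrite -[leRHS]mul1r ler_wpM2r//; case: n1.
  rewrite ltr_norml => /andP[_]; lra.
split=> //; rewrite a0 !mul0r !add0r in E1 E2 E3.
have q2 : q.2 = 0.
  by move/eqP: E3; rewrite (mulf_eq0 (radius eps s)) (gt_eqF r0) /= => /eqP.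
have q1 : q.1 = 0.
  have := normal_unit s; rewrite normal12 /normsq /=.
  rewrite !mulr0 !addr0 in E1 E2.
  move/eqP: E1; rewrite (mulf_eq0 (radius eps s * q.1)) (mulf_eq0 (radius eps s)) (gt_eqF r0) /= => /orP[/eqP//|/eqP n10].
  move/eqP: E2; rewrite (mulf_eq0 (radius eps s * q.1)) (mulf_eq0 (radius eps s)) (gt_eqF r0) /= => /orP[/eqP//|/eqP n20].
  by rewrite n10 n20 expr0n /= addr0 => /eqP; rewrite eq_sym oner_eq0.
by rewrite [q]surjective_pairing q1 q2.
Qed.

Lemma is_derive_sn (v : R) : is_derive v (1 : R) (@sn R) (2 * pi * cs v).
Proof.
have d0 : is_derive v (1 : R) (fun v => 2 * pi * v) (2 * pi : R).
  by apply: is_derive_eq; rewrite -[_ *: _]/(_ * _) mulr1.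
have := @is_derive1_comp R sin (fun v => 2 * pi * v) v _ _ (is_derive_sin _) d0.
by move/is_derive_eq; apply; rewrite mulrC.
Qed.

Lemma is_derive_cs (v : R) : is_derive v (1 : R) (@cs R) (- (2 * pi * sn v)).
Proof.
have d0 : is_derive v (1 : R) (fun v => 2 * pi * v) (2 * pi : R).
  by apply: is_derive_eq; rewrite -[_ *: _]/(_ * _) mulr1.
have := @is_derive1_comp R cos (fun v => 2 * pi * v) v _ _ (is_derive_cos _) d0.
by move/is_derive_eq; apply; rewrite mulrC mulrN.
Qed.

(** The sign of a classical crossing: velocities at crossings are diagonals, with
   determinant 2 or -2. *)
Definition sgn (o u : R) : R := det2 (velocity o) (velocity u) / 2.

Lemma classical_chart_sgn o u : over (chiral_diagram R) o u -> exists b : R * R,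
  [/\ b.1 ^+ 2 = 1, b.2 ^+ 2 = 1 & sgn o u ^+ 2 = 1] /\ forall x, `|x| <= window R ->
  [/\ [/\ velocity (o + x) = b, liss (o + x) = liss o + x *: b,
          velocity (u + x) = sgn o u *: perp b & liss (u + x) = liss o + x *: (sgn o u *: perp b)],
      [/\ girth (o + x) = 2, girth (u + x) = 1, altitude (o + x) = 0 & altitude (u + x) = 0],
      height (o + x) = 0 & height (u + x) = - sgn o u * (sn x * bump (cs x - cs (window R)))].
Proof.
move=> /classical_chart[b [g [[b1 b2 g2] H]]]; exists b.
suff -> : sgn o u = g by [].
have w0 : `|0 : R| <= window R by rewrite normr0 /window; lra.
have [[Vo _ Vu _] _ _ _] := H 0 w0; rewrite !addr0 in Vo Vu.
rewrite /sgn Vo Vu /det2 /perp; case: b b1 b2 {H Vo Vu} => b1 b2 /= b12 b22.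
rewrite -![_ *: _]/(_ * _) (_ : _ - _ = g * (b1 ^+ 2 + b2 ^+ 2)); last by ring.
by rewrite b12 b22; field.
Qed.

Section Meeting.
Variables (eps o u : R).
Hypotheses (e0 : 0 < eps) (ew : 2 * eps < window R) (ou : over (chiral_diagram R) o u).

(** Within the windows the height of the under-strand vanishes at [u] only, so that
   equal heights leave just the disc of the thin tube at the crossing itself. *)
Lemma meeting s t p q : `|s - o| <= window R -> `|t - u| <= window R -> disc p -> disc q ->
  tube eps s q = tube eps t p -> height s = height t ->
  [/\ t = u, s = o - eps * p.1 * diag R * sgn o u, q.1 = 0 & 2 * q.2 = p.2].
Proof.
move=> so tu dp dq e hh; have [b [[b1 b2 g2] H]] := classical_chart_sgn ou.
have ep := e0; have ewp := ew; have d0 := diag_gt0 R; have d1 := diag_lt1 R.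
have split_at (c x : R) : x = c + (x - c) by rewrite addrC subrK.
have k0 : 0 < 2 * eps * diag R by rewrite !mulr_gt0.
have [q1 _] := disc_le1 dq.
move: e; rewrite {1}(split_at o s) {1}(split_at u t).
move=> /(tube_meet b1 b2 g2 H _ _ _ so tu)[e1 e2 e3].
have g1 : `|sgn o u| = 1 by apply/eqP; rewrite -(@eqrXn2 _ 2)// expr1n real_normK ?num_real// g2.
have tw : `|t - u| < window R.
  have -> : `|t - u| = `|2 * eps * diag R * q.1| by rewrite e2 normrM g1 mulr1.
  rewrite normrM (gtr0_norm k0); apply: le_lt_trans ewp.
  have h1 : 2 * eps * diag R <= 2 * eps by rewrite ger_pMr ?mulr_gt0// ltW.
  by apply: le_trans h1; rewrite ger_pMr.
have t0 : t - u = 0.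
  have [_ _ ho _] := H _ so; have [_ _ _ hu] := H _ tu.
  move: hh; rewrite {1}(split_at o s) {1}(split_at u t) ho hu => /esym/eqP.
  have w2 : window R <= 1 / 2 by rewrite /window; lra.
  have g0 : sgn o u != 0 by rewrite -normr_gt0 g1.
  rewrite !mulf_eq0 oppr_eq0 (negbTE g0) /= => /orP[/eqP s0|]; last first.
    by rewrite gt_eqF// bump_gt0 subr_gt0 cs_gt.
  have w1 : window R < 1 / 2 by rewrite /window; lra.
  have sp (x : R) : 0 < x -> x < window R -> 0 < sn x.
    by move=> x0 xw; apply: sn_gt0; apply/andP; split; lra.
  case: (ltgtP (t - u) 0) => // h.
    have /(sp _) : 0 < - (t - u) by lra.
    by rewrite snN s0 oppr0 ltxx => H'; have /H' : - (t - u) < window R by rewrite ltr0_norm in tw.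
  have wl : t - u < window R by rewrite gtr0_norm in tw.
  by have := sp _ h wl; rewrite s0 ltxx.
split.
- by apply/eqP; rewrite -subr_eq0 t0.
- by rewrite (split_at o s) e1.
- by move/eqP: e2; rewrite t0 mul0r mulf_eq0 gt_eqF //= => /eqP.
- have en : eps != 0 by rewrite gt_eqF.
  by apply: (mulfI en); rewrite -e3; ring.
Qed.

(** The disc of the thin tube at the under-crossing is, also in four-space, a
   part of the thick solid tube, where it is swept out parallel to the axis. *)
Lemma crossing_disc p : disc p ->
  `|- (eps * p.1 * diag R * sgn o u)| <= window R /\
  tube4 eps (o - eps * p.1 * diag R * sgn o u) (0, p.2 / 2) = tube4 eps u p.
Proof.
move=> dp; have [b [[b1 b2 g2] H]] := classical_chart_sgn ou.
have sw := shift_small g2 e0 ew dp; split=> //.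
have w0 : `|0 : R| <= window R by rewrite normr0 /window; lra.
apply/tube4_eq; split.
  rewrite -[X in _ = tube _ X _]addr0; apply/(tube_meet b1 b2 g2 H _ _ _ sw w0).
  by split; rewrite ?mulr0 ?mul0r//=; field.
have [_ _ -> _] := H _ sw; have [_ _ _] := H _ w0; rewrite addr0 => ->.
by rewrite /sn mulr0 sin0 mul0r mulr0.
Qed.

(** The two sheets of the solid torus are transverse at a double point because the
   height of the under-strand changes there and that of the over-strand does
   not. *)
Lemma height_slope : 'D_1 (@height R) u != 0.
Proof.
have [b [[b1 b2 g2] H]] := classical_chart_sgn ou.
pose k y := bump (cs y - cs (window R)).
have sk : smooth k.
  apply: (smooth_comp (@smooth_bump R)); apply: smoothB; last exact: smooth_cst.
  exact: smooth_cs.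
have Dsh : is_derive u (1 : R) (fun y => y - u) (1 : R).
  by apply: is_derive_eq; rewrite subr0.
have Dk0 : is_derive (u - u) (1 : R) k ('D_1 k (u - u)).
  by split; [exact: smooth_derivable|reflexivity].
have Dk := @is_derive1_comp R k (fun y => y - u) u _ _ Dk0 Dsh.
have Ds := @is_derive1_comp R (@sn R) (fun y => y - u) u _ _ (is_derive_sn (u - u)) Dsh.
have D := is_deriveM (is_derive_cst (- sgn o u) u (1 : R)) (is_deriveM Ds Dk).
have w0 : 0 < window R by rewrite /window; lra.
have Dh : is_derive u (1 : R) (@height R) (- sgn o u * (2 * pi * k 0)).
  apply: (@near_eq_is_derive R R R (fun y => - sgn o u * (sn (y - u) * k (y - u)))).
    near=> y; have yu : `|y - u| <= window R.
      have yb : ball u (window R) y by near: y; exact: nbhsx_ballx.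
      by rewrite distrC; exact: ltW.
    by have [_ _ _] := H _ yu; rewrite [u + _]addrC subrK => ->.
  move/is_derive_eq: D; apply; rewrite -![_ *: _]/(_ * _) /= subrr.
  by rewrite /sn mulr0 sin0 -/(cs 0) cs0; ring.
have [_ ->] := Dh.
have g0 : sgn o u != 0.
  by apply/eqP => g0; move: g2; rewrite g0 expr0n /= => /eqP; rewrite eq_sym oner_eq0.
rewrite mulf_neq0 ?oppr_eq0// gt_eqF// !mulr_gt0 ?pi_gt0//.
by rewrite bump_gt0 subr_gt0 cs_gt ?normr0// /window; lra.
Unshelve. all: by end_near. Qed.

End Meeting.

End Tube4.

(** * The torus and its ribbon solid torus *)

Section Ribbon.
Variables (R : realType) (eps : R).
Hypotheses (e0 : 0 < eps) (ew : 2 * eps < window R) (curv : curvature_bound eps).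
Hypothesis dis : forall s t p q, disc p -> disc q -> tube eps s p = tube eps t q ->
  [\/ cong1 s t, pass s t | pass t s].
Local Notation D := (chiral_diagram R).
Local Notation grid := (@grid R).
Implicit Types (s t o u : R) (p q : R * R).

(** Double points of the solid tube: the discs at the under-crossings, whose other
   preimages are in the interior of the thick tube by [2 * p.2 = q.2]. *)
Lemma tube4_meet s t p q : disc p -> disc q -> tube4 eps s p = tube4 eps t q ->
  [\/ cong1 s t /\ p = q,
      exists o u, [/\ over D o u, t = u, s = o - eps * q.1 * diag R * sgn o u, p.1 = 0 & 2 * p.2 = q.2] |
      exists o u, [/\ over D o u, s = u, t = o - eps * p.1 * diag R * sgn o u, q.1 = 0 & 2 * q.2 = p.2]].
Proof.
move=> dp dq /tube4_eq[e hh]; have [st|[ o [u [ou so tu]]]|[ o [u [ou so tu]]]] := dis dp dq e.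
- apply: Or31; split=> //; rewrite (tube_periodic eps p st) in e.
  exact: tube_fiber_inj e0 e.
- by apply: Or32; exists o, u; have [] := meeting e0 ew ou so tu dq dp e hh.
- by apply: Or33; exists o, u; have [] := meeting e0 ew ou so tu dp dq (esym e) (esym hh).
Qed.

Lemma meridian_circle (v : R) : circle (meridian v).
Proof. by rewrite /circle /= /normsq addrC cos2Dsin2. Qed.

Lemma circle_disc p : circle p -> disc p.
Proof. by rewrite /circle /disc /= => ->. Qed.

Lemma circle_meridian p : circle p -> exists v : R, p = meridian v.
Proof.
rewrite /circle /= /normsq; case: p => a b /= ab.
have b1 : -1 <= b <= 1.
  have /disc_le1[_ /=] : disc (a, b) by rewrite /disc /= /normsq /= ab.
  by rewrite ler_norml.
have pin : 2 * pi != 0 :> R by rewrite mulf_neq0// gt_eqF ?pi_gt0.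
have cb : cos (acos b) = b by rewrite acosK// in_itv.
have : sin (acos b) ^+ 2 = a ^+ 2.
  have := cos2Dsin2 (acos b); rewrite cb; lra.
move=> /eqP; rewrite eqf_sqr => /orP[]/eqP sa.
  exists (acos b / (2 * pi)); rewrite /meridian mulrC divfK//.
  by rewrite sa cb.
exists (- acos b / (2 * pi)); rewrite /meridian mulrC divfK//.
by rewrite sinN cosN sa cb opprK.
Qed.

Lemma meridian_inj (v w : R) : meridian v = meridian w -> cong1 v w.
Proof. by move=> [s c]; apply/cong1_circle. Qed.

Lemma meridian_periodic : periodic1 (@meridian R).
Proof. by move=> v w /cong1_circle[s c]; rewrite /meridian -/(sn v) -/(cs v) s c. Qed.

Section Torus.
Variables (k k0 : R).
Hypothesis k2 : k ^+ 2 = 1.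

(** The tube of the diagram, parametrized forwards for [k = 1]; with [k = -1] the
   two factors are reversed, as the mirror image requires. *)
Definition tube_torus (x : R * R) : 'rV[R]_5 := stereo (tube4 eps (k * x.1) (meridian (k0 + k * x.2))).

Let k_neq0 : k != 0.
Proof. by apply/eqP => k0'; move: k2; rewrite k0' expr0n /= => /eqP; rewrite eq_sym oner_eq0. Qed.

Lemma smooth_tube_torus : smooth tube_torus.
Proof.
have s2 : smooth (fun x : R * R => k0 + k * x.2).
  apply: smoothD; first exact: smooth_cst.
  by apply: smoothM; [exact: smooth_cst|exact: smooth_snd].
apply: smooth_tube4.
- by apply: smoothM; [exact: smooth_cst|exact: smooth_fst].
- exact: smooth_comp (@smooth_sn R) s2.
- exact: smooth_comp (@smooth_cs R) s2.
Qed.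

Lemma tube_torus_embedded x y : tube_torus x = tube_torus y <-> cong1 x.1 y.1 /\ cong1 x.2 y.2.
Proof.
have ck (a b c : R) : cong1 (c + k * a) (c + k * b) = cong1 a b.
  rewrite /cong1 (_ : c + k * a - _ = k * (a - b)); last by ring.
  by move: k2 => /eqP; rewrite sqrf_eq1 => /orP[]/eqP->; rewrite ?mul1r// mulN1r rpredN.
split=> [/stereo_inj e|[c1 c2]]; last first.
  rewrite /tube_torus (tube4_periodic eps (meridian (k0 + k * x.2)) (_ : cong1 (k * x.1) (k * y.1))).
    by rewrite (@meridian_periodic _ (k0 + k * y.2))// ck.
  by rewrite -[k * x.1]add0r -[k * y.1]add0r ck.
have dm v := circle_disc (meridian_circle v).
(* the boundary of a normal disc at an under-crossing lies inside the thick tube,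
   where the torus has no points *)
have no (a b : R) : 2 * (meridian b).2 = (meridian a).2 -> (meridian b).1 = 0 -> False.
  move=> e1 e2; have [_ h] := disc_le1 (dm a); have := meridian_circle b.
  rewrite /circle /= /normsq e2 expr0n add0r => b1.
  have : (2 * (meridian b).2) ^+ 2 <= 1 by rewrite e1 -real_normK ?num_real// expr_le1.
  by rewrite exprMn b1; lra.
have [[c1 c2]|[ o [u [_ _ _ e1 e2]]]|[ o [u [_ _ _ e1 e2]]]] := tube4_meet (dm _) (dm _) e.
- by split; [rewrite -(ck _ _ 0) !add0r|rewrite -(ck _ _ k0); exact: meridian_inj].
- by case: (no _ _ e2 e1).
- by case: (no _ _ e2 e1).
Qed.

Lemma tube_torus_immersive x : immersive_at tube_torus x.
Proof.
move=> w; have D1 : is_derive x w (fun y : R * R => k * y.1) (k * w.1).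
  apply: (is_derive_linear (L := fun y : R * R => k * y.1)).
  - by move=> a u v; rewrite /= mulrDr; congr (_ + _); rewrite -![_ *: _]/(_ * _); ring.
  - by apply: smooth_continuous; apply: smoothM; [exact: smooth_cst|exact: smooth_fst].
have D2 : is_derive x w (fun y : R * R => k0 + k * y.2) (k * w.2).
  have D2 : is_derive x w (fun y : R * R => k * y.2) (k * w.2).
    apply: (is_derive_linear (L := fun y : R * R => k * y.2)).
    - by move=> a u v; rewrite /= mulrDr; congr (_ + _); rewrite -![_ *: _]/(_ * _); ring.
    - by apply: smooth_continuous; apply: smoothM; [exact: smooth_cst|exact: smooth_snd].
  have := is_deriveD (is_derive_cst k0 x w) D2; rewrite add0r; exact.
have D3 := is_derive_chain D2 (is_derive_sn _); have D4 := is_derive_chain D2 (is_derive_cs _).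
have [_ ->] := is_derive_stereo (is_derive_tube4 eps D1 D3 D4).
move=> /dstereo0 /(dtube4_inj e0 curv (circle_disc (meridian_circle (k0 + k * x.2)))).
move=> [/eqP]; rewrite mulf_eq0 (negbTE k_neq0) /= => /eqP w1 [/eqP h1 /eqP h2].
have w2 : w.2 = 0.
  apply/eqP; apply: contraT => w2; have kw : k * w.2 != 0 by rewrite mulf_neq0.
  move: h1 h2; rewrite -![_ *: _]/(_ * _) mulrN oppr_eq0 !mulf_eq0 (negbTE k_neq0) (negbTE w2) /=.
  have p0 : pi != 0 :> R by rewrite gt_eqF// pi_gt0.
  rewrite (negbTE p0) pnatr_eq0 /= => /eqP c0 /eqP s0.
  by have := cs2sn2 (k0 + k * x.2); rewrite c0 s0 expr0n /= addr0 => /eqP; rewrite eq_sym oner_eq0.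
by rewrite [w]surjective_pairing w1 w2.
Qed.

Lemma tube_torus_sphere x : sphere4 (tube_torus x).
Proof. exact: stereo_sphere. Qed.

End Torus.

Definition phi (x : R * (R * R)) : 'rV[R]_5 := stereo (tube4 eps x.1 x.2).

Lemma derive_phi x w : 'D_w phi x = dstereo (tube4 eps x.1 x.2) (dtube4 eps x.1 x.2 w.1 w.2).
Proof.
have I : is_derive x w (@idfun (R * (R * R))) w by exact: is_derive_id.
have lin (U : normedModType R) (L : R * (R * R) -> U) : linear L -> smooth L ->
    is_derive x w L (L w).
  move=> linL sL; exact: is_derive_linear linL (smooth_continuous sL) I.
have D1 : is_derive x w (fun y : R * (R * R) => y.1) w.1.
  by apply: (lin _ fst) => //; exact: smooth_fst.
have D2 : is_derive x w (fun y : R * (R * R) => y.2.1) w.2.1.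
  by apply: (lin _ (fun y => y.2.1)) => //; apply/smooth_comp_fst/smooth_snd.
have D3 : is_derive x w (fun y : R * (R * R) => y.2.2) w.2.2.
  by apply: (lin _ (fun y => y.2.2)) => //; apply/smooth_comp_snd/smooth_snd.
have [_] := is_derive_stereo (is_derive_tube4 eps D1 D2 D3).
rewrite -!surjective_pairing => <-; congr ('D_w _ x).
Qed.

Lemma smooth_phi : smooth phi.
Proof.
rewrite (_ : phi = fun x => stereo (tube4 eps x.1 (x.2.1, x.2.2))).
  by apply: smooth_tube4; [exact: smooth_fst|apply/smooth_comp_fst/smooth_snd|apply/smooth_comp_snd/smooth_snd].
by apply/funext => x; rewrite -surjective_pairing.
Qed.

Lemma normal_chart o u (b : R * R) s t : b.1 ^+ 2 = 1 -> b.2 ^+ 2 = 1 -> sgn o u ^+ 2 = 1 ->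
  velocity s = b -> velocity t = sgn o u *: perp b ->
  [/\ normal1 s = - (diag R * b.2), normal2 s = diag R * b.1,
      normal1 t = - (diag R * sgn o u * b.1) & normal2 t = - (diag R * sgn o u * b.2)].
Proof.
move=> b1 b2 g2 vs vt.
have := normal12 s; rewrite (normal_diagonal vs b1 b2) /perp pairZ => -[<- <-].
have := normal12 t; rewrite (normal_diagonal vt).
- by rewrite /perp pairZ /= => -[<- <-]; rewrite -![_ *: _]/(_ * _); split; ring.
- by rewrite /perp /= -[_ *: _]/(_ * _) exprMn g2 sqrrN b2 mulr1.
- by rewrite /perp /= -[_ *: _]/(_ * _) exprMn g2 b1 mulr1.
Qed.

(** The over-strand contributes its normal disc; the under-strand contributes the
   radial direction along the over-strand, and the slope of the height.  Together
   these span four-space. *)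
Lemma span_at o u s p q : over D o u -> `|s - o| <= window R ->
  forall xi, exists v w : R * (R * R),
    xi = dtube4 eps s p v.1 v.2 + dtube4 eps u q w.1 w.2.
Proof.
move=> ou so xi; have [b [[b1 b2 g2] H]] := classical_chart_sgn ou.
have w0 : `|0 : R| <= window R by rewrite normr0 /window; lra.
have [[_ _ vu _] _ _ _] := H 0 w0; have [[vs _ _ _] _ _ _] := H _ so.
rewrite addr0 in vu; rewrite addrC subrK in vs.
have [n1 n2 m1 m2] := normal_chart b1 b2 g2 vs vu.
have hu := height_slope ou; have d0 := diag_gt0 R; have dn : diag R != 0 by rewrite gt_eqF.
have gn : sgn o u != 0.
  by apply/eqP => g0; move: g2; rewrite g0 expr0n /= => /eqP; rewrite eq_sym oner_eq0.
have rs : radius eps s != 0 by rewrite gt_eqF// radius_gt0.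
have ru : radius eps u != 0 by rewrite gt_eqF// radius_gt0.
pose x i := xi ord0 i.
have xiE : xi = row4 (x (Ordinal (isT : 0 < 4)%N)) (x (Ordinal (isT : 1 < 4)%N))
    (x (Ordinal (isT : 2 < 4)%N)) (x (Ordinal (isT : 3 < 4)%N)).
  apply/rowP => i; rewrite row4E; case: i => -[|[|[|[|//]]]] i4 /=; congr (xi _ _); exact: val_inj.
move: (x _) (x _) (x _) (x _) xiE => x4 x3 x2 x1 ->.
pose a := x4 / 'D_1 (@height R) u.
have [y1 [y2 [y3 yE]]] : exists y1 y2 y3, dtube4 eps u q a 0 = row4 y1 y2 y3 x4.
  by rewrite /dtube4 /a divfK//; do 3 eexists.
pose c := (- b.2 * (x1 - y1) + b.1 * (x2 - y2)) / 2.
pose c' := (b.1 * (x1 - y1) + b.2 * (x2 - y2)) / 2.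
exists (0, (c / (radius eps s * diag R), (x3 - y3) / radius eps s)),
  (a, (- c' / (radius eps u * diag R * sgn o u), 0)).
have -> : dtube4 eps u q a (- c' / (radius eps u * diag R * sgn o u), 0) =
    dtube4 eps u q a 0 + row4 (c' * b.1) (c' * b.2) 0 0.
  rewrite /dtube4 row4D m1 m2 /=; congr row4; field; by rewrite ?gn ?ru ?dn.
have -> : dtube4 eps s p 0 (c / (radius eps s * diag R), (x3 - y3) / radius eps s) =
    row4 (- (c * b.2)) (c * b.1) (x3 - y3) 0.
  rewrite /dtube4 n1 n2 /=; congr row4; field; by rewrite ?rs ?dn.
rewrite yE !row4D /c /c'; congr row4.
- rewrite (_ : _ + _ = y1 + (x1 - y1) * (b.1 ^+ 2 + b.2 ^+ 2) / 2); last by field.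
  by rewrite b1 b2; field.
- rewrite (_ : _ + _ = y2 + (x2 - y2) * (b.1 ^+ 2 + b.2 ^+ 2) / 2); last by field.
  by rewrite b1 b2; field.
- ring.
- ring.
Qed.

(** The two preimages of the double disc at a crossing: a whole normal disc of the
   under-strand, and a disc inside the tube of the over-strand. *)
Definition under_disc (i : 'I_9) (x : R * R) : R * (R * R) := (grid (under_at i), x).

Definition over_disc (i : 'I_9) (x : R * R) : R * (R * R) :=
  (grid (over_at i) - eps * x.1 * diag R * sgn (grid (over_at i)) (grid (under_at i)), (0, x.2 / 2)).

Lemma over_grid (i : 'I_9) : over D (grid (over_at i)) (grid (under_at i)).
Proof. by exists (val i); split; [exact: ltn_ord|exact: cong1_refl..]. Qed.

Lemma over_disc_near i x : disc x -> `|(over_disc i x).1 - grid (over_at i)| <= window R.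
Proof. by move=> dx; have [h _] := crossing_disc e0 ew (over_grid i) dx; rewrite /= addrC addKr. Qed.

Lemma phi_discs i x : disc x -> phi (over_disc i x) = phi (under_disc i x).
Proof. by move=> dx; rewrite /phi; have [_ /= ->] := crossing_disc e0 ew (over_grid i) dx. Qed.

Lemma grid_near a b s t : (a < 80)%N -> (b < 80)%N -> `|s - grid a| <= window R ->
  `|t - grid b| <= window R -> cong1 s t -> a = b.
Proof.
move=> a80 b80 sa tb /cong1P[n st]; apply/eqP; apply: contraT => ab.
have tb' : `|t - grid b| <= 1 / 200 by move: tb; rewrite /window; lra.
have := @grid_far R a b (- n) t a80 b80 ab tb'.
by rewrite mulrNz opprK (_ : t - _ + _ = s - grid a); [move: sa; rewrite /window; lra|rewrite st; ring].
Qed.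

Lemma over_at_inj i j : (i < 9)%N -> (j < 9)%N -> over_at i = over_at j -> i = j.
Proof.
move=> i9 j9 /eqP ij; apply/eqP; move: ij; apply/implyP.
have := @all_iota 9 (fun i => all (fun j => (over_at i == over_at j) ==> (i == j)) (iota 0 9)) isT i i9.
by move/all_iota; apply.
Qed.

Lemma sgn_periodic o o' u u' : cong1 o o' -> cong1 u u' -> sgn o u = sgn o' u'.
Proof. by move=> oo uu; rewrite /sgn (velocity_periodic oo) (velocity_periodic uu). Qed.

Lemma meet_discs o u s t p q : over D o u -> disc q -> t = u ->
  s = o - eps * q.1 * diag R * sgn o u -> p.1 = 0 -> 2 * p.2 = q.2 ->
  exists i, solid_cong (s, p) (over_disc i q) /\ solid_cong (t, q) (under_disc i q).
Proof.
move=> [i [i9 oi ui]] dq -> -> p1 p2; exists (Ordinal i9); split; split=> //=.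
  by rewrite (sgn_periodic oi ui) cong1B.
by rewrite [p]surjective_pairing p1 -p2; congr (_, _); field.
Qed.

Lemma phi_ribbon : ribbon_immersion phi.
Proof.
split.
- exact: smooth_phi.
- by move=> p q [c1 c2]; rewrite /phi c2 (tube4_periodic eps q.2 c1).
- move=> p dp; split; first exact: stereo_sphere.
  move=> w; rewrite derive_phi => /dstereo0 /(dtube4_inj e0 curv dp)[w1 w2].
  by rewrite [w]surjective_pairing w1 w2.
- move=> p q dp dq npq /[dup] ppq /stereo_inj e w pw.
  have [xi ->] := dstereo_tangent pw.
  suff [v1 [v2 ->]] : exists v1 v2, xi = dtube4 eps p.1 p.2 v1.1 v1.2 + dtube4 eps q.1 q.2 v2.1 v2.2.
    by exists v1, v2; rewrite !derive_phi -e dstereoD.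
  have near o u x : over D o u -> disc x -> `|o - eps * x.1 * diag R * sgn o u - o| <= window R.
    by move=> ou dx; have [h _] := crossing_disc e0 ew ou dx; rewrite addrC addKr.
  have [[c1 c2]|[ o [u [ou eq ep _ _]]]|[ o [u [ou ep eq _ _]]]] := tube4_meet dp dq e.
  + by case: npq.
  + by rewrite eq; apply: (span_at _ _ ou); rewrite ep; exact: near.
  + rewrite ep; have [|v1 [v2 ->]] := @span_at o u q.1 q.2 p.2 ou _ xi; first by rewrite eq; exact: near.
    by exists v2, v1; exact: addrC.
exists 9%N, under_disc, over_disc.
have idx : smooth (fun x : R * R => x) by apply: (@smooth_linear _ _ _ idfun) => x; exact: cvg_id.
have u80 (i : 'I_9) := under_at80 (ltn_ord i); have o80 (i : 'I_9) := over_at80 (ltn_ord i).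
split.
- move=> i; split; first by apply: smooth_pair; [exact: smooth_cst|exact: idx].
  apply: smooth_pair.
    apply: smoothB; first exact: smooth_cst.
    apply: smoothM; last exact: smooth_cst.
    apply: smoothM; last exact: smooth_cst.
    by apply: smoothM; [exact: smooth_cst|exact: smooth_fst].
  apply: smooth_pair; first exact: smooth_cst.
  by apply: smoothM; [exact: smooth_snd|exact: smooth_cst].
- move=> i x dx; have I w : is_derive x w (fun y : R * R => y) w by exact: is_derive_id.
  split=> w.
    have [_ ->] := is_derive_pair (is_derive_cst (grid (under_at i)) x w) (I w).
    by move=> [].
  pose g := sgn (grid (over_at i)) (grid (under_at i)).
  pose c := - (eps * diag R * g).
  have D1 : is_derive x w (fun y : R * R => y.1) w.1.
    by apply: (is_derive_linear (L := fst)) (I w) => // z; exact: cvg_fst.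
  have D2 : is_derive x w (fun y : R * R => y.2) w.2.
    by apply: (is_derive_linear (L := snd)) (I w) => // z; exact: cvg_snd.
  have D3 := is_deriveD (is_derive_cst (grid (over_at i)) x w) (is_deriveZ c D1).
  have D4 := is_derive_pair D3 (is_derive_pair (is_derive_cst (0 : R) x w) (is_deriveZ (2^-1 : R) D2)).
  have -> : over_disc i = fun y => ((cst (grid (over_at i)) + c \*: (fun y : R * R => y.1)) y,
      (cst (0 : R) y, ((2^-1 : R) \*: (fun y : R * R => y.2)) y)).
    apply/funext => y; rewrite /over_disc -/g; congr (_, (_, _)); last exact: mulrC.
    by rewrite -[RHS]/(grid (over_at i) + c * y.1) /c; ring.
  have [_ ->] := D4; rewrite add0r => -[/eqP h1 /eqP h2].
  have [b [[_ _ g2] _]] := classical_chart_sgn (over_grid i).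
  have g0 : g != 0.
    by apply/eqP => g0; move: g2; rewrite -/g g0 expr0n /= => /eqP; rewrite eq_sym oner_eq0.
  have dn : diag R != 0 by rewrite gt_eqF// diag_gt0.
  have en : eps != 0 by rewrite gt_eqF.
  have c0 : c != 0 by rewrite oppr_eq0 (mulf_neq0 (mulf_neq0 en dn) g0).
  have w1 : w.1 = 0 by move: h1; rewrite scaler_eq0 (negbTE c0) => /eqP.
  have w2 : w.2 = 0 by move: h2; rewrite scaler_eq0 invr_eq0 pnatr_eq0 => /eqP.
  by rewrite [w]surjective_pairing w1 w2.
- move=> i x dx; split=> //; rewrite /open_disc /= /normsq /= expr0n add0r.
  have [_ x2] := disc_le1 dx; have : x.2 ^+ 2 <= 1 by rewrite -real_normK ?num_real// expr_le1.
  by rewrite expr_div_n; lra.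
- move=> i j x y dx dy.
  have near0 a : `|grid a - grid a| <= window R by rewrite subrr normr0 /window; lra.
  split.
  + move=> [c1 c2]; split=> //; apply: val_inj; apply: under_at_inj (ltn_ord i) (ltn_ord j) _.
    exact: grid_cong c1.
  + move=> [c1 []] c2; have ij : i = j.
      apply: val_inj; apply: over_at_inj (ltn_ord i) (ltn_ord j) _.
      exact: grid_near (o80 i) (o80 j) (over_disc_near i dx) (over_disc_near j dy) c1.
    split=> //; subst j.
    have h1 := over_disc_near i dx; have h2 := over_disc_near i dy.
    have e : (over_disc i x).1 = (over_disc i y).1.
      apply: cong1_small c1 _; apply: le_lt_trans (ler_distD (grid (over_at i)) _ _) _.
      by rewrite [X in _ + X]distrC; move: h1 h2; rewrite /window; lra.
    have [b [[_ _ g2] _]] := classical_chart_sgn (over_grid i).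
    have g0 : sgn (grid (over_at i)) (grid (under_at i)) != 0.
      by apply/eqP => g0; move: g2; rewrite g0 expr0n /= => /eqP; rewrite eq_sym oner_eq0.
    have dn : diag R != 0 by rewrite gt_eqF// diag_gt0.
    have en : eps != 0 by rewrite gt_eqF.
    move: e => /= /addrI /oppr_inj /(mulIf g0) /(mulIf dn) /(mulfI en) x1.
    have x2 : x.2 = y.2 by move: c2 => /= /mulIf; apply; rewrite invr_eq0 pnatr_eq0.
    by rewrite [x]surjective_pairing [y]surjective_pairing x1 x2.
  + move=> [c1 _]; have := grid_near (u80 i) (o80 j) (near0 _) (over_disc_near j dy) c1.
    by move=> e; have /eqP := over_not_under (ltn_ord j) (ltn_ord i); apply.
move=> p q dp dq npq.
have per x y : solid_cong x y -> phi x = phi y.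
  by move=> [c1 c2]; rewrite /phi c2 (tube4_periodic eps y.2 c1).
split=> [/stereo_inj e|[i [x [dx [[c1 c2]|[c1 c2]]]]]]; last first.
- by rewrite (per _ _ c1) (per _ _ c2) phi_discs.
- by rewrite (per _ _ c1) (per _ _ c2) phi_discs.
have [[c1 c2]|[ o [u [ou eq ep h1 h2]]]|[ o [u [ou ep eq h1 h2]]]] := tube4_meet dp dq e.
- by case: npq.
- have [i [d1 d2]] := meet_discs ou dq eq ep h1 h2.
  by exists i, q.2; split=> //; right; move: d1 d2; rewrite -!surjective_pairing.
- have [i [d1 d2]] := meet_discs ou dp ep eq h1 h2.
  by exists i, p.2; split=> //; left; move: d1 d2; rewrite -!surjective_pairing.
Qed.

Lemma range_phi : range (tube_torus 1 0) = phi @` [set p | circle p.2].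
Proof.
apply/seteqP; split => y /=.
  move=> [x _ <-]; exists (1 * x.1, meridian (0 + 1 * x.2)) => //=.
  exact: meridian_circle.
move=> [[s p] /= /circle_meridian[v pv] <-]; exists (s, v); first exact: I.
by rewrite /tube_torus /phi !mul1r add0r pv.
Qed.

End Ribbon.

(** * The half-turn exchanges the tubes of the two diagrams *)

Section MirrorTube.
Variables (R : realType) (D : welded_diagram R) (r z h : R -> R).
Implicit Types (s t v : R) (p q : R * R) (y : (R * R) * R).

Definition half_turn y : (R * R) * R := ((y.1.1, - y.1.2), - y.2).
Definition flip p : R * R := (p.1, - p.2).

Lemma half_turn_inj : injective half_turn.
Proof. by move=> [[a b] c] [[a' b'] c'] [-> /oppr_inj -> /oppr_inj ->]. Qed.

Lemma flipK : involutive flip.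
Proof. by move=> [a b]; rewrite /flip /= opprK. Qed.

Lemma normsq_flip p : normsq (flip p) = normsq p.
Proof. by rewrite /normsq /flip /= sqrrN. Qed.

Lemma flip_meridian v : flip (meridian v) = meridian (1 / 2 - v).
Proof.
rewrite /flip /meridian /=; congr (_, _); first by rewrite -/(sn v) -/(sn (1 / 2 - v)) sn_halfB.
have -> : 2 * pi * (1 / 2 - v) = pi - 2 * pi * v by field.
by rewrite cosB cospi sinpi mul0r addr0 mulN1r.
Qed.

(** The half-turn about the first axis reflects the plane of the diagram and the
   altitude.  The normal of the reversed mirror curve is the reflected normal,
   so that a point of the tube keeps its side of the strand. *)
Lemma tube_disc_mirror s p :
  tube_disc (mirror_curve D) (r \o -%R) (fun s => - z (- s)) s p =
  half_turn (tube_disc D r z (- s) (flip p)).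
Proof.
rewrite /tube_disc /half_turn /flip /= /unit_normal derive1_mirror.
rewrite (_ : normsq (- _, _) = normsq (derive1 D (- s))); last by rewrite /normsq /= sqrrN.
congr (_, _); last by rewrite opprD mulrN opprK.
rewrite /mirror_curve !pairZ; case: (D (- s)) => a b; rewrite !pairD /=; congr (_, _).
by rewrite -![_ *: _]/(_ * _); ring.
Qed.

(** Two reversals cancel at a crossing: the parameters where a line of the thin
   tube enters and leaves the thick one are negated, and their sides are kept, so
   that the condition on the heights is the one for the original diagram. *)
Lemma mirror_tube_data : tube_data D r z h ->
  tube_data (mirror_diagram D) (r \o -%R) (fun s => - z (- s)) (h \o -%R).
Proof.
move=> [[sr [sz sh]] [pr [pz ph]] r0 [e e0 [win dis away cross]]].
have cN s t : cong1 s t -> cong1 (- s) (- t) by rewrite cong1N.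
split.
- split; first exact: smooth_reverse sr.
  by split; [apply: smoothN; exact: smooth_reverse sz|exact: smooth_reverse sh].
- split; first by move=> s t /cN/pr.
  by split; [move=> s t /cN/pz ->|move=> s t /cN/ph].
- by move=> s; exact: r0.
have dN s t : `|- s - - t| = `|s - t| by rewrite opprK addrC distrC.
have df p : disc (flip p) <-> disc p by rewrite /disc /= normsq_flip.
have cf p : circle (flip p) <-> circle p by rewrite /circle /= normsq_flip.
exists e; first exact: e0.
split.
- move=> s s' t t' /mirror_crossing c1 /mirror_crossing c2 st; rewrite -dN; apply: win c1 c2 _.
  by apply: contraNneq st => /oppr_inj ->.
- move=> s t p q /df dp /df dq; rewrite !tube_disc_mirror => /half_turn_inj E.
  have [c|[ o [u [ou so tu]]]|[ o [u [ou so tu]]]] := dis _ _ _ _ dp dq E.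
  + by apply: Or31; rewrite -cong1N.
  + apply: Or32; exists (- o), (- u); split; [|by rewrite -dN opprK|by rewrite -dN opprK].
    by rewrite /= /mirror_over !opprK.
  + apply: Or33; exists (- o), (- u); split; [|by rewrite -dN opprK|by rewrite -dN opprK].
    by rewrite /= /mirror_over !opprK.
- move=> t H; apply: away => o u ou; rewrite -dN opprK; apply: (H (- o)).
  by rewrite /= /mirror_over !opprK.
move=> o u ou; have [rlt hits] := cross (- o) (- u) ou; split.
  by move=> s t so tu; apply: rlt; rewrite dN.
move=> v; have [tL [tR [tLu tRu hh inside sides]]] := hits (1 / 2 - v).
have hitE s t p : `|s - o| <= e /\ tube_disc (mirror_curve D) (r \o -%R) (fun s => - z (- s)) s p =
      tube_disc (mirror_curve D) (r \o -%R) (fun s => - z (- s)) t (meridian v) <->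
    `|- s - - o| <= e /\ tube_disc D r z (- s) (flip p) = tube_disc D r z (- t) (meridian (1 / 2 - v)).
  rewrite !tube_disc_mirror dN flip_meridian.
  split=> -[so E].
    by split; [exact: so|exact: half_turn_inj E].
  by split; [exact: so|exact: (congr1 half_turn E)].
exists (- tL), (- tR); split.
- by rewrite -dN opprK.
- by rewrite -dN opprK.
- by rewrite /= !opprK.
- move=> t tu; have tu' : `|- t - - u| <= e by rewrite dN.
  rewrite (_ : (t - - tL) * (t - - tR) = (- t - tL) * (- t - tR)); last by ring.
  split=> [[s [p [dp H]]]|/(inside _ tu')[s [p [dp [so E]]]]].
    by apply/(inside _ tu'); exists (- s), (flip p); split; [exact/df|exact/hitE].
  exists (- s), (flip p); split; first exact/df.
  apply/hitE; rewrite opprK flipK; exact: (conj so E).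
move=> t tu; have tu' : `|- t - - u| <= e by rewrite dN.
have [sL sR s0] := sides _ tu'; split.
- split=> [[s [p [cp H p0]]]|te].
    rewrite -[t]opprK; congr (- _); apply/sL.
    by exists (- s), (flip p); split; [exact/cf|exact/hitE|].
  have tE : - t = tL by rewrite te opprK.
  have [s [p [cp [so E] p0]]] := sL.2 tE.
  exists (- s), (flip p); split; [exact/cf|apply/hitE; rewrite opprK flipK; exact: (conj so E)|exact: p0].
- split=> [[s [p [cp H p0]]]|te].
    rewrite -[t]opprK; congr (- _); apply/sR.
    by exists (- s), (flip p); split; [exact/cf|exact/hitE|].
  have tE : - t = tR by rewrite te opprK.
  have [s [p [cp [so E] p0]]] := sR.2 tE.
  exists (- s), (flip p); split; [exact/cf|apply/hitE; rewrite opprK flipK; exact: (conj so E)|exact: p0].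
- by move=> s p cp /hitE H; exact: (s0 (- s) (flip p) ((cf p).2 cp) H).
Qed.

End MirrorTube.

Section Rotation.
Variable R : realType.

Definition row5 (a b c d e : R) : 'rV[R]_5 := \row_i [:: a; b; c; d; e]`_i.

Lemma row5E a b c d e (i : 'I_5) : row5 a b c d e ord0 i = [:: a; b; c; d; e]`_i.
Proof. by rewrite mxE. Qed.

Definition i0 : 'I_5 := @Ordinal 5 0 isT.
Definition i1 : 'I_5 := @Ordinal 5 1 isT.
Definition i2 : 'I_5 := @Ordinal 5 2 isT.
Definition i3 : 'I_5 := @Ordinal 5 3 isT.
Definition i4 : 'I_5 := @Ordinal 5 4 isT.

Lemma row5_eta (x : 'rV[R]_5) : x = row5 (x ord0 i0) (x ord0 i1) (x ord0 i2) (x ord0 i3) (x ord0 i4).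
Proof.
apply/rowP => i; rewrite row5E; case: i => -[|[|[|[|[|//]]]]] i5 /=; congr (x _ _); exact: val_inj.
Qed.

Definition rotate (c s : R) (x : 'rV[R]_5) : 'rV[R]_5 :=
  row5 (x ord0 i0) (c * x ord0 i1 - s * x ord0 i2) (s * x ord0 i1 + c * x ord0 i2)
       (x ord0 i3) (x ord0 i4).

Lemma rotateK c s : c ^+ 2 + s ^+ 2 = 1 -> cancel (rotate c s) (rotate c (- s)).
Proof.
move=> cs1 x; rewrite [RHS]row5_eta {1}/rotate !row5E /=; congr row5.
  by rewrite -[RHS]mul1r -cs1; ring.
by rewrite -[RHS]mul1r -cs1; ring.
Qed.

Lemma dot5 (x : 'rV[R]_5) : dot x x = x ord0 i0 ^+ 2 + x ord0 i1 ^+ 2 + x ord0 i2 ^+ 2 +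
  x ord0 i3 ^+ 2 + x ord0 i4 ^+ 2.
Proof.
rewrite /dot !big_ord_recr big_ord0 /= add0r !expr2.
by do !congr (_ + _); congr (x _ _ * x _ _); exact: val_inj.
Qed.

Lemma rotate_sphere c s x : c ^+ 2 + s ^+ 2 = 1 -> sphere4 x -> sphere4 (rotate c s x).
Proof.
rewrite /sphere4 /= !dot5 /rotate !row5E /= => cs1 <-.
have -> : (c * x ord0 i1 - s * x ord0 i2) ^+ 2 = (c ^+ 2 + s ^+ 2) * (x ord0 i1 ^+ 2 + x ord0 i2 ^+ 2)
  - (s * x ord0 i1 + c * x ord0 i2) ^+ 2 by ring.
by rewrite cs1; ring.
Qed.

Lemma smooth_rotate (V : normedModType R) (c s : V -> R) (f : V -> 'rV[R]_5) :
  smooth c -> smooth s -> smooth f -> smooth (fun x => rotate (c x) (s x) (f x)).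
Proof.
move=> sc ss sf; have sfi i := smooth_comp_coord i sf.
apply: smooth_mx => i.
have -> : (fun x => rotate (c x) (s x) (f x) ord0 i) = fun x =>
    [:: f x ord0 i0; c x * f x ord0 i1 - s x * f x ord0 i2; s x * f x ord0 i1 + c x * f x ord0 i2;
        f x ord0 i3; f x ord0 i4]`_i by apply/funext => x; rewrite row5E.
case: i => -[|[|[|[|[|//]]]]] i5 /=; try exact: sfi.
- by apply: smoothB; apply: smoothM.
- by apply: smoothD; apply: smoothM.
Qed.

(** Rotation by half a turn of the plane of the second and third coordinates,
   which commutes with stereographic projection. *)
Definition rotation (x : R * 'rV[R]_5) := rotate (cs (x.1 / 2)) (sn (x.1 / 2)) x.2.

Lemma rotation_isotopy : ambient_isotopy (@sphere4 R) rotation.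
Proof.
have sh : smooth (fun x : R * 'rV[R]_5 => x.1 / 2).
  by apply: smoothM; [exact: smooth_fst|exact: smooth_cst].
have sc := smooth_comp (@smooth_cs R) sh; have ss := smooth_comp (@smooth_sn R) sh.
have s2 : smooth (fun x : R * 'rV[R]_5 => x.2) by exact: smooth_snd.
split; first exact: smooth_rotate.
- move=> x _; rewrite /rotation mul0r cs0 /sn mulr0 sin0 /rotate !mul1r !mul0r subr0 add0r.
  by rewrite -row5_eta.
exists (fun x => rotate (cs (x.1 / 2)) (- sn (x.1 / 2)) x.2).
  by apply: smooth_rotate => //; exact: smoothN.
move=> t x _ Sx; have c1 := cs2sn2 (t / 2).
have c1' : cs (t / 2) ^+ 2 + (- sn (t / 2)) ^+ 2 = 1 by rewrite sqrrN.
split; rewrite /rotation /=; [exact: rotate_sphere|exact: rotate_sphere|exact: rotateK|].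
by have := rotateK c1' x; rewrite opprK.
Qed.

Lemma rotation_end (x : 'rV[R]_5) : rotation (1, x) = rotate (-1) 0 x.
Proof.
rewrite /rotation /= /cs /sn (_ : 2 * pi * (1 / 2) = pi :> R); last by field.
by rewrite cospi sinpi.
Qed.

Lemma rotate0 (c s : R) : rotate c s 0 = 0.
Proof.
rewrite [RHS]row5_eta /rotate !mxE !mulr0 subr0 addr0; congr row5.
Qed.

Lemma rotate_linear : linear (rotate (-1) 0).
Proof.
move=> a u v; rewrite [RHS]row5_eta /rotate !mxE; congr row5; rewrite /=; ring.
Qed.

Lemma rotate_stereo a b c d :
  rotate (-1) 0 (stereo (row4 a b c d)) = stereo (row4 a (- b) (- c) d).
Proof.
have dE (p q u v : R) : dot (row4 p q u v) (row4 p q u v) = p ^+ 2 + q ^+ 2 + u ^+ 2 + v ^+ 2.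
  by rewrite /dot !big_ord_recr big_ord0 /= !row4E /= add0r !expr2.
rewrite [RHS]row5_eta /rotate.
have E (x : 'rV[R]_4) : [/\ stereo x ord0 i0 = (dot x x + 1)^-1 * (2 * x ord0 (@Ordinal 4 0 isT)),
   stereo x ord0 i1 = (dot x x + 1)^-1 * (2 * x ord0 (@Ordinal 4 1 isT)),
   stereo x ord0 i2 = (dot x x + 1)^-1 * (2 * x ord0 (@Ordinal 4 2 isT)) &
   stereo x ord0 i3 = (dot x x + 1)^-1 * (2 * x ord0 (@Ordinal 4 3 isT)) /\
   stereo x ord0 i4 = (dot x x + 1)^-1 * (dot x x - 1)].
  split; [| | |split]; rewrite -?(stereo_l x) -?(stereo_r x ord0); congr (stereo x _ _); exact: val_inj.
have [E0 E1 E2 [E3 E4]] := E (row4 a b c d).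
have [F0 F1 F2 [F3 F4]] := E (row4 a (- b) (- c) d).
rewrite E0 E1 E2 E3 E4 F0 F1 F2 F3 F4 !dE !row4E /= !sqrrN; congr row5; ring.
Qed.

End Rotation.

Section Main.
Variable R : realType.

Lemma curvature_small : \forall eps \near (0 : R)^'+, curvature_bound eps.
Proof.
have [K [K1 _ _ HK]] := velocity_bounded R.
near=> eps => s; have [d dv [d1 d2]] := HK s; exists d => //.
have e0 : 0 < eps by near: eps; exact: nbhs_right_gt.
have eK : eps < 1 / (8 * K).
  by near: eps; apply: nbhs_right_lt; rewrite divr_gt0// mulr_gt0//; lra.
have {}eK : 8 * eps * K < 1 by move: eK; rewrite ltr_pdivlMr ?mulr_gt0//; lra.
have : eps * (`|d.1| + `|d.2|) <= eps * (2 * K) by rewrite ler_wpM2l ?(ltW e0)//; lra.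
by lra.
Unshelve. all: by end_near. Qed.

Lemma thin_tube : exists eps : R, [/\ 0 < eps, 2 * eps < window R, curvature_bound eps &
  forall s t p q, disc p -> disc q -> tube eps s p = tube eps t q ->
    [\/ cong1 s t, pass s t | pass t s]].
Proof.
have [eps] : exists eps : R, (0 < eps /\ eps < window R / 2) /\ (curvature_bound eps /\
  forall s t p q, disc p -> disc q -> tube eps s p = tube eps t q ->
    [\/ cong1 s t, pass s t | pass t s]).
  apply: (@filter_ex _ (0 : R)^'+).
  have w0 : 0 < window R / 2 by rewrite /window; lra.
  apply: filterI; last by apply: filterI; [exact: curvature_small|exact: tube_disjoint].
  by apply: filterI; [exact: nbhs_right_gt|exact: nbhs_right_lt].
by move=> [[e0 ew] [cu di]]; exists eps; split=> //; lra.
Qed.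

Section Fixed.
Variable eps : R.
Hypotheses (e0 : 0 < eps) (ew : 2 * eps < window R) (cu : curvature_bound eps).
Hypothesis di : forall s t p q, disc p -> disc q -> tube eps s p = tube eps t q ->
    [\/ cong1 s t, pass s t | pass t s].

Let one2 : (1 : R) ^+ 2 = 1. Proof. exact: expr1n. Qed.
Let mone2 : (-1 : R) ^+ 2 = 1. Proof. by rewrite sqrrN expr1n. Qed.

Definition chiral_torus : torus_knot R :=
  TorusKnot (smooth_tube_torus eps 1 0) (tube_torus_sphere eps 1 0)
    (@tube_torus_embedded R eps e0 ew di 1 0 one2) (@tube_torus_immersive R eps e0 cu 1 0 one2).

(** The half-turn of the torus with both parameters reversed: this is the
   parametrization that the tube formula of the mirror image produces. *)
Definition mirror_map x := rotate (-1) 0 (tube_torus eps (-1) (1 / 2) x).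

Let cs0' : (-1 : R) ^+ 2 + 0 ^+ 2 = 1.
Proof. by rewrite mone2 expr0n addr0. Qed.

Lemma rotateKK : cancel (@rotate R (-1) 0) (rotate (-1) 0).
Proof. by move=> x; have := rotateK cs0' x; rewrite oppr0. Qed.

Lemma smooth_mirror_map : smooth mirror_map.
Proof. by apply: smooth_rotate; [exact: smooth_cst|exact: smooth_cst|exact: smooth_tube_torus]. Qed.

Lemma mirror_map_sphere x : sphere4 (mirror_map x).
Proof. exact/rotate_sphere/tube_torus_sphere. Qed.

Lemma mirror_map_embedded x y : mirror_map x = mirror_map y <-> cong1 x.1 y.1 /\ cong1 x.2 y.2.
Proof.
rewrite -(@tube_torus_embedded R eps e0 ew di (-1) (1 / 2) mone2); split=> [|e]; last by rewrite /mirror_map e.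
exact: (can_inj rotateKK).
Qed.

Lemma mirror_map_immersive x : immersive_at mirror_map x.
Proof.
move=> w; have cr : continuous (@rotate R (-1) 0).
  apply: smooth_continuous; apply: (smooth_rotate (f := fun x => x)); [exact: smooth_cst..|].
  by apply: (@smooth_linear _ _ _ idfun) => z; exact: cvg_id.
have D0 : is_derive x w (tube_torus eps (-1) (1 / 2)) ('D_w (tube_torus eps (-1) (1 / 2)) x).
  by split; [exact: smooth_derivable (@smooth_tube_torus R eps (-1) (1 / 2)) x w|reflexivity].
have [_ ->] := is_derive_linear (@rotate_linear R) cr D0.
move=> r0; apply: (@tube_torus_immersive R eps e0 cu (-1) (1 / 2) mone2 x).
by rewrite -[LHS]rotateKK r0 rotate0.
Qed.

Definition mirror_torus : torus_knot R :=
  TorusKnot smooth_mirror_map mirror_map_sphere mirror_map_embedded mirror_map_immersive.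

Lemma tube_chiral : is_tube (chiral_diagram R) chiral_torus.
Proof.
exists (radius eps), (@altitude R), (@height R); split; first exact: chiral_tube_data.
move=> s v p; have pE : p = tube eps s (meridian v) by exact: tubeE.
by rewrite pE /= /tube_torus /= !mul1r add0r.
Qed.

Lemma tube_mirror : is_tube (mirror_diagram (chiral_diagram R)) mirror_torus.
Proof.
exists (radius eps \o -%R), (fun s => - altitude (- s)), (@height R \o -%R); split.
  exact/mirror_tube_data/chiral_tube_data.
move=> s v p.
have pE : p = half_turn (tube eps (- s) (meridian (1 / 2 - v))).
  have E := tube_disc_mirror (chiral_diagram R) (radius eps) (@altitude R) s (meridian v).
  by rewrite flip_meridian in E; rewrite -tubeE; exact: E.
by rewrite pE /= /mirror_map /tube_torus /= !mulN1r /tube4 rotate_stereo.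
Qed.

Lemma chiral_ribbon : ribbon chiral_torus.
Proof. exists (phi eps); [exact: phi_ribbon|exact: range_phi]. Qed.

Lemma torus_isotopic_refl (T : torus_knot R) : torus_isotopic T T.
Proof.
have id2 : smooth (fun x : R * R => x) by apply: (@smooth_linear _ _ _ idfun) => x; exact: cvg_id.
have s2 : smooth (fun x : R * 'rV[R]_5 => x.2) by exact: smooth_snd.
exists (fun x => x.2), (fun p => p); split=> //.
- by split=> //; exists (fun x => x.2).
- move=> p; have D w : 'D_w (fun p : R * R => p) p = w by have [_ ->] := is_derive_id p w.
  by rewrite !D /det2 /= !mulr1 mulr0 subr0.
Qed.

(** The half-turn is the end of a rotation, and on the torus it becomes
   [(s, v) |-> (- s, 1/2 - v)], whose determinant is 1. *)
Lemma mirror_isotopic : torus_isotopic mirror_torus chiral_torus.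
Proof.
pose g (p : R * R) : R * R := (- p.1, 1 / 2 - p.2).
have D p w : 'D_w g p = (- w.1, - w.2).
  have I : is_derive p w (fun y : R * R => y) w by exact: is_derive_id.
  have D1 : is_derive p w (fun y : R * R => y.1) w.1.
    by apply: (is_derive_linear (L := fst)) I => // y; exact: cvg_fst.
  have D2 : is_derive p w (fun y : R * R => y.2) w.2.
    by apply: (is_derive_linear (L := snd)) I => // y; exact: cvg_snd.
  have := is_derive_pair (is_deriveN D1) (is_deriveB (is_derive_cst (1 / 2 : R) p w) D2).
  by rewrite sub0r => -[_].
exists (@rotation R), g; split.
- exact: rotation_isotopy.
- by apply: smooth_pair; [apply: smoothN; exact: smooth_fst|apply: smoothB; [exact: smooth_cst|exact: smooth_snd]].
- by move=> p; rewrite !D /det2 /= oppr0 mulrNN !mulr1 mul0r subr0.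
move=> p; rewrite rotation_end /= /mirror_map rotateKK /tube_torus /g /=.
by rewrite !mulN1r !mul1r add0r.
Qed.

End Fixed.

Definition knot_class (D : welded_diagram R) : welded_knot R :=
  @WeldedKnot R [set E | welded_equiv D E] (ex_intro _ D erefl).

Lemma knot_class_self D : diagrams (knot_class D) D.
Proof. exact: Relation_Operators.rst_refl. Qed.

End Main.

Theorem theorem3p7 (R : realType) :
  exists S : torus_knot R, ribbon S /\
    exists K L : welded_knot R,
      K <> L /\ Tube_fiber S K /\ Tube_fiber S L.
Proof.
have [eps [e0 ew cu di]] := thin_tube R.
exists (chiral_torus e0 ew cu di); split; first exact: chiral_ribbon.
pose D := chiral_diagram R.
exists (knot_class D), (knot_class (mirror_diagram D)); split; [|split].
- move=> e; apply: (@mirror_not_equivalent R).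
  have : diagrams (knot_class (mirror_diagram D)) (mirror_diagram D) by exact: knot_class_self.
  by rewrite -e.
- exists D, (chiral_torus e0 ew cu di); split.
  + exact: knot_class_self.
  + exact: tube_chiral.
  + exact: torus_isotopic_refl.
- exists (mirror_diagram D), (mirror_torus e0 ew cu di); split.
  + exact: knot_class_self.
  + exact: tube_mirror.
  + exact: mirror_isotopic.
Qed.
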